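(* Let $A=(a_{i,j})\in\mathbb{Z}^{d\times n}$ be an integer matrix whose columns span a positive affine semigroup $\mathbb{N}A$ such that $\mathbb{Z}A=\mathbb{Z}^d$, and assume that $S_A=\mathbb{C}[\mathbb{N}A]$ is a Cohen--Macaulay ring. Then the Euler--Koszul complex $K_\bullet(S_A,\beta)$ is acyclic for all $\beta\in\mathbb{C}^d$, i.e. its homology vanishes in all positive homological degrees.
   Context: $\mathbb{N}A$ and $\mathbb{Z}A$ are the monoid and the group generated by the columns $\mathbf{a}_1,\dots,\mathbf{a}_n$ of $A$; positive means that $0$ is the only invertible element of $\mathbb{N}A$. $D_A$ is the Weyl algebra over $\mathbb{C}$ in variables $x_1,\dots,x_n$ with $\partial_j=\partial/\partial x_j$, and $R_A=\mathbb{C}[\partial_1,\dots,\partial_n]\subseteq D_A$. The toric ideal $I_A\subseteq R_A$ is generated by all $\partial^{\mathbf{u}_+}-\partial^{\mathbf{u}_-}$ with $\mathbf{u}\in\ker A\cap\mathbb{Z}^n$, where $(\mathbf{u}_+)_j=\max(0,\mathbf{u}_j)$ and $\mathbf{u}_-=\mathbf{u}_+-\mathbf{u}$; and $S_A=R_A/I_A\cong\mathbb{C}[t^{\mathbf{a}_1},\dots,t^{\mathbf{a}_n}]=\mathbb{C}[\mathbb{N}A]$. The Euler operators are $E_i=\sum_{j=1}^n a_{i,j}x_j\partial_j$, $i=1,\dots,d$. Give $D_A$ the $\mathbb{Z}^d$-grading with $\deg(\partial_j)=-\mathbf{a}_j$, $\deg(x_j)=\mathbf{a}_j$, and write $\deg_i$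 for the $i$-th component of the degree. For a $\mathbb{Z}^d$-graded $R_A$-module $N$ and $\beta\in\mathbb{C}^d$, the Euler--Koszul complex $K_\bullet(N,\beta)$ is the Koszul complex of the $d$ commuting left $D_A$-linear endomorphisms $E_i-\beta_i$ of $D_A\otimes_{R_A}N$, where $E_i$ acts by $E_i\circ y=(E_i-\deg_i(y))y$ for $\mathbb{Z}^d$-homogeneous $y\in D_A\otimes_{R_A}N$ (extended $\mathbb{C}$-linearly) and $\beta_i$ acts as a scalar. Its $0$-th homology for $N=S_A$ is $D_A/\langle E_1-\beta_1,\dots,E_d-\beta_d,I_A\rangle$. *)

(* Defs.v *)
From HB Require Import structures.
From mathcomp Require Import all_boot all_order all_algebra.
From mathcomp Require Import ring_quotient generic_quotient.
From mathcomp Require Import boolp.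
From mathcomp.multinomials Require Import freeg mpoly.

Set Implicit Arguments.
Unset Strict Implicit.
Unset Printing Implicit Defensive.

Import Order.TTheory GRing.Theory Num.Theory.

Local Open Scope ring_scope.
Local Open Scope quotient_scope.

Section CohenMacaulay.
Variable S : comNzRingType.

Definition ideal_span (G : S -> Prop) : {pred S} :=
  fun x => `[< exists (k : nat) (a g : 'I_k -> S),
                 (forall i, G (g i)) /\ x = \sum_i a i * g i >].

Definition ideal_of (s : seq S) : {pred S} := ideal_span (fun x => x \in s).

(* [idealr_closed] only describes proper ideals; the unit ideal, which it
   omits, is always generated by 1. *)
Definition noetherian : Prop :=
  forall I : {pred S}, idealr_closed I -> exists s : seq S, I =i ideal_of s.

Definition prime_ideal (P : {pred S}) : Prop :=
  idealr_closed P /\ prime_idealr_closed P.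

Definition maximal_ideal (M : {pred S}) : Prop :=
  idealr_closed M /\
  forall I : {pred S}, idealr_closed I -> {subset M <= I} -> I =i M.

Definition regular_sequence (s : seq S) : Prop :=
  (forall i, (i < size s)%N ->
     forall x, s`_i * x \in ideal_of (take i s) -> x \in ideal_of (take i s))
  /\ 1 \notin ideal_of s.

Definition depth_ge (I : {pred S}) (k : nat) : Prop :=
  exists s : seq S, [/\ size s = k, {subset s <= I} & regular_sequence s].

Definition codim_ge (P : {pred S}) (k : nat) : Prop :=
  exists Q : nat -> {pred S},
    [/\ forall i, (i <= k)%N -> prime_ideal (Q i),
        forall i, (i < k)%N ->
          {subset Q i <= Q i.+1} /\ ~ {subset Q i.+1 <= Q i}
      & Q k =i P].

(* Eisenbud, Commutative Algebra, 18.2: depth P = codim P for all maximal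
   ideals P; the two suprema are compared through their lower bounds. *)
Definition cohen_macaulay : Prop :=
  noetherian /\
  forall P : {pred S}, maximal_ideal P ->
    forall k : nat, depth_ge P k <-> codim_ge P k.

Lemma ideal_span_gen (G : S -> Prop) a g : G g -> a * g \in ideal_span G.
Proof.
move=> Gg; apply/asboolP; exists 1%N, (fun=> a), (fun=> g).
by split=> // ; rewrite big_ord1.
Qed.

Lemma ideal_span_closed (G : S -> Prop) a :
  {in ideal_span G &, forall u v, a * u + v \in ideal_span G}.
Proof.
move=> u v /asboolP [k [b [g [Gg ->]]]] /asboolP [l [c [h [Gh ->]]]].
apply/asboolP; exists (k + l)%N.
exists (fun i => match split i with inl j => a * b j | inr j => c j end).
exists (fun i => match split i with inl j => g j | inr j => h j end).
split=> [i|]; first by case: (split i).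
rewrite big_split_ord /= mulr_sumr; congr (_ + _); apply: eq_bigr => i _.
  by have := unsplitK (inl i : 'I_k + 'I_l); rewrite /= => ->; rewrite mulrA.
by have := unsplitK (inr i : 'I_k + 'I_l); rewrite /= => ->.
Qed.

Lemma ideal_span0 (G : S -> Prop) : 0 \in ideal_span G.
Proof.
apply/asboolP; exists 0%N, (fun=> 0), (fun=> 0).
by split=> [[]|]; rewrite ?big_ord0.
Qed.

Lemma ideal_span_ind (G : S -> Prop) (P : S -> Prop) :
  P 0 -> (forall x y, P x -> P y -> P (x + y)) ->
  (forall a g, G g -> P (a * g)) -> forall x, x \in ideal_span G -> P x.
Proof.
move=> P0 PD Pg x /asboolP [k [a [g [Gg ->]]]].
by apply: (big_ind P) => // i _; apply: Pg.
Qed.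

End CohenMacaulay.

(* In characteristic 0 the Weyl algebra is the algebra of operators on
   K[x_1,...,x_n] generated by the scalars, the x_j and the d_j = d/dx_j. *)
Section Weyl.
Variables (K : numFieldType) (n : nat).
Local Notation Kx := {mpoly K[n]}.

Inductive weyl_op : (Kx -> Kx) -> Prop :=
| weyl_op_scale c : weyl_op (fun f => c *: f)
| weyl_op_x j : weyl_op (fun f => 'X_j * f)
| weyl_op_d j : weyl_op (fun f => f^`M(j))
| weyl_op_add P Q : weyl_op P -> weyl_op Q -> weyl_op (fun f => P f + Q f)
| weyl_op_mul P Q : weyl_op P -> weyl_op Q -> weyl_op (fun f => P (Q f)).

Record weyl := Weyl { weyl_fun :> Kx -> Kx; weyl_funP : weyl_op weyl_fun }.

Lemma weyl_eq (P Q : weyl) : (forall f, P f = Q f) -> P = Q.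
Proof.
case: P Q => [P pP] [Q pQ] /= /funext eqPQ.
by subst Q; congr Weyl; exact: Prop_irrelevance.
Qed.

HB.instance Definition _ := gen_eqMixin weyl.
HB.instance Definition _ := gen_choiceMixin weyl.

Lemma weyl_linear (P : weyl) : linear P.
Proof.
case: P => P /=; elim => {P}.
- by move=> c a f g; rewrite scalerDr !scalerA mulrC.
- by move=> j a f g; rewrite mulrDr scalerAr.
- by move=> j a f g; rewrite mderivD mderivZ.
- by move=> P Q _ hP _ hQ a f g; rewrite hP hQ scalerDr addrACA.
- by move=> P Q _ hP _ hQ a f g; rewrite hQ hP.
Qed.

Lemma weyl_funD (P : weyl) f g : P (f + g) = P f + P g.
Proof. by rewrite -[f]scale1r weyl_linear !scale1r. Qed.

Lemma weyl_fun0 (P : weyl) : P 0 = 0.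
Proof. by apply: (addrI (P 0)); rewrite -weyl_funD !addr0. Qed.

Lemma weyl_funZ (P : weyl) c f : P (c *: f) = c *: P f.
Proof. by rewrite -[c *: f]addr0 weyl_linear weyl_fun0 addr0. Qed.

Definition weyl_scale c (P : weyl) : weyl :=
  Weyl (weyl_op_mul (weyl_op_scale c) (weyl_funP P)).
Definition weyl_add (P Q : weyl) : weyl :=
  Weyl (weyl_op_add (weyl_funP P) (weyl_funP Q)).
Definition weyl_mul (P Q : weyl) : weyl :=
  Weyl (weyl_op_mul (weyl_funP P) (weyl_funP Q)).
Definition weyl_zero : weyl := Weyl (weyl_op_scale 0).
Definition weyl_one : weyl := Weyl (weyl_op_scale 1).
Definition weyl_opp (P : weyl) : weyl := weyl_scale (-1) P.

Fact weyl_addA : associative weyl_add.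
Proof. by move=> P Q R; apply: weyl_eq => f /=; rewrite addrA. Qed.
Fact weyl_addC : commutative weyl_add.
Proof. by move=> P Q; apply: weyl_eq => f /=; rewrite addrC. Qed.
Fact weyl_add0 : left_id weyl_zero weyl_add.
Proof. by move=> P; apply: weyl_eq => f /=; rewrite scale0r add0r. Qed.
Fact weyl_addN : left_inverse weyl_zero weyl_opp weyl_add.
Proof.
by move=> P; apply: weyl_eq => f /=; rewrite scaleN1r scale0r addNr.
Qed.

HB.instance Definition _ :=
  GRing.isZmodule.Build weyl weyl_addA weyl_addC weyl_add0 weyl_addN.

Fact weyl_mulA : associative weyl_mul.
Proof. by move=> P Q R; apply: weyl_eq. Qed.
Fact weyl_mul1l : left_id weyl_one weyl_mul.
Proof. by move=> P; apply: weyl_eq => f /=; rewrite scale1r. Qed.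
Fact weyl_mul1r : right_id weyl_one weyl_mul.
Proof. by move=> P; apply: weyl_eq => f /=; rewrite scale1r. Qed.
Fact weyl_mulDl : left_distributive weyl_mul weyl_add.
Proof. by move=> P Q R; apply: weyl_eq. Qed.
Fact weyl_mulDr : right_distributive weyl_mul weyl_add.
Proof. by move=> P Q R; apply: weyl_eq => f /=; rewrite weyl_funD. Qed.
Fact weyl_one_neq0 : weyl_one != weyl_zero.
Proof.
apply/eqP => /(congr1 (fun P : weyl => P 1)) /=.
by rewrite scale1r scale0r => /eqP; rewrite oner_eq0.
Qed.

HB.instance Definition _ := GRing.Zmodule_isNzRing.Build weyl
  weyl_mulA weyl_mul1l weyl_mul1r weyl_mulDl weyl_mulDr weyl_one_neq0.

Fact weyl_scaleA c e P : weyl_scale c (weyl_scale e P) = weyl_scale (c * e) P.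
Proof. by apply: weyl_eq => f /=; rewrite scalerA. Qed.
Fact weyl_scale1 : left_id 1 weyl_scale.
Proof. by move=> P; apply: weyl_eq => f /=; rewrite scale1r. Qed.
Fact weyl_scaleDr : right_distributive weyl_scale +%R.
Proof. by move=> c P Q; apply: weyl_eq => f /=; rewrite scalerDr. Qed.
Fact weyl_scaleDl P : {morph weyl_scale^~ P : c e / c + e}.
Proof. by move=> c e; apply: weyl_eq => f /=; rewrite scalerDl. Qed.

HB.instance Definition _ := GRing.Zmodule_isLmodule.Build K weyl
  weyl_scaleA weyl_scale1 weyl_scaleDr weyl_scaleDl.

Fact weyl_scaleAl c (P Q : weyl) : c *: (P * Q) = (c *: P) * Q.
Proof. exact: weyl_eq. Qed.
HB.instance Definition _ := GRing.Lmodule_isLalgebra.Build K weyl weyl_scaleAl.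

Fact weyl_scaleAr c (P Q : weyl) : c *: (P * Q) = P * (c *: Q).
Proof. by apply: weyl_eq => f /=; rewrite weyl_funZ. Qed.
HB.instance Definition _ := GRing.Lalgebra_isAlgebra.Build K weyl weyl_scaleAr.

Definition wx (j : 'I_n) : weyl := Weyl (weyl_op_x j).
Definition wd (j : 'I_n) : weyl := Weyl (weyl_op_d j).

Lemma weyl_ind (T : weyl -> Prop) :
  (forall c, T c%:A) -> (forall j, T (wx j)) -> (forall j, T (wd j)) ->
  (forall P Q, T P -> T Q -> T (P + Q)) ->
  (forall P Q, T P -> T Q -> T (P * Q)) -> forall P, T P.
Proof.
move=> TC Tx Td TD TM.
suff wT P : weyl_op P -> forall pP : weyl_op P, T (Weyl pP).
  by case=> P pP; apply: wT.
have irr Q (Q' : weyl) (qQ : weyl_op Q) : Q' =1 Q -> T Q' -> T (Weyl qQ).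
  by move=> eqQ; rewrite (weyl_eq (P := Weyl qQ) (Q := Q')).
elim => {P} [c|j|j|P Q pP TP pQ TQ|P Q pP TP pQ TQ] pR.
- by apply: irr (TC c) => f /=; rewrite scale1r.
- exact: irr (Tx j).
- exact: irr (Td j).
- exact: irr (TD _ _ (TP pP) (TQ pQ)).
- exact: irr (TM _ _ (TP pP) (TQ pQ)).
Qed.

Lemma wx_comm i j : wx i * wx j = wx j * wx i.
Proof. by apply: weyl_eq => f /=; rewrite mulrCA. Qed.

Lemma wd_comm i j : wd i * wd j = wd j * wd i.
Proof. by apply: weyl_eq => f /=; rewrite mderiv_comm. Qed.

Lemma wd_wx i j : wd i * wx j = wx j * wd i + (i == j)%:R.
Proof.
apply: weyl_eq => f /=; rewrite mderivM mderivX mnm1E eq_sym addrC.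
congr (_ + _); have [->|_] := eqVneq i j.
  have -> : (U_(j) - U_(j) = 0)%MM by rewrite -{1}[U_(j)%MM]add0m addmK.
  by rewrite mpolyX0 -scalerAl mul1r.
by rewrite scale0r mul0r; apply/esym; exact: scale0r.
Qed.

(* R_A = K[d_1,...,d_n] is {mpoly K[n]}, mapped into the Weyl algebra by
   X_j |-> d_j. *)
Definition dpoly : {mpoly K[n]} -> weyl := mmap (in_alg weyl) wd.

Lemma comm_wd_exp i j k l : GRing.comm (wd i ^+ k) (wd j ^+ l).
Proof. by apply/commrX/commr_sym/commrX/commr_sym; exact: wd_comm. Qed.

Lemma mmap1_wdD m1 m2 : mmap1 wd (m1 + m2) = mmap1 wd m1 * mmap1 wd m2.
Proof.
rewrite /mmap1 (eq_bigr (fun i => wd i ^+ m1 i * wd i ^+ m2 i)); last first.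
  by move=> i _; rewrite mnmDE exprD.
elim: (index_enum _) => [|i s IHs]; first by rewrite !big_nil mulr1.
rewrite !big_cons IHs -!mulrA; congr (_ * _); rewrite !mulrA; congr (_ * _).
elim: s {IHs} => [|j s IHs]; first by rewrite big_nil mulr1 mul1r.
by rewrite big_cons mulrA comm_wd_exp -!mulrA IHs.
Qed.

Fact dpoly_is_zmod_morphism : zmod_morphism dpoly.
Proof. exact: mmap_is_additive. Qed.
HB.instance Definition _ :=
  GRing.isZmodMorphism.Build {mpoly K[n]} weyl dpoly dpoly_is_zmod_morphism.

Lemma dpolyX m : dpoly 'X_[m] = mmap1 wd m.
Proof. exact: mmapX. Qed.

Lemma dpolyXi j : dpoly 'X_j = wd j.
Proof. by rewrite dpolyX mmap1U. Qed.

Lemma dpolyC c : dpoly c%:MP = c%:A.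
Proof. exact: mmapC. Qed.

Lemma dpolyZ c p : dpoly (c *: p) = c *: dpoly p.
Proof. by rewrite /dpoly mmapZ /= mulr_algl. Qed.

Fact dpoly_is_monoid_morphism : monoid_morphism dpoly.
Proof.
split=> [|p q]; first by rewrite -mpolyC1 dpolyC scale1r.
elim/mpolyind: p => [|c m p _ _ IHp]; first by rewrite !(mul0r, raddf0).
rewrite mulrDl !raddfD /= mulrDl IHp; congr (_ + _).
elim/mpolyind: q {p IHp} => [|e m' q _ _ IHq].
  by rewrite !(mulr0, raddf0).
rewrite mulrDr !raddfD /= mulrDr IHq; congr (_ + _).
rewrite -scalerAl -scalerAr -mpolyXD !dpolyZ !dpolyX mmap1_wdD.
by rewrite -scalerAl -scalerAr.
Qed.
HB.instance Definition _ :=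
  GRing.isMonoidMorphism.Build {mpoly K[n]} weyl dpoly dpoly_is_monoid_morphism.

End Weyl.

Section BaseChange.
Variables (R D : nzRingType) (phi : {rmorphism R -> D}) (N : lmodType R).
Local Notation F := {freeg (D * N)%type / int}.
Local Notation "P <*> m" := (<< (P, m) >> : F) (at level 40).

Inductive tensor_rel : F -> Prop :=
| tensor_rel0 : tensor_rel 0
| tensor_relB x y : tensor_rel x -> tensor_rel y -> tensor_rel (x - y)
| tensor_relDl P Q m : tensor_rel ((P + Q) <*> m - P <*> m - Q <*> m)
| tensor_relDr P m m' : tensor_rel (P <*> (m + m') - P <*> m - P <*> m')
| tensor_relM P r m : tensor_rel ((P * phi r) <*> m - P <*> (r *: m)).

Definition tensor_relp : {pred F} := fun x => `[< tensor_rel x >].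

Fact tensor_relp_zmod_closed : zmod_closed tensor_relp.
Proof.
split=> [|x y /asboolP hx /asboolP hy]; apply/asboolP.
  exact: tensor_rel0.
exact: tensor_relB.
Qed.
HB.instance Definition _ :=
  GRing.isZmodClosed.Build F tensor_relp tensor_relp_zmod_closed.

(* D (x)_R N, where D is a right R-module through phi *)
Definition tensor := Quotient.quot tensor_relp.
HB.instance Definition _ := GRing.Zmodule.on tensor.

Definition pure (P : D) (m : N) : tensor := \pi_tensor (P <*> m).

Lemma tensor_relP x : tensor_rel x -> \pi_tensor x = 0.
Proof.
move=> hx; rewrite -[RHS](raddf0 (\pi_tensor : {additive F -> tensor})).
by apply/eqP; rewrite -Quotient.idealrBE subr0; apply/asboolP.
Qed.

Lemma pureDl P Q m : pure (P + Q) m = pure P m + pure Q m.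
Proof.
apply/eqP; rewrite -subr_eq0 opprD addrA -!raddfB; apply/eqP.
exact/tensor_relP/tensor_relDl.
Qed.

Lemma pureDr P m m' : pure P (m + m') = pure P m + pure P m'.
Proof.
apply/eqP; rewrite -subr_eq0 opprD addrA -!raddfB; apply/eqP.
exact/tensor_relP/tensor_relDr.
Qed.

Lemma pureM P r m : pure (P * phi r) m = pure P (r *: m).
Proof.
apply/eqP; rewrite -subr_eq0 -!raddfB; apply/eqP.
exact/tensor_relP/tensor_relM.
Qed.

Lemma pure0l m : pure 0 m = 0.
Proof. by apply: (addrI (pure 0 m)); rewrite -pureDl !addr0. Qed.

Lemma pure0r P : pure P 0 = 0.
Proof. by apply: (addrI (pure P 0)); rewrite -pureDr !addr0. Qed.

Lemma pureNl P m : pure (- P) m = - pure P m.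
Proof. by apply/eqP; rewrite -addr_eq0 -pureDl addNr pure0l. Qed.

Lemma pureNr P m : pure P (- m) = - pure P m.
Proof. by apply/eqP; rewrite -addr_eq0 -pureDr addNr pure0r. Qed.

Lemma pureMzl P m k : pure (P *~ k) m = pure P m *~ k.
Proof.
have pureMn Q j : pure (Q *+ j) m = pure Q m *+ j.
  by elim: j => [|j IHj]; rewrite ?mulr0n ?pure0l // !mulrS pureDl IHj.
by case: k => k; rewrite ?NegzE ?mulrNz ?pureNl -!pmulrn pureMn.
Qed.

Lemma pureMzr P m k : pure P (m *~ k) = pure P m *~ k.
Proof.
have pureMn j : pure P (m *+ j) = pure P m *+ j.
  by elim: j => [|j IHj]; rewrite ?mulr0n ?pure0r // !mulrS pureDr IHj.
by case: k => k; rewrite ?NegzE ?mulrNz ?pureNr -!pmulrn pureMn.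
Qed.

Lemma tensor_ind (T : tensor -> Prop) :
  T 0 -> (forall x y, T x -> T y -> T (x + y)) ->
  (forall P m, T (pure P m)) -> forall x, T x.
Proof.
move=> T0 TD Tp; elim/quotW => x.
have TN P m : T (- pure P m) by rewrite -pureNl.
elim/(@freeg_ind_dom0 int (D * N)%type): x => [|k [P m] x _ _ Tx].
  by rewrite raddf0.
rewrite raddfD; apply: (TD) => //.
have -> : << k *g (P, m) >> = (P <*> m) *~ k.
  by rewrite freegU_mulz intz.
rewrite raddfMz; set y := (X in T (X *~ _)).
have Ty : T y by exact: Tp.
have TNy : T (- y) by exact: TN.
case: k => k.
  elim: k => [|k IHk]; first by rewrite mulr0z.
  by rewrite intS mulrzDr mulr1z; apply: (TD).
rewrite NegzE mulrNz; elim: k => [|k IHk]; first by rewrite mulr1z.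
by rewrite intS mulrzDr mulr1z opprD; apply: (TD).
Qed.

Section Lift.
Variables (V : zmodType) (f : D -> N -> V).
Hypothesis fDl : forall P Q m, f (P + Q) m = f P m + f Q m.
Hypothesis fDr : forall P m m', f P (m + m') = f P m + f P m'.
Hypothesis fM : forall P r m, f (P * phi r) m = f P (r *: m).

Local Notation F1 := (fglift (fun x : D * N => f x.1 x.2 : zmodule V)).

Lemma tensor_lift : exists2 g : tensor -> V,
  (forall x y, g (x + y) = g x + g y) & forall P m, g (pure P m) = f P m.
Proof.
have FB x y : F1 (x - y) = F1 x - F1 y by rewrite lift_is_additive.
have FU P m : F1 (P <*> m) = f P m by rewrite liftU scale1r.
have F0 : F1 0 = 0 by rewrite -(subrr 0) FB subrr.
have FD x y : F1 (x + y) = F1 x + F1 y.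
  by rewrite -[y]opprK -[- y]sub0r !FB F0 !sub0r !opprK.
have Frel x : tensor_rel x -> F1 x = 0.
  elim=> {x} [//|x y _ hx _ hy|P Q m|P m m'|P r m]; rewrite !FB ?FU.
  - by rewrite hx hy subrr.
  - by rewrite fDl addrAC addrK subrr.
  - by rewrite fDr addrAC addrK subrr.
  - by rewrite fM subrr.
have Fpi x y : \pi_tensor x = \pi_tensor y -> F1 x = F1 y.
  move=> /eqP; rewrite -Quotient.idealrBE => /asboolP/Frel/eqP.
  by rewrite FB subr_eq0 => /eqP.
exists (fun x => F1 (repr x)) => [x y|P m].
  rewrite -FD; apply: Fpi; rewrite reprK raddfD.
  by rewrite -[x in LHS]reprK -[y in LHS]reprK.
by rewrite -FU; apply: Fpi; rewrite reprK.
Qed.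

End Lift.

Fact tensor_scale_ex (Q : D) : exists g : tensor -> tensor,
  (forall x y, g (x + y) = g x + g y) /\
  (forall P m, g (pure P m) = pure (Q * P) m).
Proof.
have [|P m m'|P r m|g gD gp] := @tensor_lift tensor (fun P => pure (Q * P)).
- by move=> P P' m; rewrite mulrDr pureDl.
- by rewrite pureDr.
- by rewrite mulrA pureM.
by exists g.
Qed.

Definition tensor_scale (Q : D) : tensor -> tensor :=
  projT1 (cid (tensor_scale_ex Q)).

Lemma tensor_scaleDr Q : {morph tensor_scale Q : x y / x + y}.
Proof. by rewrite /tensor_scale; case: cid => g []. Qed.

Lemma tensor_scale_pure Q P m : tensor_scale Q (pure P m) = pure (Q * P) m.
Proof. by rewrite /tensor_scale; case: cid => g []. Qed.

Lemma tensor_scale0 Q : tensor_scale Q 0 = 0.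
Proof. by rewrite -(pure0l 0) tensor_scale_pure mulr0. Qed.

Fact tensor_scaleA P Q x :
  tensor_scale P (tensor_scale Q x) = tensor_scale (P * Q) x.
Proof.
elim/tensor_ind: x => [|x y hx hy|P' m]; first by rewrite !tensor_scale0.
  by rewrite !tensor_scaleDr hx hy.
by rewrite !tensor_scale_pure mulrA.
Qed.

Fact tensor_scale1 : left_id 1 tensor_scale.
Proof.
elim/tensor_ind => [|x y hx hy|P' m]; first by rewrite !tensor_scale0.
  by rewrite !tensor_scaleDr hx hy.
by rewrite !tensor_scale_pure mul1r.
Qed.

Fact tensor_scaleDl x : {morph tensor_scale^~ x : P Q / P + Q}.
Proof.
move=> P Q; elim/tensor_ind: x => [|x y hx hy|P' m].
- by rewrite !tensor_scale0 addr0.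
- by rewrite !tensor_scaleDr hx hy addrACA.
by rewrite !tensor_scale_pure mulrDl pureDl.
Qed.

HB.instance Definition _ := GRing.Zmodule_isLmodule.Build D tensor
  tensor_scaleA tensor_scale1 tensor_scaleDr tensor_scaleDl.

Lemma scale_pure Q P m : Q *: pure P m = pure (Q * P) m.
Proof. exact: tensor_scale_pure. Qed.

End BaseChange.

(* A chain z stands for the sum of z S (x) e_S over the subsets S of 'I_d;
   it has homological degree p when it is supported on subsets of size p. *)
Section Koszul.
Variables (D : nzRingType) (M : lmodType D) (d : nat) (phi : 'I_d -> M -> M).

Definition koszul_chain := {ffun {set 'I_d} -> M}.

Definition koszul_deg (p : nat) (z : koszul_chain) : Prop :=
  forall S, z S != 0 -> #|S| = p.

Definition koszul_sign (i : 'I_d) (T : {set 'I_d}) : D :=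
  (-1) ^+ #|[set j in T | (j < i)%N]|.

(* e_S |-> the sum over i in S of (-1)^#{j in S | j < i} phi_i e_(S \ i) *)
Definition koszul_diff (z : koszul_chain) : koszul_chain :=
  [ffun T : {set 'I_d} => \sum_(i | i \notin T) koszul_sign i T *: phi i (z (i |: T))].

Definition koszul_homology_zero (p : nat) : Prop :=
  forall z, koszul_deg p z -> koszul_diff z = 0 ->
    exists2 w, koszul_deg p.+1 w & koszul_diff w = z.

Hypothesis phi_lin : forall i, linear (phi i).
Hypothesis phi_comm : forall i j x, phi i (phi j x) = phi j (phi i x).

Let phi0 i : phi i 0 = 0.
Proof.
have := phi_lin i 1 0 0; rewrite !scale1r addr0 => /esym/eqP.
by rewrite -subr_eq0 addrK => /eqP.
Qed.

Let phiD i : {morph phi i : x y / x + y}.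
Proof. by move=> x y; rewrite -[x]scale1r phi_lin !scale1r. Qed.

Let phiZ i c : {morph phi i : x / c *: x}.
Proof. by move=> x; rewrite -[c *: x]addr0 phi_lin phi0 addr0. Qed.

Lemma koszul_diff_deg p z : koszul_deg p.+1 z -> koszul_deg p (koszul_diff z).
Proof.
move=> zp T; rewrite ffunE; case: (eqVneq #|T| p) => // Tp.
rewrite big1 ?eqxx // => i iT.
case: (eqVneq (z (i |: T)) 0) => [->|/zp]; first by rewrite phi0 scaler0.
by rewrite cardsU1 iT => -[] /eqP; rewrite (negPf Tp).
Qed.

Lemma koszul_signU i j (T : {set 'I_d}) : i \notin T ->
  koszul_sign j (i |: T) = (-1) ^+ (i < j)%N * koszul_sign j T.
Proof.
move=> iT; rewrite /koszul_sign -exprD; congr (_ ^+ _).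
case ij: (i < j)%N.
  have -> : [set k in i |: T | (k < j)%N] = i |: [set k in T | (k < j)%N].
    apply/setP=> k; rewrite !inE; case: eqP => //= ->.
    by rewrite ij.
  by rewrite cardsU1 inE (negPf iT).
congr #|pred_of_set _|; apply/setP=> k; rewrite !inE.
by case: eqP => //= ->; rewrite ij (negPf iT).
Qed.

Lemma koszul_diffK z : koszul_diff (koszul_diff z) = 0.
Proof.
apply/ffunP=> T; rewrite !ffunE.
pose t (i j : 'I_d) := ((-1) ^+ (i < j)%N * koszul_sign i T * koszul_sign j T) *:
   phi i (phi j (z (j |: (i |: T)))).
transitivity (\sum_(i < d) \sum_(j < d)
   if [&& i \notin T, j \notin T & i != j] then t i j else 0).
  rewrite big_mkcond; apply: eq_bigr => i _ /=.
  case: ifP => iT /=; last by rewrite big1.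
  have phi_sum (I : finType) (P : pred I) (f : I -> M) :
      phi i (\sum_(k | P k) f k) = \sum_(k | P k) phi i (f k).
    by elim/big_rec2: _ => // k y1 y2 _ <-; rewrite phiD.
  rewrite ffunE phi_sum scaler_sumr big_mkcond; apply: eq_bigr => j _.
  rewrite !inE negb_or andbC eq_sym; case: ifP => // _.
  rewrite koszul_signU ?iT // phiZ scalerA /t; congr (_ *: _).
  by rewrite mulrA /koszul_sign -!exprD; congr (_ ^+ (_ + _)%N); rewrite addnC.
set s := LHS.
transitivity (\sum_(i < d) \sum_(j < d | (i < j)%N)
  ((if [&& i \notin T, j \notin T & i != j] then t i j else 0) +
   (if [&& j \notin T, i \notin T & j != i] then t j i else 0))).
  rewrite /s (eq_bigr (fun i : 'I_d => \sum_(j < d | (i < j)%N)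
     (if [&& i \notin T, j \notin T & i != j] then t i j else 0) +
     \sum_(j < d | (j < i)%N)
     (if [&& i \notin T, j \notin T & i != j] then t i j else 0))).
    rewrite big_split /=; under [RHS]eq_bigr do rewrite big_split /=.
    rewrite [RHS]big_split /=; congr (_ + _).
    rewrite (exchange_big_dep predT) //=.
  move=> i _; rewrite (bigID (fun j : 'I_d => (i < j)%N)) /=; congr (_ + _).
  rewrite (bigD1 i) ?ltnn //= eqxx !andbF add0r.
  apply: eq_bigl => j; rewrite -leqNgt [in RHS]ltn_neqAle andbC.
  by rewrite -val_eqE.
rewrite big1 // => i _; rewrite big1 // => j ij.
rewrite andbCA [j == i]eq_sym; case: ifP => // _; last by rewrite addr0.
rewrite /t ij ltnNge ltnW //= expr0 expr1 mul1r phi_comm setUCA -scalerDl.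
rewrite mulN1r mulNr /koszul_sign -!exprD addnC addNr.
by rewrite scale0r.
Qed.

End Koszul.

Section Semigroup.
Variables (d n : nat) (A : 'M[int]_(d, n)).

Definition in_NA (v : 'cV[int]_d) : Prop :=
  exists c : 'I_n -> nat, v = \sum_j col j A *+ c j.

Definition in_ZA (v : 'cV[int]_d) : Prop :=
  exists c : 'I_n -> int, v = \sum_j col j A *~ c j.

Definition positive_semigroup : Prop :=
  forall v, in_NA v -> in_NA (- v) -> v = 0.

End Semigroup.

Section Grading.
Variables (K : numFieldType) (d n : nat) (A : 'M[int]_(d, n)).
Local Notation RA := {mpoly K[n]}.
Local Notation DA := (weyl K n).

Inductive weyl_homog : 'cV[int]_d -> DA -> Prop :=
| weyl_homog0 u : weyl_homog u 0
| weyl_homogD u P Q : weyl_homog u P -> weyl_homog u Q -> weyl_homog u (P + Q)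
| weyl_homogC c : weyl_homog 0 c%:A
| weyl_homog_x j : weyl_homog (col j A) (wx K j)
| weyl_homog_d j : weyl_homog (- col j A) (wd K j)
| weyl_homogM u v P Q :
    weyl_homog u P -> weyl_homog v Q -> weyl_homog (u + v) (P * Q).

(* A Z^d-grading N = (+)_u N_u of an R_A-module, where deg d_j = - a_j, given
   by the projections [gcomp g u] of N onto N_u. *)
Record grading (N : lmodType RA) := Grading {
  gcomp : 'cV[int]_d -> N -> N;
  gcompB : forall u, zmod_morphism (gcomp u);
  gcompK : forall u v m, gcomp u (gcomp v m) = if u == v then gcomp v m else 0;
  gcomp_sum : forall m, exists s : seq 'cV[int]_d,
    [/\ uniq s, forall u, u \notin s -> gcomp u m = 0
      & m = \sum_(u <- s) gcomp u m];
  gcompC : forall u c m, gcomp u (c%:MP *: m) = c%:MP *: gcomp u m;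
  gcompX : forall u j m, gcomp (u - col j A) ('X_j *: m) = 'X_j *: gcomp u m
}.

Definition gr_homog (N : lmodType RA) (g : grading N) (u : 'cV[int]_d) (m : N) :=
  gcomp g u m = m.

Definition euler (i : 'I_d) : DA := \sum_j (A i j)%:~R *: (wx K j * wd K j).

Lemma euler_wx i k : euler i * wx K k = wx K k * euler i + (A i k)%:~R *: wx K k.
Proof.
have -> : (A i k)%:~R *: wx K k =
    \sum_j (if j == k then (A i j)%:~R *: wx K j else 0).
  by rewrite -big_mkcond big_pred1_eq.
rewrite /euler mulr_suml mulr_sumr -big_split; apply: eq_bigr => j _ /=.
rewrite -scalerAl -scalerAr -mulrA wd_wx mulrDr scalerDr mulrA wx_comm mulrA.
congr (_ + _); case: eqVneq => [->|_]; first by rewrite mulr1.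
by rewrite mulr0 scaler0.
Qed.

Lemma euler_wd i k : euler i * wd K k = wd K k * euler i - (A i k)%:~R *: wd K k.
Proof.
have -> : (A i k)%:~R *: wd K k =
    \sum_j (if j == k then (A i j)%:~R *: wd K j else 0).
  by rewrite -big_mkcond big_pred1_eq.
rewrite /euler mulr_suml mulr_sumr -sumrB; apply: eq_bigr => j _ /=.
rewrite -scalerAl -scalerAr mulrA wd_wx mulrDl scalerDr -!mulrA wd_comm.
rewrite eq_sym -addrA; case: eqVneq => [->|_].
  by rewrite mul1r addrN addr0.
by rewrite mul0r scaler0 subr0 addr0.
Qed.

Lemma euler_homog i u P : weyl_homog u P ->
  euler i * P = P * euler i + (u i 0)%:~R *: P.
Proof.
elim=> {u P} [u|u P Q _ hP _ hQ|c|j|j|u v P Q _ hP _ hQ].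
- by rewrite mulr0 mul0r scaler0 addr0.
- by rewrite mulrDr hP hQ mulrDl scalerDr addrACA.
- by rewrite mxE scale0r addr0 -scalerAr -scalerAl mulr1 mul1r.
- by rewrite mxE euler_wx.
- by rewrite !mxE euler_wd mulrNz scaleNr.
rewrite mulrA hP mulrDl -mulrA hQ mulrDr mulrA -addrA -scalerAr -scalerAl.
by rewrite -scalerDl mxE addrC intrD [X in X *: _]addrC addrC.
Qed.

Lemma weyl_homog_euler i : weyl_homog 0 (euler i).
Proof.
rewrite /euler; elim/big_ind: _ => [|P Q|j _]; first exact: weyl_homog0.
  exact: weyl_homogD.
rewrite -[wx K j * wd K j]mul1r scalerAl -[0]addr0.
apply: weyl_homogM; first exact: weyl_homogC.
by rewrite -(subrr (col j A)); apply: weyl_homogM; constructor.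
Qed.

Lemma weyl_homog_gen (T : DA -> Prop) :
  (forall P Q, T P -> T Q -> T (P + Q)) ->
  (forall u P, weyl_homog u P -> T P) -> forall P, T P.
Proof.
move=> TD Th P.
suff [s [hs ->]] : exists s : seq ('cV[int]_d * DA),
    (forall x, x \in s -> weyl_homog x.1 x.2) /\ P = \sum_(x <- s) x.2.
  elim: s hs => [|x s IHs] hs.
    by rewrite big_nil; apply: (Th 0); exact: weyl_homog0.
  rewrite big_cons; apply: (TD); first by apply: (Th x.1); apply: hs; rewrite mem_head.
  by apply: IHs => y ys; apply: hs; rewrite in_cons ys orbT.
elim/weyl_ind: P => [c|j|j|P Q [s [hs ->]] [t [ht ->]]|P Q [s [hs ->]] [t [ht ->]]].
- exists [:: (0, c%:A)]; rewrite big_seq1; split=> // x; rewrite inE => /eqP ->.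
  exact: weyl_homogC.
- exists [:: (col j A, wx K j)]; rewrite big_seq1; split=> // x.
  by rewrite inE => /eqP ->; exact: weyl_homog_x.
- exists [:: (- col j A, wd K j)]; rewrite big_seq1; split=> // x.
  by rewrite inE => /eqP ->; exact: weyl_homog_d.
- exists (s ++ t); rewrite big_cat; split=> // x; rewrite mem_cat => /orP[].
    exact: hs.
  exact: ht.
exists [seq (x.1 + y.1, x.2 * y.2) | x <- s, y <- t]; split=> [z|].
  by case/allpairsP=> -[x y] /= [xs yt ->] /=; apply: weyl_homogM; auto.
rewrite mulr_suml big_allpairs_dep /=; apply: eq_bigr => x _.
by rewrite mulr_sumr.
Qed.

Section EulerKoszul.
Variables (N : lmodType RA) (g : grading N).

Local Notation DN := (tensor (dpoly (K := K) (n := n)) N).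
Local Notation "P <*> m" := (pure (dpoly (K := K) (n := n)) P m) (at level 40).

Inductive tensor_homog : 'cV[int]_d -> DN -> Prop :=
| tensor_homog0 u : tensor_homog u 0
| tensor_homogD u x y :
    tensor_homog u x -> tensor_homog u y -> tensor_homog u (x + y)
| tensor_homog_pure u v P m :
    weyl_homog u P -> gr_homog g v m -> tensor_homog (u + v) (P <*> m).

Let gcomp0 u : gcomp g u 0 = 0.
Proof. by rewrite -(subrr 0) gcompB !subrr. Qed.

Let gcompD u : {morph gcomp g u : x y / x + y}.
Proof.
by move=> x y; rewrite -[y]opprK -[- y]sub0r !gcompB gcomp0 !sub0r !opprK.
Qed.

Let gcomp_sum_ind (T : N -> Prop) : T 0 ->
  (forall x y, T x -> T y -> T (x + y)) ->
  (forall u m, gr_homog g u m -> T m) -> forall m, T m.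
Proof.
move=> T0 TD Th m; have [s [_ _ ->]] := gcomp_sum g m.
elim/big_ind: _ => // u _; apply: (Th u).
by rewrite /gr_homog gcompK eqxx.
Qed.

Let theta_ex i : exists t : N -> N, {morph t : x y / x + y} /\
  forall u m, gr_homog g u m -> t m = m *~ u i 0.
Proof.
pose S m := projT1 (cid (gcomp_sum g m)).
have SP m : [/\ uniq (S m), forall u, u \notin S m -> gcomp g u m = 0
    & m = \sum_(u <- S m) gcomp g u m] by exact: projT2 (cid (gcomp_sum g m)).
pose t m := \sum_(u <- S m) gcomp g u m *~ u i 0.
have tE m s : uniq s -> {subset S m <= s} ->
    t m = \sum_(u <- s) gcomp g u m *~ u i 0.
  move=> us sub; have [uS S0 _] := SP m.
  rewrite [RHS](bigID (fun u => u \in S m)) /= [X in _ + X]big1 ?addr0; last first.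
    by move=> u /S0 ->; rewrite mul0rz.
  rewrite -big_filter; apply: perm_big; apply: uniq_perm => //.
    by rewrite filter_uniq.
  by move=> u; rewrite mem_filter; case uS': (u \in S m) => //=; rewrite sub.
exists t; split=> [x y|u m hm].
  pose s := undup (S x ++ S y ++ S (x + y)).
  have us : uniq s by exact: undup_uniq.
  have sx : {subset S x <= s} by move=> u uS; rewrite mem_undup mem_cat uS.
  have sy : {subset S y <= s}.
    by move=> u uS; rewrite mem_undup !mem_cat uS orbT.
  have sxy : {subset S (x + y) <= s}.
    by move=> u uS; rewrite mem_undup !mem_cat uS !orbT.
  rewrite (tE _ _ us sx) (tE _ _ us sy) (tE _ _ us sxy).
  by rewrite -big_split; apply: eq_bigr => u _; rewrite gcompD mulrzDl.
have [uS S0 _] := SP m.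
have z v : v != u -> gcomp g v m = 0.
  by move=> vu; rewrite -[in LHS]hm gcompK (negPf vu).
have [uSm|uSm] := boolP (u \in S m).
  rewrite /t (bigD1_seq u) //= hm big1 ?addr0 // => v vu.
  by rewrite z // mul0rz.
have m0 : m = 0 by rewrite -hm S0.
by rewrite m0 mul0rz /t big1 // => v _; rewrite gcomp0 mul0rz.
Qed.

Let homogX u j m : gr_homog g u m -> gr_homog g (u - col j A) ('X_j *: m).
Proof. by rewrite /gr_homog gcompX => ->. Qed.

Lemma tensor_homog_gen (T : DN -> Prop) :
  (forall x y, T x -> T y -> T (x + y)) ->
  (forall u x, tensor_homog u x -> T x) -> forall x, T x.
Proof.
move=> TD Th.
have T0 : T 0 by apply: (Th 0); exact: tensor_homog0.
elim/tensor_ind => // P m; move: m P.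
apply: gcomp_sum_ind => [P|x y Tx Ty P|v m hm]; first by rewrite pure0r.
  by rewrite pureDr; apply: (TD).
elim/weyl_homog_gen => [P Q TP TQ|u P hP]; first by rewrite pureDl; apply: (TD).
by apply: (Th (u + v)); exact: tensor_homog_pure.
Qed.

Definition euler_action_spec (i : 'I_d) (f : {linear DN -> DN}) : Prop :=
  forall u y, tensor_homog u y -> f y = (euler i - (u i 0)%:~R) *: y.

Lemma mpoly_gen_ind (T : RA -> Prop) :
  (forall c, T c%:MP) -> (forall j, T 'X_j) ->
  (forall p q, T p -> T q -> T (p + q)) ->
  (forall p q, T p -> T q -> T (p * q)) -> forall p, T p.
Proof.
move=> TC TX TD TM; elim/mpolyind => [|c m p _ _ Tp]; first by rewrite -mpolyC0.
apply: (TD) => //; rewrite -mul_mpolyC; apply: (TM) => //.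
rewrite mpolyXE_id; elim/big_ind: _ => [||j _]; first by rewrite -mpolyC1.
  by move=> *; apply: (TM).
by elim: (m j) => [|k IHk]; rewrite ?expr0 -?mpolyC1 // exprS; apply: (TM).
Qed.

Fact euler_action_ex i : exists f, euler_action_spec i f.
Proof.
have [t [tD th]] := theta_ex i.
have t0 : t 0 = 0 by apply: (addrI (t 0)); rewrite -tD !addr0.
have tC c m : t (c%:MP *: m) = c%:MP *: t m.
  elim/gcomp_sum_ind: m => [|x y hx hy|u m hm]; first by rewrite scaler0 t0 scaler0.
    by rewrite scalerDr !tD scalerDr hx hy.
  rewrite (th _ _ hm) (th u) ?scalerMzr //.
  by rewrite /gr_homog gcompC hm.
have tX j m : t ('X_j *: m) = 'X_j *: t m - ('X_j *: m) *~ A i j.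
  elim/gcomp_sum_ind: m => [|x y hx hy|u m hm].
  - by rewrite scaler0 t0 scaler0 mul0rz subr0.
  - by rewrite scalerDr !tD scalerDr hx hy mulrzDl opprD addrACA.
  rewrite (th _ _ hm) (th _ _ (homogX j hm)) scalerMzr !mxE mulrzDr mulrNz.
  by rewrite scalerBr !scalerMzr.
pose F P m := (P * euler i) <*> m - P <*> t m.
have FDl P Q m : F (P + Q) m = F P m + F Q m.
  by rewrite /F mulrDl !pureDl opprD addrACA.
have FDr P m m' : F P (m + m') = F P m + F P m'.
  by rewrite /F tD !pureDr opprD addrACA.
have FM P r m : F (P * dpoly r) m = F P (r *: m).
  move: m P; elim/mpoly_gen_ind: r => [c m P|j m P|p q hp hq m P|p q hp hq m P].
  - have cC Q x : (c *: Q) <*> x = Q <*> (c%:MP *: x).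
      by rewrite -pureM /= dpolyC -scalerAr mulr1.
    by rewrite /F dpolyC -!scalerAr mulr1 -scalerAl !cC tC.
  - rewrite /F dpolyXi -mulrA.
    have -> : wd K j * euler i = euler i * wd K j + wd K j *~ A i j.
      by rewrite euler_wd scaler_int subrK.
    have -> Q : Q <*> t ('X_j *: m) = (Q * wd K j) <*> (t m - m *~ A i j).
      by rewrite tX scalerMzr -scalerBr -pureM /= dpolyXi.
    rewrite mulrDr mulrA pureDl -mulrzr mulrA mulrzr pureMzl.
    rewrite -[X in _ = X - _]pureM /= dpolyXi pureDr pureNr pureMzr opprD opprK.
    by rewrite addrA addrAC.
  - by rewrite raddfD /= mulrDr FDl hp hq scalerDl FDr.
  by rewrite rmorphM /= mulrA hq hp scalerA.
have [f fD fp] := tensor_lift FDl FDr FM.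
have f0 : f 0 = 0 by apply: (addrI (f 0)); rewrite -fD !addr0.
have fZ Q x : f (Q *: x) = Q *: f x.
  elim/tensor_ind: x => [|x y hx hy|P m]; first by rewrite scaler0 f0 scaler0.
    by rewrite scalerDr !fD hx hy scalerDr.
  by rewrite scale_pure !fp /F scalerBr !scale_pure mulrA.
have flin : linear f by move=> Q x y; rewrite fD fZ.
pose fl : {linear DN -> DN} := HB.pack f (GRing.isLinear.Build DA DN DN _ f flin).
exists fl => u y hy; change (f y = (euler i - (u i 0)%:~R) *: y).
elim: hy => {u y} [u|u x y _ hx _ hy|u v P m hP hm].
- by rewrite f0 scaler0.
- by rewrite fD hx hy scalerDr.
rewrite fp /F (th _ _ hm) scalerBl !scale_pure (euler_homog _ hP).
rewrite mulrzl scaler_int mxE pureDl mulrzDr pureDl pureMzr !pureMzl opprD.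
by rewrite addrA addrK.
Qed.

Lemma euler_action_uniq i f f' :
  euler_action_spec i f -> euler_action_spec i f' -> f =1 f'.
Proof.
move=> hf hf'; elim/tensor_homog_gen => [x y hx hy|u x hx].
  by rewrite !raddfD /= hx hy.
by rewrite (hf u) // (hf' u).
Qed.

(* Such a map is unique by euler_action_uniq. *)
Definition euler_action (i : 'I_d) : {linear DN -> DN} :=
  projT1 (cid (euler_action_ex i)).

Lemma euler_actionP i : euler_action_spec i (euler_action i).
Proof. exact: (projT2 (cid (euler_action_ex i))). Qed.

Lemma tensor_homogZ u v P x :
  weyl_homog u P -> tensor_homog v x -> tensor_homog (u + v) (P *: x).
Proof.
move=> hP; elim=> {v x} [v|v x y _ hx _ hy|v w Q m hQ hm].
- by rewrite scaler0; exact: tensor_homog0.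
- by rewrite scalerDr; exact: tensor_homogD.
rewrite scale_pure addrA; apply: tensor_homog_pure => //.
exact: weyl_homogM.
Qed.

Lemma euler_action_homog i u y :
  tensor_homog u y -> tensor_homog u (euler_action i y).
Proof.
move=> hy; rewrite (euler_actionP _ hy) -[u]add0r.
apply: tensor_homogZ => //; apply: weyl_homogD; first exact: weyl_homog_euler.
rewrite -scaler_int -scaleNr; exact: weyl_homogC.
Qed.

Lemma euler_comm i j : euler i * euler j = euler j * euler i.
Proof.
by rewrite (euler_homog i (weyl_homog_euler j)) mxE scale0r addr0.
Qed.

Lemma euler_action_comm i j y :
  euler_action i (euler_action j y) = euler_action j (euler_action i y).
Proof.
elim/tensor_homog_gen: y => [x y hx hy|u y hy]; first by rewrite !raddfD /= hx hy.
rewrite (euler_actionP i (euler_action_homog j hy)).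
rewrite (euler_actionP j (euler_action_homog i hy)).
rewrite (euler_actionP i hy) (euler_actionP j hy) !scalerA; congr (_ *: _).
apply: commrB; last exact: commr_int.
apply/commr_sym; apply: commrB; last exact: commr_int.
exact: euler_comm.
Qed.

Definition euler_endo (beta : 'cV[K]_d) (i : 'I_d) (y : DN) : DN :=
  euler_action i y - (beta i 0)%:A *: y.

Lemma euler_endo_linear beta i : linear (euler_endo beta i).
Proof.
move=> P x y; rewrite /euler_endo linearP /= scalerDr scalerBr opprD addrACA.
by rewrite !scalerA -scalerAl mul1r -scalerAr mulr1.
Qed.

Lemma euler_endo_comm beta i j y :
  euler_endo beta i (euler_endo beta j y) = euler_endo beta j (euler_endo beta i y).
Proof.
have EB k l x c : euler_action k (euler_action l x - c *: x) =
    euler_action k (euler_action l x) - c *: euler_action k x.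
  by rewrite (raddfB (euler_action k)); congr (_ - _); exact: linearZ.
rewrite /euler_endo !EB euler_action_comm !scalerBr !scalerA.
rewrite -!scalerAl !mul1r !scalerA [beta i 0 * _]mulrC.
by rewrite !opprD !opprK !addrA; congr (_ + _); exact: addrAC.
Qed.

Definition euler_koszul_homology_zero (beta : 'cV[K]_d) (p : nat) : Prop :=
  koszul_homology_zero (euler_endo beta) p.

Lemma euler_koszul_complex beta z :
  koszul_diff (euler_endo beta) (koszul_diff (euler_endo beta) z) = 0.
Proof.
apply: koszul_diffK; [exact: euler_endo_linear | exact: euler_endo_comm].
Qed.

End EulerKoszul.
End Grading.

Section Toric.
Variables (K : numFieldType) (d n : nat) (A : 'M[int]_(d, n)).
Local Notation RA := {mpoly K[n]}.

Definition mnm_plus (u : 'cV[int]_n) : 'X_{1..n} :=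
  [multinom absz (Num.max 0 (u j 0))%R | j < n].
Definition mnm_minus (u : 'cV[int]_n) : 'X_{1..n} :=
  [multinom absz (Num.max 0 (u j 0) - u j 0)%R | j < n].

Definition toric_binomial (p : RA) : Prop :=
  exists u : 'cV[int]_n,
    A *m u = 0 /\ p = 'X_[mnm_plus u] - 'X_[mnm_minus u].

Definition toric_ideal : {pred RA} := ideal_span toric_binomial.

Fact toric_ideal_closed : idealr_closed toric_ideal.
Proof.
split; [exact: ideal_span0 | | exact: ideal_span_closed].
apply/negP => h1; pose ev (p : RA) := p.@[fun=> 1].
suff ev0 p : p \in toric_ideal -> ev p = 0.
  by move: (ev0 _ h1); rewrite /ev meval1 => /eqP; rewrite oner_eq0.
elim/ideal_span_ind => [|q r hq hr|a _ [u [_ ->]]]; rewrite /ev.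
- exact: meval0.
- by rewrite mevalD -/(ev q) -/(ev r) hq hr addr0.
by rewrite mevalM mevalB !mevalX !big1 ?subrr ?mulr0 // => j _; rewrite expr1n.
Qed.
HB.instance Definition _ := isIdealr.Build RA toric_ideal toric_ideal_closed.

Definition toric_ring := {ideal_quot toric_ideal}.
HB.instance Definition _ := GRing.ComNzRing.on toric_ring.

Local Notation cls := (\pi_toric_ring : RA -> toric_ring).

Lemma toric_eqP (p q : RA) : reflect (cls p = cls q) (p - q \in toric_ideal).
Proof. by rewrite Quotient.idealrBE; exact: eqP. Qed.

Lemma clsD : {morph cls : p q / p + q}.
Proof. by move=> p q; rewrite /= raddfD. Qed.

Lemma clsB : {morph cls : p q / p - q}.
Proof. by move=> p q; rewrite /= raddfB. Qed.

Lemma cls0 : cls 0 = 0.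
Proof. by rewrite -(subrr 0) clsB subrr. Qed.

Lemma clsM : {morph cls : p q / p * q}.
Proof. by move=> p q; rewrite /= rmorphM. Qed.

Lemma cls1 : cls 1 = 1.
Proof. by rewrite /= rmorph1. Qed.

Lemma toric_ringW (T : toric_ring -> Prop) :
  (forall p, T (cls p)) -> forall s, T s.
Proof. by move=> Tp s; rewrite -[s]reprK. Qed.

Definition toric_scale (p : RA) (s : toric_ring) : toric_ring := cls p * s.

Fact toric_scaleA p q s : toric_scale p (toric_scale q s) = toric_scale (p * q) s.
Proof. by rewrite /toric_scale clsM mulrA. Qed.
Fact toric_scale1 : left_id 1 toric_scale.
Proof. by move=> s; rewrite /toric_scale cls1 mul1r. Qed.
Fact toric_scaleDr : right_distributive toric_scale +%R.
Proof. by move=> p s t; rewrite /toric_scale mulrDr. Qed.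
Fact toric_scaleDl s : {morph toric_scale^~ s : p q / p + q}.
Proof. by move=> p q; rewrite /toric_scale clsD mulrDl. Qed.

HB.instance Definition _ := GRing.Zmodule_isLmodule.Build RA toric_ring
  toric_scaleA toric_scale1 toric_scaleDr toric_scaleDl.

Definition mnm_degA (m : 'X_{1..n}) : 'cV[int]_d := - \sum_j col j A *+ m j.

Definition mpoly_part (u : 'cV[int]_d) (p : RA) : RA :=
  \sum_(m <- msupp p | mnm_degA m == u) p@_m *: 'X_[m].

Lemma mcoeff_part u p m :
  (mpoly_part u p)@_m = if mnm_degA m == u then p@_m else 0.
Proof.
rewrite /mpoly_part raddf_sum /=.
have [ms|ms] := boolP (m \in msupp p); last first.
  rewrite (memN_msupp_eq0 ms) if_same big_seq_cond big1 // => k /andP[ks _].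
  rewrite mcoeffZ mcoeffX; case: eqP ks ms => [-> ->//|_ _ _].
  by rewrite mulr0.
rewrite big_mkcond (bigD1_seq m) ?msupp_uniq //= big1 ?addr0.
  by rewrite mcoeffZ mcoeffX eqxx mulr1.
move=> k /negPf km; case: ifP => // _.
by rewrite mcoeffZ mcoeffX km mulr0.
Qed.

Lemma mpoly_partB u : zmod_morphism (mpoly_part u).
Proof.
move=> p q; apply/mpolyP => m; rewrite !(mcoeffB, mcoeff_part).
by case: ifP; rewrite ?subrr.
Qed.

Lemma mpoly_partK u v p :
  mpoly_part u (mpoly_part v p) = if u == v then mpoly_part v p else 0.
Proof.
apply/mpolyP => m; rewrite (fun_if (mcoeff m)) mcoeff0 !mcoeff_part.
case: (eqVneq u v) => [->|uv]; first by case: (mnm_degA m == v).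
by case: (eqVneq _ u) => [->|//]; rewrite (negPf uv).
Qed.

Lemma mpoly_partC u c p : mpoly_part u (c%:MP * p) = c%:MP * mpoly_part u p.
Proof.
apply/mpolyP => m; rewrite !(mcoeff_part, mcoeffCM).
by case: ifP; rewrite ?mulr0.
Qed.

Lemma mnm_degAD m m' : mnm_degA (m + m') = mnm_degA m + mnm_degA m'.
Proof.
rewrite /mnm_degA -opprD -big_split; congr (- _); apply: eq_bigr => j _ /=.
by rewrite mnmDE mulrnDr.
Qed.

Lemma mnm_degAU j : mnm_degA U_(j) = - col j A.
Proof.
rewrite /mnm_degA (bigD1 j) //= big1 => [|k kj]; first by rewrite mnm1E eqxx addr0.
by rewrite mnm1E eq_sym (negPf kj).
Qed.

Lemma mpoly_part_X u m : mpoly_part u 'X_[m] = if mnm_degA m == u then 'X_[m] else 0.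
Proof.
apply/mpolyP => k; rewrite (fun_if (mcoeff k)) mcoeff0 mcoeff_part mcoeffX.
case: (eqVneq m k) => [->//|_]; by rewrite !if_same.
Qed.

Lemma mpoly_partXM u m p :
  mpoly_part (u + mnm_degA m) ('X_[m] * p) = 'X_[m] * mpoly_part u p.
Proof.
have p0 v : mpoly_part v 0 = 0 by rewrite -(subrr 0) mpoly_partB !subrr.
have pD v x y : mpoly_part v (x + y) = mpoly_part v x + mpoly_part v y.
  by rewrite -[y]opprK -[- y]sub0r !mpoly_partB p0 !sub0r !opprK.
elim/mpolyind: p => [|c k p _ _ IHp]; first by rewrite mulr0 !p0 mulr0.
rewrite mulrDr !pD mulrDr IHp; congr (_ + _).
rewrite -mul_mpolyC mulrCA !mpoly_partC mulrCA; congr (_ * _).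
rewrite -mpolyXD !mpoly_part_X mnm_degAD [mnm_degA m + _]addrC.
rewrite (inj_eq (addIr _)); case: ifP => _; last by rewrite mulr0.
by rewrite mpolyXD.
Qed.

Lemma mpoly_part_sum p : exists s : seq 'cV[int]_d,
  [/\ uniq s, forall u, u \notin s -> mpoly_part u p = 0
    & p = \sum_(u <- s) mpoly_part u p].
Proof.
pose s := undup [seq mnm_degA m | m <- msupp p].
have sP m : m \in msupp p -> mnm_degA m \in s.
  by move=> ms; rewrite mem_undup map_f.
exists s; split=> [|u us|]; first exact: undup_uniq.
  apply/mpolyP => m; rewrite mcoeff_part mcoeff0; case: eqP => // mu.
  by apply: memN_msupp_eq0; apply: contra us => /sP; rewrite mu.
apply/mpolyP => m; rewrite raddf_sum /=.
have [ms|ms] := boolP (m \in msupp p); last first.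
  rewrite (memN_msupp_eq0 ms) big1 // => u _.
  by rewrite mcoeff_part (memN_msupp_eq0 ms) if_same.
rewrite (bigD1_seq (mnm_degA m)) ?undup_uniq ?sP //= big1 ?addr0.
  by rewrite mcoeff_part eqxx.
by move=> u /negPf mu; rewrite mcoeff_part eq_sym mu.
Qed.

Lemma mnm_plusB u j : ((mnm_plus u j)%:Z - (mnm_minus u j)%:Z)%R = u j 0.
Proof.
have h0 : 0 <= Num.max 0 (u j 0) by rewrite le_max lexx.
have h1 : 0 <= Num.max 0 (u j 0) - u j 0 by rewrite subr_ge0 le_max lexx orbT.
by rewrite !mnmE (gez0_abs h0) (gez0_abs h1) opprB addrC subrK.
Qed.

Lemma mnm_degA_binomial u :
  A *m u = 0 -> mnm_degA (mnm_plus u) = mnm_degA (mnm_minus u).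
Proof.
move=> Au; apply/eqP; rewrite -subr_eq0 /mnm_degA opprK addrC subr_eq0.
rewrite -subr_eq0 -opprB -sumrB oppr_eq0; apply/eqP.
rewrite -[RHS]Au; apply/colP => i; rewrite summxE !mxE; apply: eq_bigr => j _.
have mulrZ (a : int) (k : nat) : a *+ k = a * k%:Z by rewrite -mulr_natr natz.
by rewrite mxE [X in _ + X]mxE !mulmxnE !mxE -mnm_plusB mulrBr !mulrZ.
Qed.

Lemma mpoly_part_ideal u p : p \in toric_ideal -> mpoly_part u p \in toric_ideal.
Proof.
have p0 v : mpoly_part v 0 = 0 by rewrite -(subrr 0) mpoly_partB !subrr.
have pD v x y : mpoly_part v (x + y) = mpoly_part v x + mpoly_part v y.
  by rewrite -[y]opprK -[- y]sub0r !mpoly_partB p0 !sub0r !opprK.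
elim/ideal_span_ind => [|x y hx hy|a g Gg]; first by rewrite p0 rpred0.
  by rewrite pD rpredD.
elim/mpolyind: a => [|c m a _ _ IHa]; first by rewrite mul0r p0 rpred0.
rewrite mulrDl pD rpredD // -mul_mpolyC -mulrA mpoly_partC idealMr //.
rewrite -[u](subrK (mnm_degA m)) mpoly_partXM idealMr //.
case: Gg => v [Av ->]; rewrite mpoly_partB !mpoly_part_X mnm_degA_binomial //.
case: ifP => _; last by rewrite subrr rpred0.
by rewrite -[X in X \in _]mul1r ideal_span_gen //; exists v.
Qed.

Definition toric_part (u : 'cV[int]_d) (s : toric_ring) : toric_ring :=
  cls (mpoly_part u (repr s)).

Lemma toric_part_cls u p : toric_part u (cls p) = cls (mpoly_part u p).
Proof.
apply/toric_eqP; rewrite -mpoly_partB; apply: mpoly_part_ideal.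
by apply/toric_eqP; exact: reprK.
Qed.

Fact toric_partB u : zmod_morphism (toric_part u).
Proof.
elim/toric_ringW => p; elim/toric_ringW => q.
by rewrite -clsB !toric_part_cls mpoly_partB clsB.
Qed.

Fact toric_partK u v s :
  toric_part u (toric_part v s) = if u == v then toric_part v s else 0.
Proof.
elim/toric_ringW: s => p; rewrite (toric_part_cls v) toric_part_cls mpoly_partK.
by case: ifP => // _; exact: cls0.
Qed.

Fact toric_part_sum t : exists s : seq 'cV[int]_d,
  [/\ uniq s, forall u, u \notin s -> toric_part u t = 0
    & t = \sum_(u <- s) toric_part u t].
Proof.
elim/toric_ringW: t => p; have [s [us s0 ps]] := mpoly_part_sum p.
exists s; split=> // [u /s0 pu0|]; first by rewrite toric_part_cls pu0 cls0.
rewrite {1}ps; elim: (s) => [|u s' IHs]; first by rewrite !big_nil cls0.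
by rewrite !big_cons clsD toric_part_cls IHs.
Qed.

Fact toric_partC u c s :
  toric_part u (c%:MP *: s) = c%:MP *: toric_part u s.
Proof.
elim/toric_ringW: s => p; rewrite toric_part_cls /GRing.scale /= /toric_scale -!clsM.
by rewrite toric_part_cls mpoly_partC.
Qed.

Fact toric_partX u j s :
  toric_part (u - col j A) ('X_j *: s) = 'X_j *: toric_part u s.
Proof.
elim/toric_ringW: s => p; rewrite toric_part_cls /GRing.scale /= /toric_scale -!clsM.
by rewrite toric_part_cls -mnm_degAU mpoly_partXM.
Qed.

Definition toric_grading : grading A toric_ring :=
  Grading toric_partB toric_partK toric_part_sum toric_partC toric_partX.

End Toric.

(* Main.v *)
(* Let S be the toric ring, t_j the class of d_j, and B = S[x_1, ..., x_n]. As a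
   vector space, D (x) S is B, and E_i - beta_i acts on it as multiplication by the
   symbol e_i = \sum_j a_ij x_j t_j plus an operator that preserves the degree in
   x. Removing the component of top x-degree of a cycle, it suffices that the
   Koszul complex of e_1, ..., e_d on B is acyclic.
   Let l be an integral functional that is positive on the nonzero columns of A.
   The functionals N l + e_i^* yield a chain of d + 1 primes below the maximal
   ideal generated by the t_j with a_j <> 0, so that by Cohen-Macaulayness this ideal
   contains a regular sequence of length d; with x_1, ..., x_n it gives a regular
   sequence of length d + n in B. On the other hand, there are n homogeneous
   elements g_k of B such that the radical of (e, g) contains all x_j and all t_j with
   a_j <> 0 (Noether normalization; the dimension count dim B/(e) <= n is made
   by counting monomials on each stratum of points where a given set of t_j does
   not vanish). By the acyclicity lemma of Peskine and Szpiro the Koszul complex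
   of (e, g) is acyclic, and by graded Nakayama the g_k can be removed. *)
From HB Require Import structures.
Require Import Defs.
From mathcomp Require Import all_boot all_order all_algebra.
From mathcomp Require Import ring lra zify.
From mathcomp Require Import ring_quotient generic_quotient.
From mathcomp Require Import boolp reals.
From mathcomp.real_closed Require Import complex.
From mathcomp.multinomials Require Import freeg mpoly.

Set Implicit Arguments.
Unset Strict Implicit.
Unset Printing Implicit Defensive.

Import Order.TTheory GRing.Theory Num.Theory.

Local Open Scope ring_scope.
Local Open Scope quotient_scope.

(** * Koszul complexes over a commutative ring *)

(** The number n in the dimension count arises in the same way on every stratum. Let r be the rank
    of the columns of [A] indexed by G. Where exactly the t_j with j in G are invertible, the
    symbols can be solved for r of the products x_j t_j, which leaves n - r of the variables x; a
    monomial in these t_j is determined by its degree, which r coordinates already fix; and (n - r)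
    + r = n. Localization is replaced by multiplication with powers of the product of the t_j over
    G, and dimension theory by a pigeonhole argument: elements of level k lie in a space of
    dimension at most a polynomial of degree n in k, so any n + 1 elements satisfy a polynomial
    relation. The graded arguments rest on a choice of weights: t_j has weight l(a_j) and x_j has
    weight c - l(a_j), with a constant c larger than all l(a_j). Then every x_j has positive weight
    and every product x_j t_j has weight c, so that the e_i are homogeneous. The t_j of weight 0
    belong to a_j = 0 and are equal to 1. *)

Section IdealPredicate.
Variable B : comNzRingType.

Record is_ideal (J : B -> Prop) : Prop := IsIdeal {
  is_ideal0 : J 0;
  is_idealD : forall a b, J a -> J b -> J (a + b);
  is_idealM : forall a b, J b -> J (a * b)
}.

Lemma is_ideal_sum J (hJ : is_ideal J) (I : Type) (s : seq I) (P : pred I) (F : I -> B) :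
  (forall i, P i -> J (F i)) -> J (\sum_(i <- s | P i) F i).
Proof.
by move=> JF; apply: (big_ind J) => //; [apply: is_ideal0 | apply: is_idealD].
Qed.

Lemma is_idealB J a b : is_ideal J -> J a -> J b -> J (a - b).
Proof.
by move=> hJ Ja Jb; apply: is_idealD => //; rewrite -mulN1r; apply: is_idealM.
Qed.

Lemma is_ideal_span (G : B -> Prop) : is_ideal (fun b => b \in ideal_span G).
Proof.
split; first exact: ideal_span0.
  by move=> a b aG bG; rewrite -[a]mul1r; apply: ideal_span_closed.
by move=> a b bG; rewrite -[_ * _]addr0; apply: ideal_span_closed => //; apply: ideal_span0.
Qed.

End IdealPredicate.

Section KoszulRing.
Variables (B : comNzRingType) (N : nat) (r : 'I_N -> B).

Local Notation chain := {ffun {set 'I_N} -> B^o}.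
Local Notation sg := (koszul_sign B).
Local Notation deg := (@koszul_deg B B^o N).

Definition ring_koszul (z : chain) : chain :=
  koszul_diff (fun i (b : B^o) => r i * b : B^o) z.
Local Notation kz := ring_koszul.

Lemma ring_koszulE z T :
  kz z T = \sum_(i | i \notin T) sg i T * (r i * z (i |: T)).
Proof. by rewrite ffunE. Qed.

Lemma ring_koszulP b z w : kz (b *: z + w) = b *: kz z + kz w.
Proof.
apply/ffunP => T; rewrite !ffunE /GRing.scale /= mulr_sumr -big_split /=.
by apply: eq_bigr => i _; rewrite !ffunE /GRing.scale /= !mulrDr; congr (_ + _); ring.
Qed.

Lemma ring_koszulD : {morph kz : z w / z + w}.
Proof. by move=> z w; rewrite -{1}[z]scale1r ring_koszulP scale1r. Qed.

Lemma ring_koszul0 : kz 0 = 0.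
Proof. by apply: (addrI (kz 0)); rewrite -ring_koszulD !addr0. Qed.

Lemma ring_koszulZ b z : kz (b *: z) = b *: kz z.
Proof. by rewrite -[b *: z]addr0 ring_koszulP ring_koszul0 addr0. Qed.

Lemma ring_koszulN z : kz (- z) = - kz z.
Proof. by rewrite -scaleN1r ring_koszulZ scaleN1r. Qed.

Lemma ring_koszulB : {morph kz : z w / z - w}.
Proof. by move=> z w; rewrite ring_koszulD ring_koszulN. Qed.

Lemma ring_koszulK z : kz (kz z) = 0.
Proof.
apply: koszul_diffK => [i b u v|i j u]; last by rewrite mulrCA.
by rewrite mulrDr /GRing.scale /= mulrCA.
Qed.

Lemma koszul_degD p z w : deg p z -> deg p w -> deg p (z + w).
Proof.
move=> hz hw T; rewrite ffunE; have [zT|/hz //] := eqVneq (z T) 0.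
by rewrite zT add0r => /hw.
Qed.

Lemma koszul_degZ p b z : deg p z -> deg p (b *: z).
Proof.
move=> hz T; rewrite ffunE; have [zT|/hz //] := eqVneq (z T) 0.
by rewrite zT scaler0 eqxx.
Qed.

Lemma ring_koszul_deg p z : deg p.+1 z -> deg p (kz z).
Proof.
apply: koszul_diff_deg => i b u v.
by rewrite mulrDr /GRing.scale /= mulrCA.
Qed.

Lemma koszul_sign_sqr i (T : {set 'I_N}) : sg i T * sg i T = 1.
Proof. by rewrite /koszul_sign -exprD addnn -mul2n exprM sqrrN !expr1n. Qed.

Lemma koszul_sign_swap i j (T : {set 'I_N}) : i \notin T -> j \notin T -> i != j ->
  sg j (i |: T) * sg i (j |: T) = - (sg i T * sg j T).
Proof.
move=> iT jT ij; rewrite !koszul_signU //.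
case: (ltngtP i j) => [_|_|/val_inj/eqP]; last by rewrite (negPf ij).
  by rewrite expr1 expr0; ring.
by rewrite expr1 expr0; ring.
Qed.

Lemma koszul_sign_swapl i j (T : {set 'I_N}) : i \notin T -> j \notin T -> i != j ->
  sg i T * sg j (i |: T) = - (sg j T * sg i (j |: T)).
Proof.
move=> iT jT ij; rewrite !koszul_signU //.
case: (ltngtP i j) => [_|_|/val_inj/eqP]; last by rewrite (negPf ij).
  by rewrite expr1 expr0; ring.
by rewrite expr1 expr0; ring.
Qed.

(* Contracting homotopy [e_i /\ _] for multiplication by [r i]. *)
Definition koszul_wedge (i : 'I_N) (z : chain) : chain :=
  [ffun T : {set 'I_N} => if i \in T then sg i (T :\ i) * z (T :\ i) else 0 : B^o].

Lemma koszul_wedgeP i z :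
  kz (koszul_wedge i z) + koszul_wedge i (kz z) = r i *: z.
Proof.
apply/ffunP => T; rewrite [LHS]ffunE ring_koszulE ffunE [RHS]ffunE.
case: (boolP (i \in T)) => iT.
  set U := T :\ i; have TU : T = i |: U by rewrite setD1K.
  have iU : i \notin U by rewrite !inE eqxx.
  rewrite ring_koszulE [X in _ + _ * X](bigD1 i) //= mulrDr addrCA.
  rewrite -TU mulrA koszul_sign_sqr mul1r [X in _ + X](_ : _ = 0) ?addr0 //.
  rewrite mulr_sumr [X in X + _](eq_bigl (fun j => (j \notin U) && (j != i))); last first.
    by move=> j; rewrite TU !inE negb_or andbC.
  rewrite -big_split big1 //= => j /andP[jU ji].
  rewrite ffunE TU !inE eqxx orbT setUCA setU1K; last first.
    by rewrite in_setU1 negb_or eq_sym ji iU.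
  set Z := z _; transitivity (r j * Z * (sg j (i |: U) * sg i (j |: U) + sg i U * sg j U)).
    by ring.
  by rewrite koszul_sign_swap 1?eq_sym // addNr mulr0.
rewrite (bigD1 i) //= big1 => [|j /andP[jT ji]].
  rewrite ffunE setU11 setU1K // !addr0; set Z := z _.
  by rewrite mulrA mulrACA koszul_sign_sqr mul1r.
by rewrite ffunE in_setU1 eq_sym (negPf ji) (negPf iT) !mulr0.
Qed.

Lemma koszul_wedge_deg i p z : deg p z -> deg p.+1 (koszul_wedge i z).
Proof.
move=> hz T; rewrite ffunE; case: ifP => [iT|_]; last by rewrite eqxx.
have [->|/hz <- _] := eqVneq (z (T :\ i)) 0; first by rewrite mulr0 eqxx.
by rewrite [LHS](cardsD1 i) iT.
Qed.

Definition in_ideal (J : B -> Prop) (z : chain) := forall T, J (z T).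

(** The homotopies for the generators [r i] are combined linearly. They have coefficients in [B], so
    they respect every ideal [J]; this lets the acyclicity lemma use them modulo the ideals
    [J k]. *)
Lemma koszul_homotopy x : x \in ideal_span (fun b => exists i, b = r i) ->
  exists h : chain -> chain,
   [/\ forall z, kz (h z) + h (kz z) = x *: z,
       forall p z, deg p z -> deg p.+1 (h z)
     & forall J z, is_ideal J -> in_ideal J z -> in_ideal J (h z)].
Proof.
elim/ideal_span_ind => {x} [|x y [h [hP hd hJ]] [k [kP kd kJ]]|a _ [i ->]].
- exists (fun=> 0); split=> [z|p z _ T|J z [] J0 _ _ _ T].
  + by rewrite ring_koszul0 addr0 scale0r.
  + by rewrite ffunE eqxx.
  + by rewrite ffunE.
- exists (fun z => h z + k z); split=> [z|p z zp|J z iJ Jz T].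
  + by rewrite ring_koszulD scalerDl -hP -kP addrACA.
  + by apply: koszul_degD; auto.
  + rewrite ffunE; by apply: (is_idealD iJ); [exact: hJ | exact: kJ].
exists (fun z => a *: koszul_wedge i z); split=> [z|p z zp|J z iJ Jz T].
- by rewrite ring_koszulZ -scalerDr koszul_wedgeP scalerA.
- by apply/koszul_degZ/koszul_wedge_deg.
rewrite !ffunE; apply: (is_idealM iJ); case: ifP => _; last exact: (is_ideal0 iJ).
exact: (is_idealM iJ).
Qed.

Definition ring_koszul_acyclic : Prop := forall p z, (0 < p)%N ->
  deg p z -> kz z = 0 -> exists2 w, deg p.+1 w & kz w = z.

Lemma in_ideal_kz J z : is_ideal J -> in_ideal J z -> in_ideal J (kz z).
Proof.
move=> iJ Jz T; rewrite ring_koszulE; apply: is_ideal_sum => // i _.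
by do 2!apply: is_idealM => //; apply: Jz.
Qed.

(* The elementwise form of the Peskine-Szpiro acyclicity lemma: by descending
   induction on [k], a chain of degree at least [k.+1] that is a cycle modulo
   [J k] is a boundary modulo [J k]. *)
Lemma koszul_acyclicity (f : nat -> B) (J : nat -> B -> Prop) :
  (forall b, J 0%N b <-> b = 0) -> (forall k, is_ideal (J k)) ->
  (forall k b, (k < N)%N -> J k.+1 b <-> exists c, J k (b - f k * c)) ->
  (forall k b, (k < N)%N -> J k (f k * b) -> J k b) ->
  (forall k, (k < N)%N -> exists M, f k ^+ M \in ideal_span (fun b => exists i, b = r i)) ->
  ring_koszul_acyclic.
Proof.
move=> J0 iJ JS Jreg ftor.
suff main l : (l <= N)%N -> forall p z, (N - l < p)%N -> deg p z ->
    in_ideal (J (N - l)%N) (kz z) ->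
    exists2 w, deg p.+1 w & in_ideal (J (N - l)%N) (z - kz w).
  move=> p z p0 zp dz; have := main N (leqnn N) p z; rewrite subnn => /(_ p0 zp).
  case=> [T|w wp zw]; first by apply/J0; rewrite dz ffunE.
  exists w => //; apply/esym/eqP; rewrite -subr_eq0; apply/eqP/ffunP => T.
  by rewrite [RHS]ffunE; apply/J0.
elim: l => [|l IHl] lN p z lp zp dz.
  (* Here [p] exceeds [N], and no subset of 'I_N has [p] elements, so [z] is zero. *)
  exists 0; first by move=> T; rewrite ffunE eqxx.
  move=> T; have [zT|/zp Tp] := eqVneq (z T) 0.
    by rewrite ring_koszul0 !ffunE zT subrr; exact: (is_ideal0 (iJ _)).
  by move: (max_card (mem T)) lp; rewrite Tp card_ord subn0 ltnNge => ->.
set k := (N - l.+1)%N in lp dz *.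
have kS : (N - l)%N = k.+1 by rewrite /k subnSK.
have kN : (k < N)%N by rewrite -kS leq_subr.
have {}IHl := IHl (ltnW lN); rewrite kS in IHl.
have JkS b : J k b -> J k.+1 b by move=> Jb; apply/JS => //; exists 0; rewrite mulr0 subr0.
have Jkf b : J k.+1 (f k * b).
  by apply/JS => //; exists b; rewrite subrr; exact: (is_ideal0 (iJ _)).
(* One factor [f k] can be cancelled. If f_k y = kz w modulo J_k, then [w] is a cycle modulo J_{k+1}
   of degree p + 1, so by induction w = kz v + f_k c modulo J_k. Hence f_k y = f_k kz c, and [f k]
   is a nonzerodivisor modulo J_k. *)
have step y : deg p y -> in_ideal (J k) (kz y) ->
    (exists2 w, deg p.+1 w & in_ideal (J k) (f k *: y - kz w)) ->
    exists2 w, deg p.+1 w & in_ideal (J k) (y - kz w).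
  move=> yp dy [w wp fw].
  have [||v vp wv] := IHl p.+1 w _ wp; first by rewrite ltnS.
    move=> T; rewrite (_ : kz w T = (f k *: y) T - (f k *: y - kz w) T); last first.
      by rewrite !ffunE opprB addrC subrK.
    apply: (is_idealB (iJ k.+1)); last exact: JkS.
    by rewrite ffunE; apply: Jkf.
  have /fin_all_exists [c0 c0P] : forall T, exists c, J k ((w - kz v) T - f k * c).
    by move=> T; apply/JS.
  (* The coefficients [c0] were chosen subset by subset. Truncating them restores homogeneity, and
     is harmless because [w] and [kz v] vanish on subsets of other sizes. *)
  pose c1 : chain := [ffun T : {set 'I_N} => if #|T| == p.+1 then c0 T else 0 : B^o].
  have c1p : deg p.+1 c1.
    by move=> T; rewrite ffunE; case: (#|T| =P p.+1) => // _; rewrite eqxx.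
  have c1P : in_ideal (J k) (w - kz v - f k *: c1).
    move=> T; rewrite !ffunE; case: eqP => [_|Tp].
      by have := c0P T; rewrite !ffunE.
    have -> : w T = 0 by apply/eqP/negPn/negP => /wp.
    have := ring_koszul_deg vp (S := T); rewrite ffunE.
    case: eqP => [-> _|_ /(_ isT) //].
    by rewrite scaler0 !subr0; exact: (is_ideal0 (iJ _)).
  exists c1 => // T; apply: Jreg => //.
  rewrite (_ : f k * _ = (f k *: y - kz w) T + kz (w - kz v - f k *: c1) T); last first.
    rewrite !ring_koszulB ring_koszulZ ring_koszulK subr0 !ffunE /GRing.scale /=; ring.
  by apply: (is_idealD (iJ k)); [exact: fw | exact: in_ideal_kz].
(* A power of [f k] lies in the ideal of the [r i], so its product with [z] is a boundary modulo
   J_k; the factors are then cancelled one at a time. *)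
have [M /koszul_homotopy [h [hP hd hJ]]] := ftor _ kN.
have : exists2 w, deg p.+1 w & in_ideal (J k) (f k ^+ M *: z - kz w).
  exists (h z); first exact: hd.
  by rewrite -hP addrC addKr; apply: hJ.
elim: M {h hP hd hJ} => [|M IHM]; first by rewrite scale1r.
rewrite exprS -scalerA => /step step'; apply: IHM; apply: step'.
  exact: koszul_degZ.
by move=> T; rewrite ring_koszulZ ffunE; exact: (is_idealM (iJ _)).
Qed.

(* The Koszul complex of [r i], [i < m], inside that of [r]. *)
Definition koszul_supp (m : nat) (z : chain) :=
  forall T : {set 'I_N}, z T != 0 -> forall i, i \in T -> (i < m)%N.

Definition koszul_acyclic_upto (m : nat) : Prop := forall p z, (0 < p)%N ->
  deg p z -> koszul_supp m z -> kz z = 0 ->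
  exists w, [/\ deg p.+1 w, koszul_supp m w & kz w = z].

Lemma koszul_acyclic_uptoN : ring_koszul_acyclic -> koszul_acyclic_upto N.
Proof.
move=> ac p z p0 zp _ /(ac p z p0 zp) [w wp dw]; by exists w; split=> // T _ i _.
Qed.

Lemma koszul_suppD m z w : koszul_supp m z -> koszul_supp m w -> koszul_supp m (z + w).
Proof.
move=> hz hw T; rewrite ffunE; have [zT|/hz //] := eqVneq (z T) 0.
by rewrite zT add0r => /hw.
Qed.

(* The long exact sequence for adjoining [r o]. *)
Lemma koszul_last_surj (o : 'I_N) p z : koszul_acyclic_upto o.+1 -> (0 < p)%N ->
  deg p z -> koszul_supp o z -> kz z = 0 ->
  exists z1 w, [/\ deg p z1, koszul_supp o z1 & kz z1 = 0] /\
    [/\ deg p.+1 w, koszul_supp o w & z = r o *: z1 + kz w].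
Proof.
move=> ac p0 zp zs dz; have [||w [wp ws dw]] := ac p z p0 zp => //.
  by move=> T /zs h i /h /ltnW.
have wsub (T : {set 'I_N}) i : w T != 0 -> i \in T -> i != o -> (i < o)%N.
  move=> /ws h /h; rewrite ltnS leq_eqVlt => /orP[/eqP/val_inj -> |//].
  by rewrite eqxx.
have zo (T : {set 'I_N}) : o \in T -> z T = 0.
  move=> oT; apply/eqP/negPn/negP => /zs/(_ _ oT).
  by rewrite ltnn.
(* The chain [w] is split along e_o: [z1] holds the coefficients on subsets containing [o], with
   signs, and [w1] the others. The equation kz w = z read on subsets containing [o] gives kz z1 = 0,
   and read on the other subsets it gives the decomposition of [z]. *)
pose z1 : chain := [ffun T : {set 'I_N} =>
  if o \in T then 0 else sg o T * w (o |: T) : B^o].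
pose w1 : chain := [ffun T : {set 'I_N} => if o \in T then 0 else w T : B^o].
exists z1, w1; do !split.
- move=> T; rewrite ffunE; case: ifP => [_|oT]; first by rewrite eqxx.
  have [->|/wp] := eqVneq (w (o |: T)) 0; first by rewrite mulr0 eqxx.
  by rewrite cardsU1 oT add1n => -[->].
- move=> T; rewrite ffunE; case: ifP => [_|oT]; first by rewrite eqxx.
  have [->|woT _ i iT] := eqVneq (w (o |: T)) 0; first by rewrite mulr0 eqxx.
  apply: (wsub _ i woT); first by rewrite in_setU1 iT orbT.
  by apply: contraTneq iT => ->; rewrite oT.
- apply/ffunP => T; rewrite ring_koszulE [RHS]ffunE.
  have [oT|oT] := boolP (o \in T).
    by rewrite big1 // => i _; rewrite ffunE in_setU1 oT orbT !mulr0.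
  transitivity (- (sg o T * kz w (o |: T))); last first.
    by rewrite dw zo ?setU11 // mulr0 oppr0.
  rewrite ring_koszulE mulr_sumr -sumrN (bigD1 o) //= ffunE setU11 !mulr0 add0r.
  apply: eq_big => [i|i /andP[iT io]]; first by rewrite in_setU1 negb_or andbC.
  rewrite ffunE in_setU1 eq_sym (negPf io) (negPf oT) /= setUCA.
  set W := w _; transitivity (sg i T * sg o (i |: T) * (r i * W)); first by ring.
  by rewrite koszul_sign_swapl //; ring.
- move=> T; rewrite ffunE; case: ifP => [_|_ /wp //]; by rewrite eqxx.
- move=> T; rewrite ffunE; case: ifP => [_|oT wT i iT]; first by rewrite eqxx.
  by apply: (wsub _ _ wT iT); apply: contraTneq iT => ->; rewrite oT.
apply/ffunP => T; rewrite !ffunE; have [oT|oT] := boolP (o \in T).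
  rewrite zo // scaler0 add0r big1 // => i _.
  by rewrite ffunE in_setU1 oT orbT mulr0 scaler0.
rewrite -{1}dw ring_koszulE (bigD1 o) //= [X in _ = _ + X](bigD1 o) //=.
rewrite ffunE setU11 mulr0 scaler0 add0r /GRing.scale /= mulrCA; congr (_ + _).
apply: eq_bigr => i /andP[iT io].
by rewrite ffunE in_setU1 eq_sym (negPf io) (negPf oT).
Qed.

(* A grading of [B] is encoded as the ring morphism [b |-> \sum_k b_k X^k]. *)
Section Graded.
Variables (alpha : {rmorphism B -> {poly B}}) (wt : 'I_N -> nat).
Hypothesis alpha_r : forall i, alpha (r i) = r i *: 'X^(wt i).
Hypothesis alpha1 : forall b, (alpha b).[1] = b.

(** The basis element e_T gets the total weight of [T], which makes the Koszul differential
    homogeneous of degree 0. *)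
Let shift (T : {set 'I_N}) := (\sum_(i in T) wt i)%N.

Definition koszul_comp (k : nat) (z : chain) : chain :=
  [ffun T : {set 'I_N} => (alpha (z T) * 'X^(shift T))`_k : B^o].

Lemma koszul_compD k : {morph koszul_comp k : z w / z + w}.
Proof. by move=> z w; apply/ffunP => T; rewrite !ffunE rmorphD mulrDl coefD. Qed.

Lemma koszul_comp_kz k z : koszul_comp k (kz z) = kz (koszul_comp k z).
Proof.
apply/ffunP => T; rewrite ffunE !ring_koszulE rmorph_sum mulr_suml coef_sum.
apply: eq_bigr => i iT; rewrite ffunE !rmorphM alpha_r.
have -> : shift (i |: T) = (wt i + shift T)%N by rewrite /shift big_setU1.
rewrite exprD /koszul_sign rmorphXn rmorphN1 -scalerAl -scalerAr -!scalerAl coefZ.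
have -> (e : nat) (p : {poly B}) : (-1) ^+ e * p = ((-1) ^+ e)%:P * p.
  by rewrite rmorphXn rmorphN1.
by rewrite -mulrA coefCM mulrCA ['X^(wt i) * alpha _]mulrC -mulrA.
Qed.

Lemma koszul_compZ k o z : koszul_comp k (r o *: z) =
  if (k < wt o)%N then 0 else r o *: koszul_comp (k - wt o) z.
Proof.
have E T : koszul_comp k (r o *: z) T =
    r o * ('X^(wt o) * (alpha (z T) * 'X^(shift T)))`_k.
  by rewrite !ffunE rmorphM alpha_r -!scalerAl coefZ -mulrA.
case: ifP => ko; apply/ffunP => T; rewrite E coefXnM ko.
  by rewrite mulr0 ffunE.
by rewrite !ffunE.
Qed.

Lemma koszul_comp_sum z : exists K, z = \sum_(k < K) koszul_comp k z.
Proof.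
exists (\max_(T : {set 'I_N}) size (alpha (z T) * 'X^(shift T))%R).
apply/ffunP => T; rewrite sum_ffunE.
under eq_bigr do rewrite ffunE.
transitivity (alpha (z T) * 'X^(shift T)).[1].
  by rewrite hornerM hornerXn expr1n mulr1 alpha1.
rewrite (horner_coef_wide _ (leq_bigmax (F := fun T => size (alpha (z T) * 'X^(shift T))%R) T)).
by apply: eq_bigr => i _; rewrite expr1n mulr1.
Qed.

Lemma koszul_comp_supp k z T : koszul_comp k z T != 0 -> z T != 0.
Proof. by rewrite ffunE; apply: contraNneq => ->; rewrite rmorph0 mul0r coef0. Qed.

(* Graded Nakayama, applied to the homology of the smaller complex. *)
Lemma koszul_acyclic_upto_pred (o : 'I_N) : (0 < wt o)%N ->
  koszul_acyclic_upto o.+1 -> koszul_acyclic_upto o.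
Proof.
move=> wto ac p z p0 zp zs dz.
suff comp k z' : deg p z' -> koszul_supp o z' -> kz z' = 0 ->
    exists w, [/\ deg p.+1 w, koszul_supp o w & kz w = koszul_comp k z'].
  have [K zK] := koszul_comp_sum z; rewrite zK; elim: K {zK} => [|K [w [wp ws dw]]].
    exists 0; split; last by rewrite big_ord0 ring_koszul0.
      by move=> T; rewrite ffunE eqxx.
    by move=> T; rewrite ffunE eqxx.
  have [v [vp vs dv]] := comp K z zp zs dz.
  exists (w + v); split; [exact: koszul_degD|exact: koszul_suppD|].
  by rewrite big_ord_recr /= ring_koszulD dw dv.
(* Up to a boundary [z] is r_o z1, so its component of degree k comes from the component of [z1] of
   degree k - wt o, which is smaller because [wt o] is positive. Hence [z] is generalized in the
   induction. *)
elim/ltn_ind: k z' {z zp zs dz} => k IHk z zp zs dz.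
have [z1 [w [[z1p z1s dz1] [wp ws ->]]]] := koszul_last_surj ac p0 zp zs dz.
rewrite koszul_compD koszul_comp_kz koszul_compZ.
have cwp : deg p.+1 (koszul_comp k w) by move=> T /koszul_comp_supp/wp.
have cws : koszul_supp o (koszul_comp k w) by move=> T /koszul_comp_supp/ws.
case: ltnP => ko; first by exists (koszul_comp k w); rewrite add0r.
have [|v [vp vs dv]] := IHk (k - wt o)%N _ z1 z1p z1s dz1.
  by rewrite ltn_subrL wto (leq_trans wto ko).
exists (r o *: v + koszul_comp k w); split.
- by apply: koszul_degD => //; apply: koszul_degZ.
- apply: koszul_suppD => // T; rewrite ffunE => h; apply: vs.
  by apply: contraNneq h => ->; rewrite scaler0.
by rewrite ring_koszulP dv.
Qed.

Lemma koszul_acyclic_upto_le m : (m <= N)%N ->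
  (forall i : 'I_N, (m <= i)%N -> (0 < wt i)%N) -> ring_koszul_acyclic ->
  koszul_acyclic_upto m.
Proof.
move=> mN wtm ac; rewrite -(subKn mN); have: (N - m <= N - m)%N by [].
elim: {1 3}(N - m)%N => [|l IHl] lm; first by rewrite subn0; apply: koszul_acyclic_uptoN.
have lN : (N - l.+1 < N)%N by rewrite ltn_subrL (leq_ltn_trans _ (leq_trans lm (leq_subr _ _))).
apply: (@koszul_acyclic_upto_pred (Ordinal lN)) => /=.
  by apply: wtm => /=; lia.
have -> : (N - l.+1).+1 = (N - l)%N by lia.
by apply: IHl; lia.
Qed.

End Graded.

End KoszulRing.

(** * Restriction of the Koszul complex to the first elements *)

Section KoszulWiden.
Variables (B : comNzRingType) (d m : nat) (r : 'I_(d + m) -> B).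

Local Notation emb := (lshift m : 'I_d -> 'I_(d + m)).

Lemma lshift_imsetK : cancel (fun T : {set 'I_d} => emb @: T)
  (fun T : {set 'I_(d + m)} => emb @^-1: T).
Proof.
move=> T; apply/setP => i; rewrite inE mem_imset //; exact: lshift_inj.
Qed.

Lemma koszul_sign_lshift (i : 'I_d) (T : {set 'I_d}) :
  koszul_sign B (emb i) (emb @: T) = koszul_sign B i T.
Proof.
rewrite /koszul_sign; congr (_ ^+ _).
rewrite -(card_imset _ (@lshift_inj d m)); congr #|pred_of_set _|.
apply/setP => j; rewrite inE; apply/andP/imsetP.
  by case=> /imsetP [k kT ->] /= ki; exists k; rewrite ?inE ?kT.
by case=> k; rewrite inE => /andP[kT ki] ->; rewrite mem_imset //; exact: lshift_inj.
Qed.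

(** The embedding of indices is increasing and so preserves the signs. A chain is extended by zero
    to all subsets, and the bounding chain is restricted back. *)
Lemma ring_koszul_acyclic_lshift :
  koszul_acyclic_upto r d -> ring_koszul_acyclic (fun i => r (emb i)).
Proof.
move=> ac p z p0 zp dz.
have inE_lt (T : {set 'I_(d + m)}) : (forall i, i \in T -> (i < d)%N) ->
    emb @: (emb @^-1: T) = T.
  move=> Td; apply/setP => i; apply/imsetP/idP => [[j]|iT]; first by rewrite inE => ? ->.
  by exists (Ordinal (Td _ iT)); [rewrite inE /= |]; rewrite (_ : lshift _ _ = i) //; apply: val_inj.
pose z' : {ffun {set 'I_(d + m)} -> B^o} :=
  [ffun T : {set 'I_(d + m)} => if T == emb @: (emb @^-1: T) then z (emb @^-1: T) else 0 : B^o].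
have res (w : {ffun {set 'I_(d + m)} -> B^o}) (T : {set 'I_d}) : koszul_supp d w ->
    ring_koszul r w (emb @: T) =
    ring_koszul (fun i => r (emb i)) [ffun T : {set 'I_d} => w (emb @: T) : B^o] T.
  move=> ws; rewrite !ring_koszulE big_split_ord /= [X in _ + X]big1 ?addr0; last first.
    move=> i _; have [->|/ws/(_ (rshift d i))] := eqVneq (w (rshift d i |: emb @: T)) 0.
      by rewrite !mulr0.
    by rewrite setU11 => /(_ isT) /=; rewrite ltnNge leq_addr.
  apply: eq_big => [i|i _]; first by rewrite mem_imset //; exact: lshift_inj.
  by rewrite ffunE koszul_sign_lshift imsetU1.
have z's : koszul_supp d z'.
  move=> T; rewrite ffunE; case: (T =P _) => [-> _ i|]; last by rewrite eqxx.
  by case/imsetP => j _ -> /=.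
have rz' : [ffun T : {set 'I_d} => z' (emb @: T) : B^o] = z.
  by apply/ffunP => T; rewrite !ffunE lshift_imsetK eqxx.
have [|||w [wp ws dw]] := ac p z' p0.
- move=> T; rewrite ffunE; case: (T =P _) => [Te /zp <-|]; last by rewrite eqxx.
  by rewrite {1}Te card_imset //; exact: lshift_inj.
- exact: z's.
- apply/ffunP => T; rewrite [RHS]ffunE.
  have [/inE_lt <-|Td] := pselect (forall i, i \in T -> (i < d)%N).
    by rewrite res // rz' dz ffunE.
  rewrite ring_koszulE big1 // => i iT.
  have [->|/z's h] := eqVneq (z' (i |: T)) 0; first by rewrite !mulr0.
  by case: Td => j jT; apply: h; rewrite in_setU1 jT orbT.
exists [ffun T : {set 'I_d} => w (emb @: T) : B^o].
  by move=> T; rewrite ffunE => /wp; rewrite card_imset //; exact: lshift_inj.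
by apply/ffunP => T; rewrite -res // dw -[in RHS]rz' [RHS]ffunE.
Qed.

End KoszulWiden.

(** * Algebraic relations modulo the radical of the symbol ideal *)

(** With r the rank, [h] selects r rows spanning the row space and [f] selects r columns on which
    these rows form an invertible block, whose inverse supplies [l]. Later [f] names the variables x
    that are eliminated, and [h] the coordinates of the degree that determine all the others. *)
Lemma rank_submatrix (F : fieldType) (d n : nat) (M : 'M[F]_(d, n)) :
  exists (r : nat) (f : 'I_r -> 'I_n) (h : 'I_r -> 'I_d),
  [/\ injective f,
      forall a, exists l : 'I_d -> F,
        forall b, \sum_i l i * M i (f b) = (a == b)%:R
    & forall v : 'I_n -> F, (forall a, \sum_j M (h a) j * v j = 0) ->
        forall i, \sum_j M i j * v j = 0].
Proof.
pose h := maxrankfun M; pose N := rowsub h M.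
have Nfree : row_free N by exact: maxrowsub_free.
have NTfull : row_full N^T by rewrite /row_full mxrank_tr.
pose f := fullrankfun NTfull.
have Qu : rowsub f N^T \in unitmx by exact: fullrowsub_unit.
exists (\rank M), f, h; split; first exact: fullrankfun_inj.
  move=> a; pose y := invmx (rowsub f N^T).
  have yP b : \sum_c y c a * M (h c) (f b) = (a == b)%:R.
    have := congr1 (fun Z : 'M_(\rank M) => Z b a) (mulmxV Qu); rewrite !mxE eq_sym => <-.
    by apply: eq_bigr => c _; rewrite !mxE mulrC.
  exists (fun i => \sum_(c | h c == i) y c a) => b.
  rewrite -yP (partition_big h predT) //=; apply: eq_bigr => i _.
  by rewrite mulr_suml; apply: eq_bigr => c /eqP ->.
move=> v hv i.
have /submxP [Y MY] : (M <= N)%MS by rewrite (eq_maxrowsub M).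
have Nv : N *m (\col_j v j) = 0.
  by apply/colP => a; rewrite !mxE -[RHS](hv a); apply: eq_bigr => j _; rewrite !mxE.
have := congr1 (fun Z : 'cV_d => Z i 0) (congr1 (mulmx^~ (\col_j v j)) MY).
rewrite -mulmxA Nv mulmx0 !mxE => E; rewrite -[RHS]E.
by apply: eq_bigr => j _; rewrite mxE.
Qed.

Definition entry_sum d n (A : 'M[int]_(d, n)) := (\sum_i \sum_j `|A i j|)%N.

Lemma absz_shift (s : int) (o : nat) : `|s| <= o%:Z -> (absz (s + o%:Z)%R <= o.*2)%N.
Proof. lia. Qed.

Lemma absz_shift_inj (o : nat) (s s' : int) : `|s| <= o%:Z -> `|s'| <= o%:Z ->
  absz (s + o%:Z)%R = absz (s' + o%:Z)%R -> s = s'.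
Proof. lia. Qed.

Section Radical.
Variable B : comNzRingType.

Definition in_rad (J : B -> Prop) (b : B) := exists N, J (b ^+ N).

Lemma in_rad_sub (J : B -> Prop) b : J b -> in_rad J b. Proof. by exists 1%N. Qed.

Lemma in_radX (J : B -> Prop) (iJ : is_ideal J) b N M : J (b ^+ N) -> (N <= M)%N -> J (b ^+ M).
Proof. by move=> JN /subnK <-; rewrite exprD; apply: is_idealM. Qed.

Lemma is_ideal_rad (J : B -> Prop) : is_ideal J -> is_ideal (in_rad J).
Proof.
move=> iJ; split; first by exists 1%N; rewrite expr1; apply: is_ideal0.
  move=> a b [N aN] [M bM]; exists (N + M)%N; rewrite exprDn.
  apply: is_ideal_sum => // -[i /= iNM] _; rewrite -mulr_natl.
  apply: is_idealM => //; have [MI|/ltnW MI] := leqP M i.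
    by apply: is_idealM => //; apply: in_radX bM _.
  rewrite mulrC; apply: is_idealM => //; apply: in_radX aN _ => //; lia.
by move=> a b [N bN]; exists N; rewrite exprMn; apply: is_idealM.
Qed.

Lemma in_rad_rad (J : B -> Prop) : is_ideal J -> forall b, in_rad (in_rad J) b -> in_rad J b.
Proof. by move=> iJ b [N [M]]; rewrite -exprM => h; exists (N * M)%N. Qed.

Lemma ideal_span_sub (G J : B -> Prop) b : is_ideal J -> (forall g, G g -> J g) ->
  b \in ideal_span G -> J b.
Proof.
move=> iJ GJ; elim/ideal_span_ind => [|x y|a g /GJ]; first exact: is_ideal0.
  exact: is_idealD.
exact: is_idealM.
Qed.

Lemma ideal_span_mem (G : B -> Prop) b : G b -> b \in ideal_span G.
Proof. by move=> Gb; rewrite -[b]mul1r; apply: ideal_span_gen. Qed.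

Lemma ideal_span_mono (G H : B -> Prop) b : (forall g, G g -> g \in ideal_span H) ->
  b \in ideal_span G -> b \in ideal_span H.
Proof. by move=> GH; apply: (ideal_span_sub (is_ideal_span H)). Qed.

End Radical.

Section Relations.
Variables (K : numFieldType) (B : comNzRingType) (io : {rmorphism K -> B}).
Variables (d n : nat) (A : 'M[int]_(d, n)) (t x : 'I_n -> B).

Local Notation mon y u := (\prod_j y j ^+ u j).

Hypothesis tA : forall u v : 'I_n -> nat,
  (forall i, \sum_j A i j * (u j)%:Z = \sum_j A i j * (v j)%:Z) -> mon t u = mon t v.
Hypothesis genB : forall P : B -> Prop,
  (forall c, P (io c)) -> (forall j, P (t j)) -> (forall j, P (x j)) ->
  (forall a b, P a -> P b -> P (a + b)) -> (forall a b, P a -> P b -> P (a * b)) ->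
  forall b, P b.

Definition euler_symbol (i : 'I_d) : B := \sum_j (A i j)%:~R * (x j * t j).

(** * Counting monomials on one stratum *)

Section Stratum.
Variable G : {set 'I_n}.

(** Combined with multiplication by powers of the product of the t_j over [G], this stands for the
    ring of functions on the part of the zero set of the symbols where exactly the t_j with j in [G]
    are nonzero. *)
Definition stratum_ideal (b : B) : Prop :=
  b \in ideal_span (fun g => (exists i, g = euler_symbol i) \/
                             (exists2 k, k \notin G & g = t k)).

Local Notation IG := stratum_ideal.
Local Notation tG := (\prod_(j in G) t j).

Lemma is_ideal_stratum : is_ideal IG. Proof. exact: is_ideal_span. Qed.
Local Notation iG := is_ideal_stratum.

Let IG_t k : k \notin G -> IG (t k).
Proof. by move=> kG; apply: ideal_span_mem; right; exists k. Qed.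

Variables (r : nat) (f : 'I_r -> 'I_n) (h : 'I_r -> 'I_d).
Let M : 'M[K]_(d, n) := \matrix_(i, j) if j \in G then (A i j)%:~R else 0.
Hypothesis f_inj : injective f.
Hypothesis f_red : forall a, exists l : 'I_d -> K,
  forall b, \sum_i l i * M i (f b) = (a == b)%:R.
Hypothesis h_ker : forall v : 'I_n -> K, (forall a, \sum_j M (h a) j * v j = 0) ->
  forall i, \sum_j M i j * v j = 0.

Let fG a : f a \in G.
Proof.
have [l /(_ a)] := f_red a; rewrite eqxx; case: (boolP (f a \in G)) => // aG.
by rewrite big1 => [/esym/eqP|i _]; rewrite ?oner_eq0 // mxE (negPf aG) mulr0.
Qed.

(** The combination of the symbols with coefficients [l] has coefficient 1 at [f a] and 0 at the
    other selected columns. Modulo the t_k outside [G] it can be solved for x_{f a} t_{f a}. *)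
Let reduce a : exists c : 'I_n -> K, IG (x (f a) * t (f a) -
  \sum_(k in [set k in G | k \notin codom f]) io (c k) * (x k * t k)).
Proof.
have [l lP] := f_red a; pose c k := \sum_i l i * M i k.
exists (fun k => - c k).
have -> : x (f a) * t (f a) - \sum_(k in [set k in G | k \notin codom f])
      io (- c k) * (x k * t k) =
   \sum_i io (l i) * euler_symbol i -
   \sum_(k | k \notin G) (\sum_i io (l i) * (A i k)%:~R * x k) * t k.
  transitivity (\sum_(k in G) io (c k) * (x k * t k)); last first.
    apply/eqP; rewrite eq_sym subr_eq; apply/eqP.
    under eq_bigr do rewrite mulr_sumr.
    rewrite exchange_big /= (bigID (fun k => k \in G)) /=; congr (_ + _).
      apply: eq_bigr => k kG; rewrite rmorph_sum mulr_suml.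
      by apply: eq_bigr => i _; rewrite mxE kG rmorphM rmorph_int -mulrA.
    apply: eq_bigr => k kG; rewrite mulr_suml; apply: eq_bigr => i _.
    by rewrite !mulrA.
  rewrite -sumrN.
  under eq_bigr do rewrite rmorphN mulNr opprK.
  rewrite [RHS](bigID (fun k => k \in codom f)) /=; congr (_ + _); last first.
    by apply: eq_bigl => k; rewrite inE.
  rewrite (bigD1 (f a)) ?fG ?codom_f //= big1 => [|k /andP[/andP[kG /codomP[b ->]] ab]].
    by rewrite addr0 /c lP eqxx rmorph1 mul1r.
  rewrite /c lP; case: (a =P b) ab => [->|]; first by rewrite eqxx.
  by rewrite rmorph0 mul0r.
apply: (is_idealB iG).
  apply: (is_ideal_sum iG) => i _; apply: (is_idealM iG).
  by apply: ideal_span_mem; left; exists i.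
by apply: (is_ideal_sum iG) => k kG; apply: (is_idealM iG); apply: IG_t.
Qed.

(** The levels add up under multiplication. The bound on the exponents of t is twice the level
    because reducing t_G t_j or t_G x_{f a} may produce the square of one t_k, at level 1. *)
Inductive reduced (k : nat) : B -> Prop :=
| reduced_mon u e : (forall j, (u j <= k.*2)%N) -> (forall j, j \notin G -> u j = 0%N) ->
    (forall j, (e j <= k)%N) -> (forall a, e (f a) = 0%N) -> reduced k (mon t u * mon x e)
| reducedD a b : reduced k a -> reduced k b -> reduced k (a + b)
| reducedZ c b : reduced k b -> reduced k (io c * b)
| reduced_ideal b : IG b -> reduced k b.

Let monM (y : 'I_n -> B) u v : mon y u * mon y v = mon y (fun j => (u j + v j)%N).
Proof. by rewrite -big_split; apply: eq_bigr => j _; rewrite exprD. Qed.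

Let reducedM k l a b : reduced k a -> reduced l b -> reduced (k + l) (a * b).
Proof.
elim=> {a} [u e u2 uG ek ef|a a' _ IHa _ IHa'|c a _ IHa|a aI] hb; last first.
- by apply: reduced_ideal; rewrite mulrC; apply: (is_idealM iG).
- by rewrite -mulrA; apply: reducedZ; apply: IHa.
- by rewrite mulrDl; apply: reducedD; [apply: IHa | apply: IHa'].
elim: hb => {b} [v g v2 vG gl gf|b b' _ IHb _ IHb'|c b _ IHb|b bI]; last first.
- by apply: reduced_ideal; apply: (is_idealM iG).
- by rewrite mulrCA; apply: reducedZ.
- by rewrite mulrDr; apply: reducedD.
rewrite mulrACA !monM; apply: reduced_mon => [j|j jG|j|a].
- by rewrite doubleD leq_add.
- by rewrite uG // vG.
- by rewrite leq_add.
by rewrite ef gf.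
Qed.

Let tG_mon : tG = mon t (fun j => (j \in G) : nat).
Proof. by rewrite big_mkcond; apply: eq_bigr => j _; case: ifP; rewrite ?expr0. Qed.

Let mon0 (y : 'I_n -> B) : mon y (fun=> 0%N) = 1.
Proof. by rewrite big1. Qed.

Let mon1 (y : 'I_n -> B) j : mon y (fun k => (k == j) : nat) = y j.
Proof.
by rewrite (bigD1 j) //= eqxx expr1 big1 ?mulr1 // => k /negPf ->.
Qed.

Let reduced_mont k u : (forall j, (u j <= k.*2)%N) ->
  (forall j, j \notin G -> u j = 0%N) -> reduced k (mon t u).
Proof.
move=> u2 uG; have -> : mon t u = mon t u * mon x (fun=> 0%N) by rewrite mon0 mulr1.
exact: reduced_mon.
Qed.

Let reduced_tG : reduced 1 tG.
Proof.
by rewrite tG_mon; apply: reduced_mont => j => [|/negPf -> //]; case: (j \in G).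
Qed.

Let reduced_tGX k : reduced k (tG ^+ k).
Proof.
elim: k => [|k IHk]; last by rewrite exprS -add1n; apply: reducedM.
by rewrite expr0 -(mon0 t); apply: reduced_mont.
Qed.

Let reduced_sum k (I : Type) (s : seq I) (P : pred I) (F : I -> B) :
  (forall i, P i -> reduced k (F i)) -> reduced k (\sum_(i <- s | P i) F i).
Proof.
move=> kF; apply: (big_ind (reduced k)) => //; last exact: reducedD.
by apply: reduced_ideal; apply: is_ideal0 iG.
Qed.

Let reduced_tGt j : reduced 1 (tG * t j).
Proof.
have [jG|jG] := boolP (j \in G); last first.
  by apply/reduced_ideal/(is_idealM iG)/IG_t.
rewrite tG_mon -(mon1 t j) monM.
apply: reduced_mont => k; first by case: (k \in G); case: (k == j).
by move=> /[dup] kG /negPf ->; case: eqVneq kG => // ->; rewrite jG.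
Qed.

(** For an eliminated variable x_{f a}, the factor t_{f a} is borrowed from the product over [G] and
    x_{f a} t_{f a} is replaced by means of [reduce]. *)
Let reduced_tGx j : reduced 1 (tG * x j).
Proof.
have [/codomP [a ->]|jf] := boolP (j \in codom f); last first.
  rewrite -(mon1 x j) tG_mon; apply: reduced_mon => [k|k /negPf -> //|k|a].
  - by case: (k \in G).
  - by case: (k == j).
  by case: eqP jf => // <-; rewrite codom_f.
have [c cP] := reduce a; set s := \sum_(k in _) _ in cP.
pose tF := \prod_(k in G :\ f a) t k.
have tGF : tG = t (f a) * tF by rewrite (big_setD1 (f a)).
have -> : tG * x (f a) = tF * (x (f a) * t (f a) - s) + tF * s.
  by rewrite -mulrDr subrK tGF; ring.
apply: reducedD; first by apply: reduced_ideal; apply: (is_idealM iG).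
rewrite mulr_sumr; apply: reduced_sum => k; rewrite inE => /andP[kG kf].
rewrite mulrCA; apply: reducedZ; rewrite mulrC mulrAC -mulrA mulrC.
rewrite -(mon1 x k) -(mon1 t k).
have -> : tF = mon t (fun j => (j \in G :\ f a) : nat).
  by rewrite /tF big_mkcond; apply: eq_bigr => i _; case: ifP; rewrite ?expr0.
rewrite monM; apply: reduced_mon => [i|i iG|i|b].
- by case: (i \in _); case: (i == k).
- rewrite !inE (negPf iG) andbF; have [ik|//] := eqVneq i k.
  by rewrite ik kG in iG.
- by case: (i == k).
by case: eqP kf => // <-; rewrite codom_f.
Qed.

Let reduced_ex b : exists k, reduced k (tG ^+ k * b).
Proof.
elim/genB: b => [c|j|j|a b [k ka] [l lb]|a b [k ka] [l lb]].
- by exists 0%N; rewrite mulrC; apply: reducedZ; apply: reduced_tGX.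
- by exists 1%N; apply: reduced_tGt.
- by exists 1%N; apply: reduced_tGx.
- exists (k + l)%N; rewrite mulrDr; apply: reducedD.
    by rewrite addnC exprD -mulrA addnC [(k + l)%N]addnC; apply: reducedM.
  by rewrite exprD -mulrA; apply: reducedM.
by exists (k + l)%N; rewrite exprD mulrACA; apply: reducedM.
Qed.

Section Coefficients.
Variable k : nat.

Let CA := entry_sum A.
Let off := (k.*2 * CA)%N.
Let H := (off.*2 + k)%N.

Let valid (u e : 'I_n -> nat) :=
  [/\ forall j, (u j <= k.*2)%N, forall j, j \notin G -> u j = 0%N,
      forall j, (e j <= k)%N & forall a, e (f a) = 0%N].

(** The n entries of a code: at the position [f a], which carries no exponent of x, stands the
    coordinate [h a] of the degree of the t-monomial, moved by [off] into the natural numbers; every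
    other position holds the exponent of x there. [H] bounds both kinds of entries. *)
Let code (u e : 'I_n -> nat) : {ffun 'I_n -> 'I_H.+1} :=
  [ffun j => inord (if [pick a | f a == j] is Some a
                    then absz (\sum_l A (h a) l * (u l)%:Z + off%:Z) else e j)].

Let absz_sum i u : (forall j, (u j <= k.*2)%N) ->
  (`|\sum_l A i l * (u l)%:Z| <= off%:Z)%R.
Proof.
move=> u2; apply: le_trans (ler_norm_sum _ _ _) _.
apply: (@le_trans _ _ (\sum_l ((k.*2)%:Z * `|A i l|%:Z))).
  apply: ler_sum => l _; rewrite normrM -abszE mulrC ler_wpM2r //.
  by rewrite ger0_norm // lez_nat.
rewrite -mulr_sumr /off PoszM ler_wpM2l // /CA /entry_sum.
rewrite (bigD1 i) //= PoszD -[\sum_l _]addr0 lerD //.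
by rewrite (big_morph Posz PoszD (erefl _)).
Qed.

(** Equal codes give equal degrees in the rows [h], hence in all rows by [h_ker], and t-monomials of
    equal degree coincide by [tA]. *)
Let code_inj u e v g : valid u e -> valid v g -> code u e = code v g ->
  mon t u * mon x e = mon t v * mon x g.
Proof.
move=> [u2 uG ek ef] [v2 vG gk gf] cE.
have E j : (if [pick a | f a == j] is Some a
            then absz (\sum_l A (h a) l * (u l)%:Z + off%:Z)%R else e j) =
           (if [pick a | f a == j] is Some a
            then absz (\sum_l A (h a) l * (v l)%:Z + off%:Z)%R else g j).
  have := congr1 (fun c : {ffun 'I_n -> 'I_H.+1} => val (c j)) cE.
  rewrite !ffunE; case: pickP => [a _|_] /=; rewrite !inordK // ltnS /H.
  - by rewrite (leq_trans (absz_shift (absz_sum (h a) v2))) // leq_addr.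
  - by rewrite (leq_trans (absz_shift (absz_sum (h a) u2))) // leq_addr.
  - by rewrite (leq_trans (gk j)) // leq_addl.
  - by rewrite (leq_trans (ek j)) // leq_addl.
congr (_ * _); last first.
  apply: eq_bigr => j _; congr (_ ^+ _); have := E j.
  by case: pickP => [a /eqP <-|//]; rewrite ef gf.
have Ef a : \sum_l A (h a) l * (u l)%:Z = \sum_l A (h a) l * (v l)%:Z.
  have := E (f a); case: pickP => [b /eqP/f_inj ->|/(_ a)]; last by rewrite eqxx.
  exact: absz_shift_inj (absz_sum (h a) u2) (absz_sum (h a) v2).
apply: tA => i; apply: (@intr_inj K); apply/eqP; rewrite -subr_eq0; apply/eqP.
have ME (b : 'I_d) : \sum_l M b l * ((u l)%:R - (v l)%:R) =
    (\sum_l A b l * (u l)%:Z)%:~R - (\sum_l A b l * (v l)%:Z)%:~R.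
  rewrite !rmorph_sum -sumrB; apply: eq_bigr => l _; rewrite mxE !rmorphM /=.
  case: ifP => lG; first by rewrite mulrBr -!pmulrn.
  by rewrite uG ?lG // vG ?lG // mul0r subrr.
by rewrite -ME; apply: h_ker => a; rewrite ME Ef subrr.
Qed.

Let decode_ex (w : {ffun 'I_n -> 'I_H.+1}) : exists b, forall u e, valid u e ->
  code u e = w -> mon t u * mon x e = b.
Proof.
have [[u [e [ue <-]]]|no] := pselect (exists u e, valid u e /\ code u e = w).
  by exists (mon t u * mon x e) => v g vg vw; apply: code_inj.
by exists 0 => u e ue uw; case: no; exists u, e.
Qed.

(** Valid monomials with the same code are equal, so modulo the stratum ideal the elements of level
    k are spanned by as many elements as there are codes. For fixed [A] this number is a polynomial
    of degree n in k. *)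
Lemma reduced_coef : exists dec : {ffun 'I_n -> 'I_(4 * CA * k + k).+1} -> B,
  forall b, reduced k b -> exists c, IG (b - \sum_w io (c w) * dec w).
Proof.
have -> : (4 * CA * k + k = H)%N by rewrite /H /off; lia.
have [dec decP] := boolp.choice decode_ex.
exists dec => b; elim=> {b} [u e u2 uG ek ef|a b _ [c cP] _ [c' cP']|a b _ [c cP]|b bI].
- exists (fun w => (w == code u e)%:R); rewrite (bigD1 (code u e)) //= eqxx rmorph1 mul1r.
  rewrite [\sum_(w | _) _]big1 => [|w /negPf ->]; last by rewrite rmorph0 mul0r.
  by rewrite addr0 (decP (code u e) u e) // subrr; apply: (is_ideal0 iG).
- exists (fun w => c w + c' w).
  under eq_bigr do rewrite rmorphD mulrDl.
  by rewrite big_split /= opprD addrACA; apply: (is_idealD iG).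
- exists (fun w => a * c w).
  under eq_bigr do rewrite rmorphM -mulrA.
  by rewrite -mulr_sumr -mulrBr; apply: (is_idealM iG).
exists (fun=> 0); rewrite big1 ?subr0 // => w _.
by rewrite rmorph0 mul0r.
Qed.

End Coefficients.

Let reduced_exp k l b : reduced k b -> reduced (k * l) (b ^+ l).
Proof.
move=> kb; elim: l => [|l IHl]; last by rewrite exprS mulnS; apply: reducedM.
by rewrite muln0 -[b ^+ 0](expr0 tG); apply: reduced_tGX.
Qed.

Let reduced_prod (I : Type) (s : seq I) (k : I -> nat) (F : I -> B) :
  (forall i, reduced (k i) (F i)) -> reduced (\sum_(i <- s) k i) (\prod_(i <- s) F i).
Proof.
move=> kF; elim: s => [|i s IHs]; last by rewrite !big_cons; apply: reducedM.
by rewrite !big_nil -(expr0 tG); apply: reduced_tGX.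
Qed.

(** The q^m monomials in [z] with exponents below q, multiplied by one power of t_G, have a level
    proportional to q, and hence lie in a space of dimension at most a constant times q^n. As m > n,
    they are dependent for large q. *)
Lemma stratum_relation_aux m (z : 'I_m -> B) : (n < m)%N ->
  exists2 P : {mpoly K[m]}, P != 0 & exists N, IG (tG ^+ N * mmap io z P).
Proof.
move=> nm.
have [k0 [k0_gt0 k0P]] : exists k0, (0 < k0)%N /\ forall i, reduced k0 (tG ^+ k0 * z i).
  have [k kP] := boolp.choice (fun i => reduced_ex (z i)).
  exists (\sum_i k i).+1; split=> // i; rewrite (bigD1 i) //= -addnS exprD.
  rewrite mulrAC; apply: reducedM; first exact: kP.
  exact: reduced_tGX.
pose CA := entry_sum A.
(* Since X q = (4 CA + 2) S, the number of codes at level S is at most (X q)^n; and q > X^n gives (X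
   q)^n < q^(n+1) <= q^m. *)
pose X := ((4 * CA + 2) * (k0 * m))%N.
pose q := (X ^ n).+1; pose S := (k0 * (m * q))%N.
have [dec decP] := reduced_coef S.
pose E (v : {ffun 'I_m -> 'I_q}) := tG ^+ S * \prod_i z i ^+ v i.
have Ered v : reduced S (E v).
  have vS : (\sum_i v i <= m * q)%N.
    rewrite -[m in (m * q)%N]card_ord -sum_nat_const; apply: leq_sum => i _.
    exact: ltnW.
  (* Each factor z_i consumes k0 powers of t_G, and the powers left over bring all the monomials to
     the common level S. *)
  have -> : E v = tG ^+ (k0 * (m * q - \sum_i v i)) * \prod_i (tG ^+ k0 * z i) ^+ v i.
    rewrite /E; under [X in _ = _ * X]eq_bigr do rewrite exprMn -exprM.
    by rewrite big_split /= prodrXr mulrA -exprD -big_distrr /= -mulnDr subnK.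
  have -> : S = (k0 * (m * q - \sum_i v i) + \sum_i k0 * v i)%N.
    by rewrite -big_distrr -mulnDr subnK.
  by apply: reducedM => //; apply: reduced_prod => i; apply: reduced_exp.
have [c cP] := boolp.choice (fun v => decP _ (Ered v)).
pose W := {ffun 'I_n -> 'I_(4 * CA * S + S).+1}.
have cardlt : (#|{: W}| < #|{: {ffun 'I_m -> 'I_q}}|)%N.
  rewrite !card_ffun !card_ord.
  have m0 : (0 < m)%N by exact: leq_ltn_trans nm.
  apply: (@leq_ltn_trans ((X * q) ^ n)).
    have [->//|n0] := posnP n; rewrite leq_exp2r // /X /S.
    have : (0 < k0 * (m * q))%N by rewrite !muln_gt0 k0_gt0 m0.
    by rewrite -(mulnA _ (k0 * m)%N q) -(mulnA k0 m q); move: (k0 * (m * q))%N => s; nia.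
  rewrite expnMn; apply: (@leq_trans (q * q ^ n)); last first.
    by rewrite -expnS leq_pexp2l.
  by rewrite ltn_pmul2r ?expn_gt0 //.
pose Cm : 'M[K]_(#|{: {ffun 'I_m -> 'I_q}}|, #|{: W}|) :=
  \matrix_(i, j) c (enum_val i) (enum_val j).
(* There are more rows than columns; a linear relation between the rows provides the coefficients of
   [P]. *)
have : kermx Cm != 0.
  rewrite -mxrank_eq0 mxrank_ker -lt0n subn_gt0.
  exact: leq_ltn_trans (rank_leq_col _) cardlt.
case/rowV0Pn => y /sub_kermxP yC y0.
pose mv (v : {ffun 'I_m -> 'I_q}) := [multinom (v i : nat) | i < m].
have mv_inj : injective mv.
  move=> v w /(congr1 (fun u : 'X_{1..m} => (u : _ -> _))) vw; apply/ffunP => i.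
  by apply/val_inj; have := congr1 (fun u => u i) vw; rewrite !mnmE.
pose y' v := y 0 (enum_rank v).
pose P : {mpoly K[m]} := \sum_v y' v *: 'X_[mv v].
exists P.
  case/rV0Pn: y0 => i yi; apply: contraNneq yi => /(congr1 (mcoeff (mv (enum_val i)))).
  rewrite mcoeff0 raddf_sum (bigD1 (enum_val i)) //= mcoeffZ mcoeffX eqxx mulr1.
  rewrite big1 => [|v vi]; first by rewrite addr0 /y' enum_valK => ->.
  by rewrite mcoeffZ mcoeffX (inj_eq mv_inj) (negPf vi) mulr0.
exists S.
have -> : tG ^+ S * mmap io z P = \sum_v io (y' v) * E v.
  rewrite raddf_sum mulr_sumr; apply: eq_bigr => v _.
  rewrite /= mmapZ mmapX mulrCA /mmap1 /E; congr (_ * (_ * _)).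
  by apply: eq_bigr => i _; rewrite mnmE.
have -> : \sum_v io (y' v) * E v =
    \sum_v io (y' v) * (E v - \sum_w io (c v w) * dec w).
  apply/eqP; rewrite -subr_eq0 -sumrB.
  under eq_bigr do rewrite -mulrBr opprB addrC subrK mulr_sumr.
  apply/eqP; rewrite [LHS]exchange_big [LHS]big1 //= => w _.
  under eq_bigr do rewrite mulrA -rmorphM.
  rewrite -mulr_suml -rmorph_sum /=.
  rewrite (_ : \sum_v _ = 0) ?rmorph0 ?mul0r //.
  have := congr1 (fun Z : 'rV_#|{: W}| => Z 0 (enum_rank w)) yC; rewrite !mxE => E0.
  rewrite -[RHS]E0.
  rewrite [RHS](reindex (@enum_rank {ffun 'I_m -> 'I_q})) /=; last first.
    exact/onW_bij/enum_rank_bij.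
  by apply: eq_bigr => v _; rewrite mxE !enum_rankK.
apply: (is_ideal_sum iG) => v _; apply: (is_idealM iG); exact: cP.
Qed.

End Stratum.

(** * From the strata to the radical *)

Lemma stratum_relation (G : {set 'I_n}) m (z : 'I_m -> B) : (n < m)%N ->
  exists2 P : {mpoly K[m]}, P != 0 &
    exists N, stratum_ideal G ((\prod_(j in G) t j) ^+ N * mmap io z P).
Proof.
move=> nm; pose M := \matrix_(i, j) if j \in G then (A i j)%:~R : K else 0.
have [r [f [h [f_inj f_red h_ker]]]] := rank_submatrix M.
exact: (stratum_relation_aux f_inj f_red h_ker).
Qed.

(** The strata cover everything: for each index either t_j is zero or it may be inverted. The two
    cases are merged for one index after the other. *)
Lemma strata_rad b :
  (forall G : {set 'I_n}, exists N, stratum_ideal G ((\prod_(j in G) t j) ^+ N * b)) ->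
  in_rad (fun b => b \in ideal_span (fun g => exists i, g = euler_symbol i)) b.
Proof.
move=> hb.
(* Only the indices below [k] have been assigned to [G] or to its complement: [k] = n gives the
   strata, [k] = 0 the ideal of the symbols alone. *)
pose I k (G : {set 'I_n}) c := c \in ideal_span (fun g => (exists i, g = euler_symbol i) \/
   (exists j : 'I_n, [/\ (j < k)%N, j \notin G & g = t j])).
have iI k G : is_ideal (I k G) by exact: is_ideal_span.
suff main k : (k <= n)%N -> forall G : {set 'I_n}, (forall j, j \in G -> (j < n - k)%N) ->
    exists N, I (n - k)%N G ((\prod_(j in G) t j) ^+ N * b ^+ N).
  have [|N] := main n (leqnn n) set0; first by move=> j; rewrite inE.
  rewrite subnn big_set0 expr1n mul1r => bN; exists N.
  apply: ideal_span_mono bN.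
  by move=> g [ge|[j []//]]; apply: ideal_span_mem.
elim: k => [|k IHk] kn G Gk.
  have [N bN] := hb G; exists N.+1; rewrite subn0 exprS [b ^+ _]exprSr mulrACA.
  apply: (is_idealM (iI _ _)); apply: ideal_span_mono bN.
  move=> g [[i ge]|[j jG ge]]; apply: ideal_span_mem; first by left; exists i.
  by right; exists j; split.
set m := (n - k.+1)%N in Gk *.
have nk : (n - k)%N = m.+1 by rewrite /m subnSK.
have mn : (m < n)%N by rewrite /m ltn_subrL (leq_ltn_trans _ kn).
pose o := Ordinal mn; rewrite {}nk in IHk; have {}IHk := IHk (ltnW kn).
have oG : o \notin G by apply/negP => /Gk; rewrite ltnn.
have [|N bN] := IHk (o |: G).
  by move=> j; rewrite in_setU1 => /orP[/eqP ->//|/Gk /ltnW].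
have [|N' bN'] := IHk G; first by move=> j /Gk /ltnW.
rewrite (big_setU1 _ oG) /= in bN.
set tG := \prod_(j in G) t j in bN bN' *.
have {}bN : I m G ((t o * tG) ^+ N * b ^+ N).
  apply: ideal_span_mono bN.
  move=> g [[i ge]|[j [jm jG ge]]]; apply: ideal_span_mem; first by left; exists i.
  move: jG; rewrite in_setU1 negb_or => /andP[jo jG].
  right; exists j; split=> //; rewrite ltn_neqAle -ltnS jm andbT.
  by apply: contraNneq jo => jo; apply/eqP/val_inj.
have [r rP] : exists r, I m G (tG ^+ N' * b ^+ N' - t o * r).
  move: (tG ^+ N' * _) bN' => y; elim/ideal_span_ind => {y}.
  - by exists 0; rewrite mulr0 subrr; apply: (is_ideal0 (iI _ _)).
  - move=> y z [r ry] [s sz]; exists (r + s); rewrite mulrDr opprD addrACA.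
    exact: (is_idealD (iI _ _)).
  move=> c g [[i ge]|[j [jm jG ge]]].
    exists 0; rewrite mulr0 subr0; apply: (is_idealM (iI _ _)); apply: ideal_span_mem.
    by left; exists i.
  move: jm; rewrite ltnS leq_eqVlt => /orP[/eqP jo|jm].
    exists c; rewrite ge (_ : j = o) ?[c * _]mulrC ?subrr; last exact: val_inj.
    exact: (is_ideal0 (iI _ _)).
  exists 0; rewrite mulr0 subr0; apply: (is_idealM (iI _ _)); apply: ideal_span_mem.
  by right; exists j; split.
(* Modulo the ideal, (t_o t_G)^N b^N = 0 and t_G^N' b^N' = t_o r. The N-th power of the second
   equation is multiplied by t_G^N b^N, so that the first one applies. *)
exists (N' * N + N)%N.
have -> : tG ^+ (N' * N + N) * b ^+ (N' * N + N) =
    tG ^+ N * b ^+ N * ((tG ^+ N' * b ^+ N') ^+ N - (t o * r) ^+ N) +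
    r ^+ N * ((t o * tG) ^+ N * b ^+ N).
  by rewrite !exprD !exprM !exprMn; ring.
apply: (is_idealD (iI _ _)); apply: (is_idealM (iI _ _)) => //.
by rewrite subrXX mulrC; apply: (is_idealM (iI _ _)).
Qed.

(** The product of the relations found on the finitely many strata holds on each of them. *)
Lemma euler_symbol_relation m (z : 'I_m -> B) : (n < m)%N ->
  exists2 P : {mpoly K[m]}, P != 0 &
    in_rad (fun b => b \in ideal_span (fun g => exists i, g = euler_symbol i))
      (mmap io z P).
Proof.
move=> nm.
have /boolp.choice [P PP] (G : {set 'I_n}) : exists P : {mpoly K[m]}, P != 0 /\
    exists N, stratum_ideal G ((\prod_(j in G) t j) ^+ N * mmap io z P).
  by have [P P0 PN] := stratum_relation G z nm; exists P.
exists (\prod_G P G).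
  by apply/prodf_neq0 => G _; have [] := PP G.
apply: strata_rad => G; have [_ [N PN]] := PP G; exists N.
rewrite (bigD1 G) //= rmorphM mulrA mulrC.
exact: (is_idealM (is_ideal_stratum G)).
Qed.

End Relations.

(** * Noether normalization *)

Lemma digits_inj (w m : nat) (u v : 'I_m -> nat) :
  (forall i, (u i < w)%N) -> (forall i, (v i < w)%N) ->
  (\sum_i u i * w ^ i = \sum_i v i * w ^ i)%N -> forall i, u i = v i.
Proof.
elim: m u v => [|m IHm] u v uw vw; first by move=> _ [].
rewrite !big_ord_recl !expn0 !muln1 => E.
have S (y : 'I_m.+1 -> nat) : (\sum_(i < m) y (fintype.lift ord0 i) * w ^ bump 0 i =
    (\sum_(i < m) y (fintype.lift ord0 i) * w ^ i) * w)%N.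
  by rewrite big_distrl; apply: eq_bigr => i _; rewrite /= /bump leq0n add1n expnSr mulnA.
rewrite /= !S in E.
have E0 : u ord0 = v ord0.
  by move: (congr1 (modn^~ w) E); rewrite ![(_ + _ * w)%N]addnC !modnMDl !modn_small.
move: E; rewrite E0 => /addnI/eqP; rewrite eqn_pmul2r ?(leq_ltn_trans _ (uw ord0)) //.
move=> /eqP E i; case: (unliftP ord0 i) => [j ->|-> //].
exact: (IHm _ _ (fun i => uw _) (fun i => vw _) E j).
Qed.

Lemma poly_nonroot (K : numFieldType) (p : {poly K}) : p != 0 -> exists y, p.[y] != 0.
Proof.
move=> p0; apply: contrapT => no.
have h y : p.[y] == 0 by apply/negPn/negP => py; apply: no; exists y.
pose s : seq K := [seq i%:R | i <- iota 0 (size p)].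
suff: (size s < size p)%N by rewrite size_map size_iota ltnn.
apply: max_poly_roots => //; first by apply/allP => y _; exact: h.
by rewrite map_inj_uniq ?iota_uniq // => i j /eqP; rewrite eqr_nat => /eqP.
Qed.

(* Kronecker substitution [X_i := y ^ (w ^ i)]. *)
Lemma mpoly_nonzero_point (K : numFieldType) m (P : {mpoly K[m]}) : P != 0 ->
  exists2 mu : 'I_m -> K, P.@[mu] != 0 & forall i, mu i != 0.
Proof.
move=> P0; pose w := msize P.
pose wt (u : 'X_{1..m}) := (\sum_i u i * w ^ i)%N.
pose q : {poly K} := \sum_(u <- msupp P) P@_u *: 'X^(wt u).
have small u i : u \in msupp P -> (u i < w)%N.
  move=> us; apply: leq_ltn_trans (msize_mdeg_lt us).
  by rewrite mdegE (bigD1 i) //= leq_addr.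
have q0 : q != 0.
  apply: contraNneq P0 => qe; apply/eqP/mpolyP => u; rewrite mcoeff0.
  have [us|/memN_msupp_eq0 //] := boolP (u \in msupp P).
  have := congr1 (fun p : {poly K} => p`_(wt u)) qe; rewrite coef0 coef_sum => <-.
  rewrite (bigD1_seq u) ?msupp_uniq //= coefZ coefXn eqxx mulr1.
  rewrite big_seq_cond big1 ?addr0 // => v /andP[vs vu].
  rewrite coefZ coefXn; case: eqP => [E|]; last by rewrite mulr0.
  case/eqP: vu; apply/mnmP => i.
  exact: (digits_inj (fun i => small v i vs) (fun i => small u i us) (esym E)).
(* The additional factor 'X excludes the point y = 0, so that every coordinate of [mu] is nonzero
   and may serve as a denominator. *)
have [|y] := @poly_nonroot K (q * 'X); first by rewrite mulf_neq0 // polyX_eq0.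
rewrite hornerM hornerX mulf_eq0 negb_or => /andP[qy y0].
exists (fun i => y ^+ (w ^ i)); last by move=> i; rewrite expf_neq0.
rewrite mevalE; move: qy; rewrite /q horner_sum.
congr (_ != _); apply: eq_bigr => u _; rewrite hornerZ hornerXn; congr (_ * _).
by rewrite /wt -prodrXr; apply: eq_bigr => i _; rewrite mulnC exprM.
Qed.

Lemma coefM_top (B : comNzRingType) (p q : {poly B}) a b :
  (size p <= a.+1)%N -> (size q <= b.+1)%N -> (p * q)`_(a + b) = p`_a * q`_b.
Proof.
move=> pa qb; rewrite coefM (bigD1 (inord a)) //= inordK ?ltnS ?leq_addr // addKn.
rewrite big1 ?addr0 // => i ia; have [ai|ia'|ai] := ltngtP i a.
- by rewrite [q`__]nth_default ?mulr0 // (leq_trans qb) //; lia.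
- by rewrite [p`__]nth_default ?mul0r // (leq_trans pa).
by case/eqP: ia; apply/val_inj; rewrite /= inordK // ltnS -ai leq_addr.
Qed.

Lemma coefX_top (B : comNzRingType) (p : {poly B}) a N :
  (size p <= a.+1)%N -> (p ^+ N)`_(a * N) = p`_a ^+ N /\ (size (p ^+ N) <= (a * N).+1)%N.
Proof.
move=> pa; elim: N => [|N [IHN sN]].
  by rewrite muln0 !expr0 coefC eqxx size_poly1.
rewrite !exprS mulnS; split; first by rewrite coefM_top // IHN.
apply: leq_trans (size_polyMleq _ _) _; lia.
Qed.

Lemma mmap_congr (K B : comNzRingType) (io : {rmorphism K -> B}) m (J : B -> Prop)
    (c c' : 'I_m -> B) (P : {mpoly K[m]}) :
  is_ideal J -> (forall i, J (c i - c' i)) -> J (mmap io c P - mmap io c' P).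
Proof.
move=> iJ cc'; elim/mpolyind: P => [|a u P _ _ IHP].
  by rewrite !mmap0 subrr; apply: (is_ideal0 iJ).
rewrite !mmapD opprD addrACA; apply: (is_idealD iJ) => //.
rewrite !mmapZ !mmapX -mulrBr; apply: (is_idealM iJ).
have congM y z y' z' : J (y - y') -> J (z - z') -> J (y * z - y' * z').
  move=> hy hz; have -> : y * z - y' * z' = y * (z - z') + z' * (y - y') by ring.
  by apply: (is_idealD iJ); apply: (is_idealM iJ).
rewrite /mmap1; elim/big_ind2: _ => [|y y' z z' hy hz|i _]; last 1 first.
- elim: (u i) => [|k IHk]; first by rewrite !expr0 subrr; apply: (is_ideal0 iJ).
  by rewrite !exprS; apply: congM.
- by rewrite subrr; apply: (is_ideal0 iJ).
exact: congM.
Qed.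

Section Hsop.
Variables (K : numFieldType) (B : comNzRingType) (io : {rmorphism K -> B}).
Variables (d n : nat) (A : 'M[int]_(d, n)) (t x : 'I_n -> B).

Local Notation mon y u := (\prod_j y j ^+ u j).

Hypothesis tA : forall u v : 'I_n -> nat,
  (forall i, \sum_j A i j * (u j)%:Z = \sum_j A i j * (v j)%:Z) -> mon t u = mon t v.
Hypothesis genB : forall P : B -> Prop,
  (forall c, P (io c)) -> (forall j, P (t j)) -> (forall j, P (x j)) ->
  (forall a b, P a -> P b -> P (a + b)) -> (forall a b, P a -> P b -> P (a * b)) ->
  forall b, P b.

Local Notation e := (euler_symbol A t x).

Variables (alpha : {rmorphism B -> {poly B}}).

Definition homogeneous (k : nat) (b : B) := alpha b = b *: 'X^k.

Variables (ce : nat) (wtt wtx : 'I_n -> nat).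
Hypothesis alpha_io : forall c, alpha (io c) = (io c)%:P.
Hypothesis alpha_e : forall i, homogeneous ce (e i).
Hypothesis alpha_t : forall j, homogeneous (wtt j) (t j).
Hypothesis alpha_x : forall j, homogeneous (wtx j) (x j).
Hypothesis wtx_gt0 : forall j, (0 < wtx j)%N.

Definition euler_ideal m (c : 'I_m -> B) (b : B) : Prop :=
  b \in ideal_span (fun g => (exists i, g = e i) \/ (exists i, g = c i)).

Lemma is_ideal_euler m (c : 'I_m -> B) : is_ideal (euler_ideal c).
Proof. exact: is_ideal_span. Qed.

Lemma homogeneousX k b l : homogeneous k b -> homogeneous (k * l) (b ^+ l).
Proof. by rewrite /homogeneous => bk; rewrite rmorphXn bk exprZn exprM. Qed.

Lemma homogeneousB k a b : homogeneous k a -> homogeneous k b -> homogeneous k (a - b).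
Proof. by rewrite /homogeneous => ak bk; rewrite rmorphB ak bk scalerBl. Qed.

Lemma homogeneousZ k c b : homogeneous k b -> homogeneous k (io c * b).
Proof.
by rewrite /homogeneous => bk; rewrite rmorphM alpha_io bk mul_polyC scalerA.
Qed.

Lemma euler_ideal_graded D m (c : 'I_m -> B) b : (forall i, homogeneous D (c i)) ->
  euler_ideal c b -> forall k, euler_ideal c (alpha b)`_k.
Proof.
move=> cD; elim/ideal_span_ind => {b} [|a b IHa IHb|a g ge] k.
- by rewrite rmorph0 coef0; apply: is_ideal0 (is_ideal_euler c).
- by rewrite rmorphD coefD; apply: (is_idealD (is_ideal_euler c)).
have [D' gD] : exists D', homogeneous D' g.
  by case: ge => [[i ->]|[i ->]]; [exists ce | exists D].
rewrite rmorphM gD -scalerAr coefZ mulrC; apply: (is_idealM (is_ideal_euler c)).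
exact: ideal_span_mem.
Qed.

(* Noether normalization step: after the substitution [c_i := c'_i + l_i c_m],
   the relation of [euler_symbol_relation] becomes a monic equation for [c_m]. *)
Lemma hsop_step D m (c : 'I_m.+1 -> B) : (n <= m)%N -> (0 < D)%N ->
  (forall i, homogeneous D (c i)) ->
  exists2 c' : 'I_m -> B, forall i, homogeneous D (c' i) &
    forall i, in_rad (euler_ideal c') (c i).
Proof.
move=> nm D0 cD; have [P P0 [N PN]] := euler_symbol_relation tA genB c (leq_ltn_trans nm (ltnSn m)).
have [mu muP mu0] := mpoly_nonzero_point P0.
(* The line through 0 and [mu], parametrized by its last coordinate. On it [P] restricts to the
   one-variable polynomial [q], which is nonzero because its value at [mu ord_max] is that of [P] at
   [mu]. *)
pose l i := mu i / mu ord_max; pose cm := c ord_max.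
pose c' i := c (fintype.lift ord_max i) - io (l (fintype.lift ord_max i)) * cm.
exists c' => [i|]; first by apply: homogeneousB => //; apply: homogeneousZ; apply: cD.
have iJ := is_ideal_euler c'.
have cJ i : euler_ideal c' (c i - io (l i) * cm).
  case: (unliftP ord_max i) => [j ->|->].
    by apply: ideal_span_mem; right; exists j.
  by rewrite /l divff // rmorph1 mul1r subrr; apply: (is_ideal0 iJ).
suff cmJ : in_rad (euler_ideal c') cm.
  move=> i; rewrite -[c i](subrK (io (l i) * cm)).
  apply: (is_idealD (is_ideal_rad iJ)); last exact: (is_idealM (is_ideal_rad iJ)).
  exact/in_rad_sub.
pose q : {poly K} := mmap polyC (fun i => l i *: 'X) P.
have qE : (map_poly io q).[cm] = mmap io (fun i => io (l i) * cm) P.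
  rewrite /q; elim/mpolyind: (P) => [|a u p _ _ IHp].
    by rewrite !mmap0 rmorph0 horner0.
  rewrite !mmapD rmorphD hornerD IHp; congr (_ + _).
  rewrite !mmapZ !mmapX rmorphM hornerM /= map_polyC hornerC; congr (_ * _).
  rewrite rmorph_prod horner_prod; apply: eq_bigr => i _.
  by rewrite rmorphXn horner_exp /= map_polyZ map_polyX hornerZ hornerX.
have q0 : q != 0.
  apply: contraNneq muP => q0; have : q.[mu ord_max] = 0 by rewrite q0 horner0.
  move=> <-; apply/eqP; rewrite /q /meval; elim/mpolyind: (P) => [|a u p _ _ IHp].
    by rewrite !mmap0 horner0.
  rewrite !mmapD hornerD -IHp; congr (_ + _).
  rewrite !mmapZ !mmapX hornerM hornerC; congr (_ * _).
  rewrite horner_prod; apply: eq_bigr => i _.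
  by rewrite horner_exp hornerZ hornerX /l divfK.
pose k := (size q).-1.
have qJ : euler_ideal c' ((map_poly io q).[cm] ^+ N).
  have PJ : euler_ideal c' (mmap io c P ^+ N).
    by apply: ideal_span_mono PN => g ge; apply: ideal_span_mem; left.
  rewrite -[X in euler_ideal _ X](subrK (mmap io c P ^+ N)); apply: (is_idealD iJ) => //.
  rewrite subrXX mulrC; apply: (is_idealM iJ); rewrite qE -opprB -mulN1r.
  by apply: (is_idealM iJ); apply: mmap_congr.
have cDm : homogeneous D cm by exact: cD.
(* Since [cm] is homogeneous of degree D, the component of top degree D k of q(cm) is the leading
   coefficient of [q] times cm^k. The ideal is graded, so it contains the top component of q(cm)^N,
   and with it a power of [cm]. *)
pose Q : {poly B} := \sum_(i < k.+1) (io q`_i * cm ^+ i) *: 'X^(D * i).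
have alphaQ : alpha (map_poly io q).[cm] = Q.
  have sq : size (map_poly io q) = k.+1.
    by rewrite size_map_poly_id0 ?fmorph_eq0 ?lead_coef_eq0 // /k prednK // size_poly_gt0.
  rewrite horner_coef sq rmorph_sum; apply: eq_bigr => i _.
  rewrite coef_map rmorphM alpha_io (homogeneousX i cDm) /=.
  by rewrite mul_polyC scalerA.
have sQ : (size Q <= (D * k).+1)%N.
  apply: (leq_trans (size_sum _ _ _)); apply/bigmax_leqP => i _.
  apply: leq_trans (size_scale_leq _ _) _.
  by rewrite size_polyXn ltnS leq_mul2l -ltnS ltn_ord orbT.
have Qk : Q`_(D * k) = io q`_k * cm ^+ k.
  rewrite coef_sum (bigD1 ord_max) //= coefZ coefXn eqxx mulr1 big1 ?addr0 // => i ik.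
  rewrite coefZ coefXn eqn_pmul2l //; case: eqP => [ki|_]; last by rewrite mulr0.
  by case/eqP: ik; apply/val_inj.
have := euler_ideal_graded (D := D) (c := c') _ qJ (D * k * N).
rewrite rmorphXn alphaQ (coefX_top N sQ).1 Qk exprMn -exprM => cN; exists (k * N)%N.
have -> : cm ^+ (k * N) = io (q`_k ^- N) * (io q`_k ^+ N * cm ^+ (k * N)).
  rewrite mulrA -rmorphXn -rmorphM mulVf ?rmorph1 ?mul1r //.
  by rewrite expf_neq0 // -[q`_k]/(lead_coef q) lead_coef_eq0.
apply: (is_idealM iJ); apply: cN => i.
by apply: homogeneousB => //; apply: homogeneousZ; apply: cD.
Qed.

Lemma hsop_reduce D k (c : 'I_(k + n) -> B) : (0 < D)%N ->
  (forall i, homogeneous D (c i)) ->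
  exists2 g : 'I_n -> B, forall i, homogeneous D (g i) &
    forall i, in_rad (euler_ideal g) (c i).
Proof.
move=> D0; elim: k c => [|k IHk] c cD.
  by exists c => // i; apply/in_rad_sub/ideal_span_mem; right; exists i.
have [c' c'D cc'] := hsop_step (c := c) (leq_addl k n) D0 cD.
have [g gD c'g] := IHk c' c'D; exists g => // i.
have iJ := is_ideal_euler g.
have [N cN] := cc' i; apply: (in_rad_rad iJ); exists N.
apply: ideal_span_sub (is_ideal_rad iJ) _ cN => b [be|[j ->]] //.
by apply/in_rad_sub/ideal_span_mem; left.
Qed.

Lemma hsop_exists : exists (D : nat) (g : 'I_n -> B),
  [/\ (0 < D)%N, forall i, homogeneous D (g i),
      forall j, in_rad (euler_ideal g) (x j)
    & forall j, (0 < wtt j)%N -> in_rad (euler_ideal g) (t j)].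
Proof.
(* Every weight is at most [s], so the positive ones divide s!, and suitable powers of the variables
   all acquire the degree s!. A t_j of weight 0 is replaced by 0. *)
pose s := (\sum_j (wtx j + wtt j))%N.
have ws j : (wtx j + wtt j <= s)%N by rewrite /s (bigD1 j) //= leq_addr.
pose c (i : 'I_(n + n)) := match split i with
  | inl j => x j ^+ (s`! %/ wtx j)
  | inr j => if (0 < wtt j)%N then t j ^+ (s`! %/ wtt j) else 0 end.
have [|i|g gD cg] := @hsop_reduce s`! n c; first exact: fact_gt0.
  rewrite /c; case: (split i) => j.
    have := homogeneousX (s`! %/ wtx j) (alpha_x j); rewrite mulnC divnK //.
    by rewrite dvdn_fact // wtx_gt0 (leq_trans (leq_addr _ _) (ws j)).
  case: ifP => tj; last by rewrite /homogeneous rmorph0 scale0r.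
  have := homogeneousX (s`! %/ wtt j) (alpha_t j); rewrite mulnC divnK //.
  by rewrite dvdn_fact // tj (leq_trans (leq_addl _ _) (ws j)).
exists s`!, g; split=> // [|j|j tj]; first exact: fact_gt0.
  have [N cN] := cg (unsplit (inl j)); move: cN; rewrite /c unsplitK -exprM => cN.
  by eexists; exact: cN.
have [N cN] := cg (unsplit (inr j)); move: cN; rewrite /c unsplitK tj -exprM => cN.
by eexists; exact: cN.
Qed.

End Hsop.

(** * Positive functionals *)

Section Gordan.
Variable d : nat.
Implicit Types l v : 'I_d -> int.

Definition dot l v := \sum_i l i * v i.

Lemma dotDl l l' (a b : int) v : dot (fun i => a * l i + b * l' i) v = a * dot l v + b * dot l' v.
Proof.
by rewrite /dot !mulr_sumr -big_split; apply: eq_bigr => i _; rewrite /=; ring.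
Qed.

Lemma dotDr l (a b : int) v v' : dot l (fun i => a * v i + b * v' i) = a * dot l v + b * dot l v'.
Proof.
by rewrite /dot !mulr_sumr -big_split; apply: eq_bigr => i _; rewrite /=; ring.
Qed.

(** Gordan's alternative over the integers, by induction on the number of vectors: a functional that
    is positive on all vectors but the first one, [v], is corrected according to the sign of its
    value at [v]. *)
Lemma gordan m (f : 'I_m -> 'I_d -> int) :
  (exists l, forall a, 0 < dot l (f a)) \/
  (exists c : 'I_m -> nat, (exists a, (0 < c a)%N) /\
     forall i, \sum_a (c a)%:Z * f a i = 0).
Proof.
elim: m f => [|m IHm] f; first by left; exists (fun=> 0) => -[].
pose v := f ord0; pose u a := f (fintype.lift ord0 a).
have consP l : 0 < dot l v -> (forall a, 0 < dot l (u a)) -> exists l, forall a, 0 < dot l (f a).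
  by move=> lv lu; exists l => a; case: (unliftP ord0 a) => [b ->|-> //]; apply: lu.
have perturb l l' : (forall a, 0 < dot l (u a)) -> dot l v = 0 -> 0 < dot l' v ->
    exists l, forall a, 0 < dot l (f a).
  move=> lu lv l'v; pose k := 1 + \sum_a `|dot l' (u a)|.
  apply: (consP (fun i => k * l i + 1 * l' i)) => [|a].
    by rewrite dotDl lv mulr0 add0r mul1r.
  rewrite dotDl mul1r; have := lu a.
  have : `|dot l' (u a)| <= \sum_a `|dot l' (u a)|.
    by rewrite (bigD1 a) //= lerDl sumr_ge0.
  rewrite /k; move: (dot l (u a)) (dot l' (u a)) (\sum_a _) => x y z; nia.
have [[l lP]|[c [[a ca] cP]]] := IHm u; last first.
  right; exists (fun b => if unlift ord0 b is Some b' then c b' else 0%N); split.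
    by exists (fintype.lift ord0 a); rewrite liftK.
  move=> i; rewrite big_ord_recl unlift_none mul0r add0r -[RHS](cP i).
  by apply: eq_bigr => b _; rewrite liftK.
have [lv|lv|lv] := ltrgtP 0 (dot l v); first by left; apply: consP lP.
  (* The vector [w a] is the combination of [u a] and [v] on which [l] vanishes. From [l'] positive
     on all [w a] one obtains a functional that vanishes on [v] and takes at [u a] the value of [l']
     at [w a]; perturbing it by - l makes it positive on [v]. A relation between the [w a] is also
     one between the [u a] and [v]. *)
  pose w a i := (- dot l v) * u a i + dot l (u a) * v i.
  have [[l' l'P]|[c [[a ca] cP]]] := IHm w.
    left; apply: (perturb (fun i => (- dot l v) * l' i + dot l' v * l i) (fun i => -1 * l i + 0 * l i)).
    - by move=> a; have := l'P a; rewrite dotDr dotDl [dot l (u a) * _]mulrC.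
    - by rewrite dotDl; ring.
    by rewrite dotDl mul0r addr0 mulN1r oppr_gt0.
  right; exists (fun b => if unlift ord0 b is Some b' then (absz (dot l v) * c b')%N
                   else (\sum_b' c b' * absz (dot l (u b')))%N); split.
    by exists (fintype.lift ord0 a); rewrite liftK muln_gt0 ca absz_gt0 lt_eqF.
  move=> i; rewrite big_ord_recl unlift_none -[RHS](cP i).
  rewrite (big_morph Posz PoszD (erefl _)) mulr_suml -big_split; apply: eq_bigr => b _.
  rewrite /= liftK /w !PoszM (ltz0_abs lv) (gtz0_abs (lP b)) /v /u; ring.
have [[i vi]|v0] := pselect (exists i, v i != 0).
  left; apply: (perturb l v) => //; rewrite /dot.
  rewrite lt_def sumr_ge0 => [|j _]; last exact: sqr_ge0.
  rewrite andbT psumr_neq0 => [|j _]; last exact: sqr_ge0.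
  by apply/hasP; exists i; rewrite ?mem_index_enum //= lt_def sqr_ge0 mulf_neq0.
right; exists (fun b => (b == ord0) : nat); split; first by exists ord0.
move=> i; rewrite (bigD1 ord0) //= big1 => [|b /negPf ->]; last by rewrite mul0r.
rewrite mul1r addr0; apply/eqP/negPn/negP => vi; apply: v0; by exists i.
Qed.

(** By Gordan's alternative, failure would give a nontrivial relation with natural coefficients
    between nonzero columns. A term of it would be invertible in the semigroup, hence zero. *)
Lemma positive_functional n (A : 'M[int]_(d, n)) : positive_semigroup A ->
  exists l, forall j, col j A != 0 -> 0 < dot l (fun i => A i j).
Proof.
move=> pos; pose Z := [set j | col j A != 0].
have [[l lP]|[c [[a ca] cP]]] := gordan (fun (a : 'I_#|Z|) i => A i (enum_val a)).
  exists l => j jZ; have jZ' : j \in Z by rewrite inE.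
  by have := lP (enum_rank_in jZ' j); rewrite enum_rankK_in.
have := enum_valP a; rewrite inE => /eqP; case.
have S : \sum_(b : 'I_#|Z|) col (enum_val b) A *+ c b = 0.
  apply/colP => i; rewrite summxE mxE -[RHS](cP i); apply: eq_bigr => b _.
  by rewrite mulmxnE mxE -mulr_natl natz.
pose cc (e : 'I_#|Z| -> nat) j : nat := (\sum_(b | enum_val b == j) e b)%N.
have NA e : in_NA A (\sum_(b : 'I_#|Z|) col (enum_val b) A *+ e b).
  exists (cc e); rewrite (partition_big (fun b => enum_val b) predT) //=.
  apply: eq_bigr => j _; rewrite /cc -sumrMnr.
  by apply: eq_bigr => b /eqP ->.
have NA1 : in_NA A (col (enum_val a) A *+ c a).
  have := NA (fun b => if b == a then c a else 0%N).
  by rewrite (bigD1 a) //= eqxx big1 ?addr0 => [|b /negPf ->].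
have NA2 : in_NA A (- (col (enum_val a) A *+ c a)).
  have := NA (fun b => if b == a then 0%N else c b).
  rewrite (bigD1 a) //= eqxx mulr0n add0r; congr in_NA.
  move/eqP: S; rewrite (bigD1 a) //= addrC addr_eq0 => /eqP <-.
  by apply: eq_bigr => b /negPf ->.
move/colP: (pos _ NA1 NA2) => E; apply/colP => i; have := E i.
rewrite mulmxnE !mxE -mulr_natl => /eqP; rewrite mulf_eq0 => /orP[|/eqP ->//].
by rewrite pnatr_eq0; case: (c a) ca.
Qed.

End Gordan.

(** * A regular sequence in the toric ring *)

Section ToricRing.
Variables (K : numFieldType) (d n : nat) (A : 'M[int]_(d, n)).
Local Notation RA := {mpoly K[n]}.
Local Notation S := (toric_ring K A).
Local Notation cls := (\pi_S : RA -> S).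

Lemma toric_lift (C : comNzRingType) (h : {rmorphism RA -> C}) :
  (forall p, toric_binomial A p -> h p = 0) ->
  exists g : {rmorphism S -> C}, forall p, g (cls p) = h p.
Proof.
move=> h0; have hI p : p \in @toric_ideal K d n A -> h p = 0.
  elim/ideal_span_ind => [|u v hu hv|a g /h0 hg]; first exact: rmorph0.
    by rewrite rmorphD hu hv addr0.
  by rewrite rmorphM hg mulr0.
pose g0 (s : S) := h (repr s).
have g0E p : g0 (cls p) = h p.
  apply/eqP; rewrite -subr_eq0 -rmorphB; apply/eqP/hI/toric_eqP.
  exact: reprK.
have gB : zmod_morphism g0.
  elim/toric_ringW => p; elim/toric_ringW => q.
  by rewrite -clsB !g0E rmorphB.
have gM : monoid_morphism g0.
  split; first by rewrite -cls1 g0E rmorph1.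
  elim/toric_ringW => p; elim/toric_ringW => q.
  by rewrite -clsM !g0E rmorphM.
pose g : {rmorphism S -> C} := HB.pack g0
  (GRing.isZmodMorphism.Build S C g0 gB) (GRing.isMonoidMorphism.Build S C g0 gM).
by exists g.
Qed.

Definition toric_var (j : 'I_n) : S := cls 'X_j.
Definition toric_const : {rmorphism K -> S} := (cls \o @mpolyC n K).

Lemma toric_constE c : toric_const c = cls c%:MP.
Proof. by []. Qed.

Lemma cls_monomial (m : 'X_{1..n}) : cls 'X_[m] = \prod_j toric_var j ^+ m j.
Proof.
rewrite mpolyXE_id rmorph_prod; apply: eq_bigr => j _.
by rewrite rmorphXn.
Qed.

(** After the common factor with exponents min(u, v) is removed, the two monomials differ by a
    generator of the toric ideal, the one for u - v. *)
Lemma toric_var_congr (u v : 'I_n -> nat) :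
  (forall i, \sum_j A i j * (u j)%:Z = \sum_j A i j * (v j)%:Z) ->
  \prod_j toric_var j ^+ u j = \prod_j toric_var j ^+ v j.
Proof.
move=> uv; pose w : 'cV[int]_n := \col_j ((u j)%:Z - (v j)%:Z).
have Aw : A *m w = 0.
  apply/colP => i; rewrite !mxE -[RHS](subrr (\sum_j A i j * (u j)%:Z)) [X in _ - X]uv -sumrB.
  by apply: eq_bigr => j _; rewrite mxE mulrBr.
have E : cls 'X_[mnm_plus w] = cls 'X_[mnm_minus w].
  apply/toric_eqP; rewrite -[X in X \in _]mul1r; apply: ideal_span_gen.
  by exists w.
have split_min (y : 'I_n -> nat) (m : 'X_{1..n}) :
    (forall j, y j = minn (u j) (v j) + m j)%N ->
    \prod_j toric_var j ^+ y j = \prod_j toric_var j ^+ minn (u j) (v j) * cls 'X_[m].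
  move=> ym; rewrite cls_monomial -big_split; apply: eq_bigr => j _.
  by rewrite ym exprD.
rewrite (split_min u (mnm_plus w)) => [|j]; last by rewrite mnmE !mxE; lia.
by rewrite E -(split_min v (mnm_minus w)) // => j; rewrite mnmE !mxE; lia.
Qed.

Lemma toric_var_col0 j : col j A = 0 -> toric_var j = 1.
Proof.
move=> j0; have := @toric_var_congr (fun k => (k == j) : nat) (fun=> 0%N).
rewrite [RHS]big1 // (bigD1 j) //= eqxx expr1 big1 => [|k /negPf ->//].
rewrite mulr1; apply=> i; rewrite [RHS]big1 => [|k _]; last by rewrite mulr0.
rewrite (bigD1 j) //= eqxx mulr1 big1 => [|k /negPf ->]; last by rewrite mulr0.
by have /colP/(_ i) := j0; rewrite !mxE addr0.
Qed.

Lemma toric_ring_gen (P : S -> Prop) :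
  (forall c, P (toric_const c)) -> (forall j, P (toric_var j)) ->
  (forall a b, P a -> P b -> P (a + b)) -> (forall a b, P a -> P b -> P (a * b)) ->
  forall s, P s.
Proof.
move=> PC PX PD PM; elim/toric_ringW => p; elim/mpoly_gen_ind: p => [c|j|p q|p q] //.
- exact: PC.
- exact: PX.
- by rewrite clsD; apply: PD.
by rewrite clsM; apply: PM.
Qed.

Section Functional.
Variable l : 'I_d -> int.
Local Notation lA j := (dot l (fun i => A i j)).
Hypothesis l_pos : forall j, col j A != 0 -> 0 < lA j.

Let lA_ge0 j : 0 <= lA j.
Proof.
have [/colP j0|/l_pos/ltW //] := eqVneq (col j A) 0.
rewrite /dot big1 // => i _; have := j0 i; rewrite !mxE => ->.
by rewrite mulr0.
Qed.

Definition toric_weight j := absz (lA j).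

Lemma toric_weight_gt0 j : (0 < toric_weight j)%N = (col j A != 0).
Proof.
rewrite absz_gt0; apply/idP/idP => [|/l_pos]; last by move=> h; rewrite gt_eqF.
apply: contraNneq => /colP j0; rewrite /dot big1 // => i _.
by have := j0 i; rewrite !mxE => ->; rewrite mulr0.
Qed.

(* Nonnegative on the columns of [A]; together with [l] these functionals
   separate the points of Z^d. *)
Let N := (entry_sum A)%:Z.
Variable i0 : 'I_d.
Let wf (i : 'I_d) (v : 'I_d -> int) := if i == i0 then dot l v else N * dot l v + v i.
Let W i j := absz (wf i (fun k => A k j)).

Let wf_ge0 i j : 0 <= wf i (fun k => A k j).
Proof.
rewrite /wf; case: ifP => // _; have [/colP j0|/l_pos lj] := eqVneq (col j A) 0.
  by have := j0 i; rewrite !mxE => ->; rewrite addr0 mulr_ge0.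
have AN : `|A i j| <= N.
  rewrite /N /entry_sum -abszE lez_nat (bigD1 i) //= (bigD1 j) //=.
  by rewrite -addnA leq_addr.
have : N <= N * lA j by rewrite ler_peMr //; lia.
lia.
Qed.

Let wfW i (m : 'I_n -> nat) : (\sum_j W i j * m j)%N%:Z =
  wf i (fun k => \sum_j A k j * (m j)%:Z).
Proof.
rewrite (big_morph Posz PoszD (erefl _)).
under eq_bigr do rewrite PoszM gez0_abs //.
have dE : dot l (fun k => \sum_j A k j * (m j)%:Z) = \sum_j lA j * (m j)%:Z.
  rewrite /dot; under eq_bigr do rewrite mulr_sumr.
  rewrite exchange_big; apply: eq_bigr => j _; rewrite mulr_suml.
  by apply: eq_bigr => i' _; rewrite mulrA.
rewrite /wf; case: ifP => _; first by rewrite dE.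
by rewrite dE mulr_sumr -big_split; apply: eq_bigr => j _; rewrite /= mulrDl mulrA.
Qed.

(** The order in which the variables of the target are specialized; [i0] comes last. *)
Let pos (i : 'I_d) : nat := if unlift i0 i is Some b then b else d.-1.
(** The map [psi0 k] sends t^a to the product of the y_i^(wf i a) and then puts the first [k]
    variables y_i equal to 1, except that y_{i0}, which is reached only for k = d, becomes 0. The
    kernels form the chain of primes, which ends with the ideal of all t_j with a_j nonzero. *)
Let sigma k i : {mpoly K[d]} := if (pos i < k)%N then (i != i0)%:R else 'X_i.

Let psi0 k : {rmorphism RA -> {mpoly K[d]}} :=
  mmap (@mpolyC d K) (fun j => \prod_i sigma k i ^+ W i j).

Let psi0X k (m : 'X_{1..n}) : psi0 k 'X_[m] = \prod_i sigma k i ^+ (\sum_j W i j * m j).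
Proof.
rewrite /psi0 /= mmapX /mmap1.
under [LHS]eq_bigr do rewrite -prodrXl.
rewrite [LHS]exchange_big; apply: eq_bigr => i _ /=.
by rewrite -prodrXr; apply: eq_bigr => j _; rewrite exprM.
Qed.

Let psi_ex k : exists g : {rmorphism S -> {mpoly K[d]}}, forall p, g (cls p) = psi0 k p.
Proof.
apply: toric_lift => p [u [Au ->]]; rewrite rmorphB !psi0X; apply/eqP.
rewrite subr_eq0; apply/eqP; apply: eq_bigr => i _; congr (_ ^+ _).
apply: (pcan_inj (g := fun z : int => Some (absz z)) (f := Posz)) => //.
rewrite !wfW; congr wf; apply/funext => k'; apply/eqP; rewrite -subr_eq0 -sumrB.
have := congr1 (fun M : 'cV_d => M k' 0) Au; rewrite !mxE => E; rewrite -[X in _ == X]E.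
by apply/eqP/eq_bigr => j _; rewrite -mulrBr mnm_plusB.
Qed.

Section Chain.
Variable psi : nat -> {rmorphism S -> {mpoly K[d]}}.
Hypothesis psiE : forall k p, psi k (cls p) = psi0 k p.

Let psi_var k j : psi k (toric_var j) = \prod_i sigma k i ^+ W i j.
Proof. by rewrite /toric_var psiE /psi0 /= mmapX mmap1U. Qed.

Let psi_const k c : psi k (toric_const c) = c%:MP.
Proof. by rewrite /= psiE /psi0 /= mmapC. Qed.

Let Q k : {pred S} := fun s => psi k s == 0.

Let Q_prime k : prime_ideal (Q k).
Proof.
split; first split.
- by rewrite unfold_in /Q rmorph0.
- by rewrite unfold_in /Q rmorph1 oner_eq0.
- by move=> a u v; rewrite !unfold_in /Q rmorphD rmorphM => /eqP -> /eqP ->; rewrite mulr0 addr0.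
by move=> u v; rewrite !unfold_in /Q rmorphM mulf_eq0.
Qed.

Let psiS k : exists tau : {rmorphism {mpoly K[d]} -> {mpoly K[d]}},
  forall s, psi k.+1 s = tau (psi k s).
Proof.
have [tau [tauC tauX]] : exists tau : {rmorphism {mpoly K[d]} -> {mpoly K[d]}},
    (forall c, tau c%:MP = c%:MP) /\ forall i, tau 'X_i = sigma k.+1 i.
  exists (mmap (@mpolyC d K) (sigma k.+1)).
  by split=> [c|i] /=; rewrite ?mmapC ?mmapX ?mmap1U.
exists tau; elim/toric_ring_gen => [c|j|a b ha hb|a b ha hb].
- by rewrite !psi_const tauC.
- rewrite !psi_var rmorph_prod; apply: eq_bigr => i _; rewrite rmorphXn; congr (_ ^+ _).
  rewrite {2}/sigma; case: ifP => ik; last by rewrite tauX.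
  by rewrite rmorph_nat /sigma leqW.
- by rewrite !rmorphD ha hb.
by rewrite !rmorphM ha hb.
Qed.

Let Q_sub k : {subset Q k <= Q k.+1}.
Proof.
have [tau tauE] := psiS k; move=> s; rewrite !unfold_in /Q tauE => /eqP ->.
by rewrite rmorph0.
Qed.

Hypothesis A_full : forall v : 'cV[int]_d, in_ZA A v.
Hypothesis l0 : l i0 != 0.

Let pos_i0 : pos i0 = d.-1. Proof. by rewrite /pos unlift_none. Qed.

Let pos_surj k : (k < d.-1)%N -> exists2 i, pos i = k & i != i0.
Proof.
move=> kd; exists (fintype.lift i0 (Ordinal kd)); first by rewrite /pos liftK.
by rewrite eq_sym neq_lift.
Qed.

Let Q_lt k : (k < d)%N -> ~ {subset Q k.+1 <= Q k}.
Proof.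
move=> kd sub; have [kd'|dk] := ltnP k d.-1; last first.
  (* The last inclusion, where y_{i0} becomes 0: it is strict because of t_j for any nonzero column,
     whose exponent at y_{i0} is its positive weight. *)
  have {dk} kd1 : k = d.-1 by lia.
  have [j jA] : exists j, col j A != 0.
    apply: contrapT => no; have cj j : col j A = 0.
      by apply/eqP/negPn/negP => jA; apply: no; exists j.
    have [c] := A_full (delta_mx i0 0); rewrite big1 => [/colP/(_ i0)|j _]; last first.
      by rewrite cj mul0rz.
    by rewrite !mxE !eqxx.
  have : toric_var j \in Q k.+1.
    rewrite unfold_in /Q psi_var (bigD1 i0) //= /sigma pos_i0 kd1 ltnSn eqxx.
    rewrite /W /wf eqxx expr0n -/(toric_weight j) eqn0Ngt toric_weight_gt0 jA.
    by rewrite mul0r.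
  move/sub; rewrite unfold_in /Q psi_var; apply/negP.
  apply/prodf_neq0 => i _; rewrite expf_neq0 // /sigma; case: ifP => [ik|_].
    have -> : i != i0 by apply: contraTneq ik => ->; rewrite pos_i0 kd1 ltnn.
    by rewrite oner_eq0.
  by rewrite -msize_poly_eq0 msizeX mdeg1.
have [i ik ii0] := pos_surj kd'.
(* As [v] is orthogonal to [l] and supported on [i] and [i0], every functional except the one of
   index [i] vanishes on it. The binomial whose two monomials differ in degree by [v] dies when y_i
   becomes 1, and not before: the point y_i = 2, with all other y equal to 1, detects it. *)
pose v k' := if k' == i then l i0 else if k' == i0 then - l i else 0.
have dv : dot l v = 0.
  rewrite /dot (bigD1 i) //= (bigD1 i0) 1?eq_sym //= big1 => [|k' /andP[ki ki0]].
    by rewrite /v eqxx eq_sym (negPf ii0) eqxx; ring.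
  by rewrite /v (negPf ki) (negPf ki0) mulr0.
have [c cE] := A_full (\col_k' v k').
pose w : 'cV[int]_n := \col_j c j.
have cv k' : \sum_j A k' j * (mnm_plus w j)%:Z = \sum_j A k' j * (mnm_minus w j)%:Z + v k'.
  apply/eqP; rewrite addrC -subr_eq -sumrB; apply/eqP.
  have /colP/(_ k') := cE; rewrite summxE !mxE => ->; apply: eq_bigr => j _.
  by rewrite -mulrBr mnm_plusB mxE -scaler_int !mxE intz mulrC.
pose a i' := (\sum_j W i' j * mnm_plus w j)%N.
pose b i' := (\sum_j W i' j * mnm_minus w j)%N.
have ab i' : (a i')%:Z = (b i')%:Z + (if i' == i then l i0 else 0).
  rewrite /a /b !wfW.
  have -> : (fun k' => \sum_j A k' j * (mnm_plus w j)%:Z) =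
      (fun k' => 1 * (\sum_j A k' j * (mnm_minus w j)%:Z) + 1 * v k').
    by apply/funext => k'; rewrite cv !mul1r.
  rewrite /wf; case: eqP => [->|/eqP ii].
    by rewrite dotDr dv eq_sym (negPf ii0); ring.
  rewrite dotDr dv /v (negPf ii); case: ifP => _; ring.
pose p : RA := 'X_[mnm_plus w] - 'X_[mnm_minus w].
have : cls p \in Q k.+1.
  rewrite unfold_in /Q psiE rmorphB !psi0X subr_eq0; apply/eqP/eq_bigr => i' _.
  have [->|ii] := eqVneq i' i; first by rewrite /sigma ik ltnSn ii0 !expr1n.
  by congr (_ ^+ _); have := ab i'; rewrite (negPf ii) addr0 => -[].
move/sub; rewrite unfold_in /Q psiE rmorphB !psi0X => /eqP.
move=> /(congr1 (meval (fun i' => if i' == i then 2 else 1 : K))).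
have ev (y : 'I_d -> nat) :
    (\prod_i' sigma k i' ^+ y i').@[fun i' => if i' == i then 2 else 1] = 2 ^+ y i :> K.
  rewrite rmorph_prod (bigD1 i) //= big1 => [|i' ii].
    by rewrite mulr1 rmorphXn /= /sigma ik ltnn mevalXU eqxx.
  rewrite rmorphXn /= /sigma; case: ifP => [ki|_]; last by rewrite mevalXU (negPf ii) expr1n.
  have -> : i' != i0.
    by apply: contraTneq ki => ->; rewrite pos_i0 -leqNgt ltnW.
  by rewrite rmorph1 expr1n.
rewrite rmorph0 rmorphB /= !ev -/(a i) -/(b i) => /eqP; rewrite subr_eq0 -!natrX eqr_nat.
rewrite eqn_exp2l // => /eqP E; have := ab i; rewrite E eqxx => /eqP.
by rewrite -{1}[(b i)%:Z]addr0 (inj_eq (addrI _)) eq_sym (negPf l0).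
Qed.

Let psi_d_var j : psi d (toric_var j) = (col j A == 0)%:R.
Proof.
rewrite psi_var (bigD1 i0) //= big1 => [|i ii0].
  rewrite mulr1 /sigma pos_i0 ltn_predL (leq_ltn_trans _ (ltn_ord i0)) // eqxx expr0n.
  by rewrite /W /wf eqxx -/(toric_weight j) eqn0Ngt toric_weight_gt0 negbK.
rewrite /sigma ii0; have -> : (pos i < d)%N; last by rewrite expr1n.
by rewrite /pos; case: unlift => [b|]; have := ltn_ord i; [have := ltn_ord b|]; lia.
Qed.

Let span_vars s := s \in ideal_span (fun g => exists2 j, col j A != 0 & g = toric_var j).

(** The t_j with a_j = 0 are equal to 1. Thus K is the residue field at the ideal of the other t_j,
    which is therefore maximal. *)
Let toric_decomp s : exists c, span_vars (s - toric_const c).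
Proof.
have iI := is_ideal_span (fun g => exists2 j, col j A != 0 & g = toric_var j).
elim/toric_ring_gen: s => [c|j|a b [c cP] [e eP]|a b [c cP] [e eP]].
- by exists c; rewrite subrr; apply: (is_ideal0 iI).
- have [j0|j0] := eqVneq (col j A) 0.
    by exists 1; rewrite rmorph1 toric_var_col0 // subrr; apply: (is_ideal0 iI).
  by exists 0; rewrite rmorph0 subr0; apply: ideal_span_mem; exists j.
- by exists (c + e); rewrite rmorphD opprD addrACA; apply: (is_idealD iI).
exists (c * e); rewrite rmorphM.
have -> : a * b - toric_const c * toric_const e =
  a * (b - toric_const e) + toric_const e * (a - toric_const c) by ring.
by apply: (is_idealD iI); apply: (is_idealM iI).
Qed.

Let Q_max : maximal_ideal (Q d).
Proof.
split; first exact: (Q_prime d).1.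
move=> I [I0 I1 IP] QI s; apply/idP/idP; last exact: QI.
move=> sI; have [c cP] := toric_decomp s.
have sc : s - toric_const c \in Q d.
  move: cP; rewrite /span_vars; elim/ideal_span_ind => [|a b|a g [j jA ->]].
  - by rewrite unfold_in /Q rmorph0.
  - by rewrite !unfold_in /Q rmorphD => /eqP -> /eqP ->; rewrite addr0.
  by rewrite unfold_in /Q rmorphM psi_d_var (negPf jA) mulr0.
have [c0|c0] := eqVneq c 0; first by move: sc; rewrite c0 rmorph0 subr0.
case/negP: I1; rewrite -[1]addr0.
have -> : 1 = toric_const c^-1 * s - toric_const c^-1 * (s - toric_const c).
  by rewrite -mulrBr opprB addrC subrK -rmorphM mulVf // rmorph1.
rewrite -mulNr addr0; apply: (IP) => //; rewrite -[X in X \in I]addr0; apply: (IP) => //.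
exact: QI.
Qed.

Let Q_d_span s : s \in Q d -> span_vars s.
Proof.
have [c cP] := toric_decomp s; rewrite unfold_in /Q => /eqP sQ.
have : psi d (s - toric_const c) = 0.
  move: cP; rewrite /span_vars; elim/ideal_span_ind => [|a b ha hb|a g [j jA ->]].
  - by rewrite rmorph0.
  - by rewrite rmorphD ha hb addr0.
  by rewrite rmorphM psi_d_var (negPf jA) mulr0.
rewrite rmorphB sQ psi_const sub0r => /eqP; rewrite oppr_eq0 mpolyC_eq0 => /eqP c0.
by move: cP; rewrite c0 rmorph0 subr0.
Qed.

Lemma regular_sequence_ex : cohen_macaulay S ->
  exists s : seq S, [/\ size s = d,
    forall i, (i < d)%N -> span_vars s`_i & regular_sequence s].
Proof.
case=> _ /(_ (Q d) Q_max d) [_ [|s [sd sQ sreg]]].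
  by exists Q; split=> // k kd; split; [exact: Q_sub | exact: Q_lt].
by exists s; split=> // i id; apply/Q_d_span/sQ/mem_nth; rewrite sd.
Qed.

End Chain.

Lemma toric_regular_sequence_aux : (forall v : 'cV[int]_d, in_ZA A v) -> l i0 != 0 ->
  cohen_macaulay S -> exists s : seq S, [/\ size s = d,
    forall i, (i < d)%N ->
      s`_i \in ideal_span (fun g => exists2 j, col j A != 0 & g = toric_var j)
    & regular_sequence s].
Proof. by have [psi psiE] := boolp.choice psi_ex; apply: regular_sequence_ex psiE. Qed.

End Functional.

Lemma toric_regular_sequence (l : 'I_d -> int) :
  (forall j, col j A != 0 -> 0 < dot l (fun i => A i j)) ->
  (forall v : 'cV[int]_d, in_ZA A v) -> cohen_macaulay S ->
  exists s : seq S, [/\ size s = d,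
    forall i, (i < d)%N ->
      s`_i \in ideal_span (fun g => exists2 j, col j A != 0 & g = toric_var j)
    & forall i, (i < d)%N -> forall x, s`_i * x \in ideal_of (take i s) ->
        x \in ideal_of (take i s)].
Proof.
move=> l_pos A_full CM; have [d0|d0] := posnP d.
  by exists [::]; split=> [|i|i]; [exact: esym | have := d0; lia | have := d0; lia].
have [[i li]|l0] := pselect (exists i, l i != 0).
  have [s [sd sI [sreg _]]] := toric_regular_sequence_aux l_pos A_full li CM.
  by exists s; split=> // k kd; apply: sreg; rewrite sd.
(* If l were 0, all columns of [A] would vanish, and they could not generate Z^d for d > 0. *)
pose i := Ordinal d0; have [c] := A_full (delta_mx i 0).
rewrite big1 => [/colP/(_ i)|j _]; first by rewrite !mxE !eqxx.
have [->|/l_pos] := eqVneq (col j A) 0; first by rewrite mul0rz.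
rewrite /dot big1 ?ltxx // => k _; have [->|lk] := eqVneq (l k) 0; first by rewrite mul0r.
by case: l0; exists k.
Qed.

End ToricRing.

(** * Regular sequences in polynomial rings *)

Lemma mpoly_ring_gen (S : comNzRingType) n (P : {mpoly S[n]} -> Prop) :
  (forall c, P c%:MP) -> (forall j, P 'X_j) ->
  (forall p q, P p -> P q -> P (p + q)) ->
  (forall p q, P p -> P q -> P (p * q)) -> forall p, P p.
Proof.
move=> PC PX PD PM; elim/mpolyind => [|c m p _ _ Pp]; first by rewrite -mpolyC0.
apply: (PD) => //; rewrite -mul_mpolyC; apply: (PM) => //.
rewrite mpolyXE_id; elim/big_ind: _ => [||j _]; first by rewrite -mpolyC1.
  by move=> *; apply: (PM).
by elim: (m j) => [|k IHk]; rewrite ?expr0 -?mpolyC1 // exprS; apply: (PM).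
Qed.

Section PolynomialRegular.
Variables (S : comNzRingType) (n d : nat) (s : seq S).
Local Notation B := {mpoly S[n]}.
Hypothesis s_size : size s = d.
Hypothesis s_reg : forall i, (i < d)%N -> forall a, s`_i * a \in ideal_of (take i s) ->
  a \in ideal_of (take i s).

Definition poly_seq (k : nat) : B :=
  if (k < d)%N then (s`_k)%:MP else if insub (k - d)%N is Some j then 'X_j else 0.

(* Membership in the ideal generated by the first [k] terms of [poly_seq]. *)
Definition poly_seq_ideal (k : nat) (b : B) := forall m : 'X_{1..n},
  (forall i : 'I_n, (i < k - d)%N -> m i = 0%N) -> b@_m \in ideal_of (take k s).

Let is_ideal_of k : is_ideal (fun a => a \in ideal_of (take k s)).
Proof. exact: is_ideal_span. Qed.

Let coefXM j (b : B) m : ('X_j * b)@_m = if m j == 0%N then 0 else b@_(m - U_(j)).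
Proof.
case: (posnP (m j)) => [m0|mj].
  rewrite mcoeffM big1 // => -[m1 m2] /= /eqP E; rewrite mcoeffX.
  case: eqP => [E1|]; last by rewrite mul0r.
  by have := congr1 (fun u : 'X_{1..n} => u j) E; rewrite -E1 m0 mnmDE mnm1E eqxx.
rewrite -[in LHS](submK (m := U_(j)) (m' := m)).
  by rewrite addmC mulrC mcoeffMX.
by rewrite lep1mP -lt0n.
Qed.

Lemma is_ideal_poly_seq k : is_ideal (poly_seq_ideal k).
Proof.
split=> [m _|a b ha hb m hm|a b hb m hm].
- by rewrite mcoeff0; apply: (is_ideal0 (is_ideal_of k)).
- by rewrite mcoeffD; apply: (is_idealD (is_ideal_of k)); [apply: ha | apply: hb].
rewrite mcoeffM; apply: (is_ideal_sum (is_ideal_of k)) => -[m1 m2] /= /eqP E.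
apply: (is_idealM (is_ideal_of k)); apply: hb => i ik.
have := congr1 (fun u : 'X_{1..n} => u i) E; rewrite mnmDE hm // => /esym/eqP.
by rewrite addn_eq0 => /andP[_ /eqP].
Qed.

Lemma poly_seq_ideal0 b : poly_seq_ideal 0 b <-> b = 0.
Proof.
have I0 a : a \in ideal_of (take 0 s) -> a = 0.
  by rewrite take0; elim/ideal_span_ind => // u v -> ->; rewrite addr0.
split=> [hb|->]; last exact: is_ideal0 (is_ideal_poly_seq _).
by apply/mpolyP => m; rewrite mcoeff0; apply/I0/hb => i; rewrite ltn0.
Qed.

Let poly_seqX k (kd : (k - d < n)%N) : (d <= k)%N -> poly_seq k = 'X_(Ordinal kd).
Proof.
by rewrite /poly_seq leqNgt => /negPf ->; rewrite insubT.
Qed.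

Let cond_of k (m : 'X_{1..n}) : (k <= d)%N -> forall i : 'I_n, (i < k - d)%N -> m i = 0%N.
Proof. by move=> kd i; have -> : (k - d = 0)%N by lia. Qed.

(** This justifies the coefficientwise description of the ideals: below d, one divides by s_k
    coefficient by coefficient; from d on, one splits off the monomials that contain the new
    variable. *)
Lemma poly_seq_idealS k b : (k < d + n)%N ->
  poly_seq_ideal k.+1 b <-> exists c, poly_seq_ideal k (b - poly_seq k * c).
Proof.
move=> kdn; have [kd|dk] := ltnP k d.
  have takeS : take k.+1 s = rcons (take k s) s`_k by rewrite (take_nth 0) ?s_size.
  have sub a : a \in ideal_of (take k s) -> a \in ideal_of (take k.+1 s).
    by apply: ideal_span_mono => g gs; apply: ideal_span_mem; rewrite takeS mem_rcons inE gs orbT.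
  rewrite /poly_seq kd; split=> [hb|[c hc] m hm]; last first.
    have := hc m (cond_of _ (ltnW kd)); rewrite mcoeffB mcoeffCM => /sub hm'.
    rewrite -[b@_m](subrK (s`_k * c@_m)); apply: (is_idealD (is_ideal_of _)) => //.
    rewrite mulrC; apply: (is_idealM (is_ideal_of _)); apply: ideal_span_mem.
    by rewrite takeS mem_rcons mem_head.
  have div a : a \in ideal_of (take k.+1 s) -> exists c, a - s`_k * c \in ideal_of (take k s).
    elim/ideal_span_ind => [|u v [c cP] [e eP]|u g].
    - by exists 0; rewrite mulr0 subrr; apply: (is_ideal0 (is_ideal_of _)).
    - exists (c + e); rewrite mulrDr opprD addrACA.
      exact: (is_idealD (is_ideal_of _)).
    rewrite takeS mem_rcons inE => /orP[/eqP ->|gs].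
      by exists u; rewrite mulrC subrr; apply: (is_ideal0 (is_ideal_of _)).
    exists 0; rewrite mulr0 subr0; apply: (is_idealM (is_ideal_of _)).
    exact: ideal_span_mem.
  have /boolp.choice [c cP] m : exists c, b@_m - s`_k * c \in ideal_of (take k s).
    by apply: div; apply: hb; apply: cond_of.
  exists (\sum_(m <- msupp b) c m *: 'X_[m]) => m _.
  rewrite mcoeffB mcoeffCM raddf_sum /=; under eq_bigr do rewrite mcoeffZ mcoeffX.
  have [ms|ms] := boolP (m \in msupp b).
    rewrite (bigD1_seq m) ?msupp_uniq //= eqxx mulr1 big1 ?addr0 // => m' /negPf ->.
    by rewrite mulr0.
  rewrite (memN_msupp_eq0 ms) big_seq_cond big1 ?mulr0 ?subrr => [|m' /andP[m's _]].
    exact: (is_ideal0 (is_ideal_of _)).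
  by case: eqP m's ms => [-> ->//|]; rewrite mulr0.
have ln : (k - d < n)%N by lia.
have tk l : (d <= l)%N -> take l s = s by move=> dl; rewrite take_oversize // s_size.
rewrite poly_seqX //; set j := Ordinal ln; split=> [hb|[c hc] m hm]; last first.
  have := hc m; rewrite mcoeffB coefXM hm ?eqxx ?subr0 ?tk //; last by rewrite subSn.
  - by apply=> i ik; apply: hm; rewrite subSn // ltnW.
  - exact: leqW.
(* The quotient by X_j of the part of [b] made of the monomials divisible by X_j. *)
pose c : B := \sum_(m <- msupp b) (if m j == 0%N then 0 else b@_m) *: 'X_[m - U_(j)].
have cE (m : 'X_{1..n}) : m j != 0%N -> c@_(m - U_(j)) = b@_m.
  move=> mj; rewrite raddf_sum /=.
  under eq_bigr do rewrite mcoeffZ mcoeffX.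
  have subU_inj (m' : 'X_{1..n}) : m' j != 0%N -> (m' - U_(j))%MM = (m - U_(j))%MM -> m' = m.
    by move=> mj' E; rewrite -(submK (m := U_(j)) (m' := m')) ?E ?submK // lep1mP.
  have [ms|ms] := boolP (m \in msupp b).
    rewrite (bigD1_seq m) ?msupp_uniq //= (negPf mj) eqxx mulr1 big1 ?addr0 // => m' mm'.
    case: eqP => [|/eqP mj']; first by rewrite mul0r.
    by case: ((m' - U_(j))%MM =P (m - U_(j))%MM) mm' => [/(subU_inj _ mj') ->|]; rewrite ?eqxx ?mulr0.
  rewrite (memN_msupp_eq0 ms) big_seq_cond big1 // => m' /andP[m's _].
  case: eqP => [|/eqP mj']; first by rewrite mul0r.
  by case: ((m' - U_(j))%MM =P (m - U_(j))%MM) m's => [/(subU_inj _ mj') ->|]; rewrite ?(negPf ms) ?mulr0.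
exists c => m hm; rewrite mcoeffB coefXM tk //.
case: eqP => [mj|/eqP mj]; last by rewrite cE // subrr; exact: ideal_span0.
rewrite subr0 -(tk k.+1 (leqW dk)); apply: hb => i; rewrite subSn // ltnS leq_eqVlt.
by case/orP => [/eqP ij|]; [rewrite (_ : i = j) //; apply: val_inj | exact: hm].
Qed.

Lemma poly_seq_reg k b : (k < d + n)%N ->
  poly_seq_ideal k (poly_seq k * b) -> poly_seq_ideal k b.
Proof.
move=> kdn; have [kd|dk] := ltnP k d.
  rewrite /poly_seq kd => hb m hm; apply: s_reg => //.
  by have := hb m hm; rewrite mcoeffCM.
have ln : (k - d < n)%N by lia.
rewrite poly_seqX // => hb m hm; set j := Ordinal ln in hb.
have := hb (m + U_(j))%MM; rewrite coefXM mnmDE mnm1E eqxx addn1 /= addmK; apply=> i ik.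
by rewrite mnmDE hm // mnm1E -val_eqE /= gtn_eqF.
Qed.

End PolynomialRegular.

(** * Acyclicity of the symbol complex *)

Lemma prod_scaleXn (C : comNzRingType) n (v : 'I_n -> C) (w u : 'I_n -> nat) :
  \prod_j (v j *: 'X^(w j)) ^+ u j = (\prod_j v j ^+ u j) *: 'X^(\sum_j w j * u j).
Proof.
by under eq_bigr do rewrite exprZn -exprM; rewrite scaler_prod prodrXr.
Qed.

Lemma mpoly_lift (R C : comNzRingType) n (f : {rmorphism R -> C}) (v : 'I_n -> C) :
  exists h : {rmorphism {mpoly R[n]} -> C},
    (forall c, h c%:MP = f c) /\ (forall m, h 'X_[m] = \prod_j v j ^+ m j).
Proof.
by exists (mmap f v); split=> [c|m]; rewrite /= ?mmapC ?mmapX.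
Qed.

Lemma rmorphism_polyC (R C : comNzRingType) (f : {rmorphism R -> C}) :
  exists h : {rmorphism R -> {poly C}}, forall c, h c = (f c)%:P.
Proof. by exists (polyC \o f). Qed.

Section SymbolKoszul.
Variables (K : numFieldType) (d n : nat) (A : 'M[int]_(d, n)).
Variables (S : comNzRingType) (tc : {rmorphism K -> S}) (tv : 'I_n -> S).
Local Notation B := {mpoly S[n]}.

Hypothesis tv_congr : forall u v : 'I_n -> nat,
  (forall i, \sum_j A i j * (u j)%:Z = \sum_j A i j * (v j)%:Z) ->
  \prod_j tv j ^+ u j = \prod_j tv j ^+ v j.
Hypothesis S_gen : forall P : S -> Prop,
  (forall c, P (tc c)) -> (forall j, P (tv j)) ->
  (forall a b, P a -> P b -> P (a + b)) -> (forall a b, P a -> P b -> P (a * b)) ->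
  forall s, P s.

Definition poly_var (j : 'I_n) : B := (tv j)%:MP.

Definition toric_symbol (i : 'I_d) : B := euler_symbol A poly_var (fun j => 'X_j) i.

Lemma poly_var_congr (u v : 'I_n -> nat) :
  (forall i, \sum_j A i j * (u j)%:Z = \sum_j A i j * (v j)%:Z) ->
  \prod_j poly_var j ^+ u j = \prod_j poly_var j ^+ v j.
Proof.
have E (y : 'I_n -> nat) : \prod_j poly_var j ^+ y j = (\prod_j tv j ^+ y j)%:MP.
  by rewrite rmorph_prod; apply: eq_bigr => j _; rewrite rmorphXn.
by move=> /tv_congr uv; rewrite !E uv.
Qed.

Let io : {rmorphism K -> B} := (@mpolyC n S \o tc).

Lemma toric_poly_gen (P : B -> Prop) :
  (forall c, P (io c)) -> (forall j, P (poly_var j)) -> (forall j, P 'X_j) ->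
  (forall a b, P a -> P b -> P (a + b)) -> (forall a b, P a -> P b -> P (a * b)) ->
  forall b, P b.
Proof.
move=> PC Pt PX PD PM; elim/mpoly_ring_gen => // s.
elim/S_gen: s => [c|j|a b ha hb|a b ha hb].
- exact: PC.
- exact: Pt.
- by rewrite rmorphD; apply: PD.
by rewrite rmorphM; apply: PM.
Qed.

Variable cls : {mpoly K[n]} -> S.
Hypothesis cls_const : forall a, cls a%:MP = tc a.
Hypothesis cls_var : forall j, cls 'X_j = tv j.
Hypothesis S_lift : forall (C : comNzRingType) (h : {rmorphism {mpoly K[n]} -> C}),
  (forall p, toric_binomial A p -> h p = 0) ->
  exists g : {rmorphism S -> C}, forall p, g (cls p) = h p.

Variables (wt wx : 'I_n -> nat) (c : nat).
Hypothesis wt_congr : forall u v : 'I_n -> nat,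
  (forall i, \sum_j A i j * (u j)%:Z = \sum_j A i j * (v j)%:Z) ->
  (\sum_j wt j * u j = \sum_j wt j * v j)%N.
Hypothesis wx_gt0 : forall j, (0 < wx j)%N.
Hypothesis wxt : forall j, (wx j + wt j)%N = c.

Lemma toric_grading_morphism : exists h : {rmorphism S -> {poly S}},
  (forall a, h (tc a) = (tc a)%:P) /\ forall j, h (tv j) = tv j *: 'X^(wt j).
Proof.
have [cP cPE] := rmorphism_polyC tc.
have [h0 [h0C h0M]] := mpoly_lift cP (fun j => tv j *: 'X^(wt j)).
have h0X (m : 'X_{1..n}) : h0 'X_[m] =
    (\prod_j tv j ^+ m j) *: 'X^(\sum_j wt j * m j) by rewrite h0M prod_scaleXn.
have [|h hE] := S_lift (h := h0).
  move=> p [u [Au ->]]; rewrite rmorphB !h0X; apply/eqP; rewrite subr_eq0.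
  have uv i : \sum_j A i j * (mnm_plus u j)%:Z = \sum_j A i j * (mnm_minus u j)%:Z.
    apply/eqP; rewrite -subr_eq0 -sumrB.
    have := congr1 (fun M : 'cV_d => M i 0) Au; rewrite !mxE => E; rewrite -[X in _ == X]E.
    by apply/eqP/eq_bigr => j _; rewrite -mulrBr mnm_plusB.
  by rewrite (tv_congr uv) (wt_congr uv).
exists h; split=> [a|j]; first by rewrite -cls_const hE h0C cPE cls_const.
rewrite -cls_var hE h0M (bigD1 j) //= mnm1E eqxx expr1 big1 ?mulr1 ?cls_var // => k kj.
by rewrite mnm1E eq_sym (negPf kj).
Qed.

(** The morphism [alpha] multiplies each variable by a power of the grading parameter; evaluation at
    1 sums the components and gives the element back. *)
Lemma toric_poly_grading : exists alpha : {rmorphism B -> {poly B}},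
  [/\ forall a, alpha (io a) = (io a)%:P,
      forall j, homogeneous alpha (wt j) (poly_var j),
      forall j, homogeneous alpha (wx j) 'X_j
    & forall b, (alpha b).[1] = b].
Proof.
have [h [h_const h_var]] := toric_grading_morphism.
pose alpha : {rmorphism B -> {poly B}} :=
  mmap (map_poly (@mpolyC n S) \o h) (fun j => ('X_j : B) *: 'X^(wx j)).
have aC a : alpha a%:MP = map_poly (@mpolyC n S) (h a) by rewrite /alpha /= mmapC.
have aX j : alpha 'X_j = 'X_j *: 'X^(wx j) by rewrite /alpha /= mmapX mmap1U.
have at_ j : alpha (poly_var j) = poly_var j *: 'X^(wt j).
  by rewrite aC h_var map_polyZ map_polyXn.
have ac a : alpha (io a) = (io a)%:P by rewrite aC h_const map_polyC.
exists alpha; split=> //; elim/toric_poly_gen => [a|j|j|a b ha hb|a b ha hb].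
- by rewrite ac hornerC.
- by rewrite at_ hornerZ hornerXn expr1n mulr1.
- by rewrite aX hornerZ hornerXn expr1n mulr1.
- by rewrite rmorphD hornerD ha hb.
by rewrite rmorphM hornerM ha hb.
Qed.

Variable s : seq S.
Hypothesis s_size : size s = d.
Hypothesis s_var : forall i, (i < d)%N ->
  s`_i \in ideal_span (fun g => exists2 j, (0 < wt j)%N & g = tv j).
Hypothesis s_reg : forall i, (i < d)%N -> forall a, s`_i * a \in ideal_of (take i s) ->
  a \in ideal_of (take i s).

Theorem symbol_koszul_acyclic : ring_koszul_acyclic toric_symbol.
Proof.
have [alpha [ac at_ aX a1]] := toric_poly_grading.
have ae i : homogeneous alpha c (toric_symbol i).
  rewrite /homogeneous /toric_symbol /euler_symbol rmorph_sum scaler_suml.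
  apply: eq_bigr => j _; rewrite !rmorphM rmorph_int at_ aX.
  rewrite !mulrzl -scalerMzl; congr (_ *~ _).
  by rewrite -scalerAl -scalerAr scalerA -exprD wxt.
have [D [g [D0 gD gx gt]]] := hsop_exists poly_var_congr toric_poly_gen ac ae at_ aX wx_gt0.
pose r (i : 'I_(d + n)) : B := match split i with inl i => toric_symbol i | inr j => g j end.
have rl i : r (lshift n i) = toric_symbol i by rewrite /r (unsplitK (inl i)).
have rr j : r (rshift d j) = g j by rewrite /r (unsplitK (inr j)).
have -> : toric_symbol = (fun i => r (lshift n i)) by apply/funext => i; rewrite rl.
apply: ring_koszul_acyclic_lshift.
pose wr (i : 'I_(d + n)) := if split i is inl _ then c else D.
apply: (koszul_acyclic_upto_le (alpha := alpha) (wt := wr)).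
- move=> i; rewrite /wr /r; case: (split i) => j; [exact: ae | exact: gD].
- exact: a1.
- exact: leq_addr.
- by move=> i di; rewrite /wr; case: splitP => // j ij; move: (ltn_ord j); rewrite -ij ltnNge di.
have iR : is_ideal (in_rad (fun b => b \in ideal_span (fun b => exists i, b = r i))).
  exact/is_ideal_rad/is_ideal_span.
have euler_r b : in_rad (euler_ideal A poly_var (fun j => 'X_j) g) b ->
    in_rad (fun b => b \in ideal_span (fun b => exists i, b = r i)) b.
  move=> [N bN]; exists N; apply: ideal_span_mono bN => y [[i ->]|[j ->]];
    apply: ideal_span_mem; [exists (lshift n i) | exists (rshift d j)].
    by rewrite rl.
  by rewrite rr.
apply: (koszul_acyclicity (f := poly_seq n d s) (J := poly_seq_ideal d s)).
- exact: poly_seq_ideal0.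
- exact: is_ideal_poly_seq.
- by move=> k b kdn; apply: poly_seq_idealS.
- by move=> k b kdn; apply: poly_seq_reg.
move=> k kdn; rewrite /poly_seq; case: ifP => kd; last first.
  case: insubP => [j _ _|_]; first exact/euler_r/gx.
  by exists 1%N; rewrite expr1; apply: ideal_span0.
have := s_var kd; elim/ideal_span_ind => [|a b ha hb|a y [j jA ->]].
- by rewrite rmorph0; apply: (is_ideal0 iR).
- by rewrite rmorphD; apply: (is_idealD iR).
rewrite rmorphM; apply: (is_idealM iR); exact/euler_r/gt.
Qed.

End SymbolKoszul.

Section ToricKoszul.
Variables (K : numFieldType) (d n : nat) (A : 'M[int]_(d, n)).
Local Notation S := (toric_ring K A).
Local Notation cls := (\pi_S : {mpoly K[n]} -> S).
Local Notation tc := (toric_const K A).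

Theorem toric_koszul_acyclic : positive_semigroup A ->
  (forall v : 'cV[int]_d, in_ZA A v) -> cohen_macaulay S ->
  ring_koszul_acyclic (toric_symbol A (toric_var K A)).
Proof.
move=> A_pos A_full CM.
have [l l_pos] := positive_functional A_pos.
have [s [sd sI sreg]] := toric_regular_sequence l_pos A_full CM.
(* The constant [c] exceeds each weight of t, so that the complementary weights c - wt j of the x_j
   are positive. *)
pose wt := toric_weight A l; pose c := (\sum_j wt j).+1.
have wc j : (wt j < c)%N by rewrite /c ltnS (bigD1 j) //= leq_addr.
have wtA (u : 'I_n -> nat) :
    (\sum_j wt j * u j)%N%:Z = \sum_i l i * \sum_j A i j * (u j)%:Z.
  under [RHS]eq_bigr do rewrite mulr_sumr.
  rewrite exchange_big (big_morph Posz PoszD (erefl _)); apply: eq_bigr => j _ /=.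
  rewrite PoszM gez0_abs; first by rewrite mulr_suml; apply: eq_bigr => i _; rewrite mulrA.
  have [/colP j0|/l_pos/ltW //] := eqVneq (col j A) 0.
  by rewrite /dot big1 // => i _; have := j0 i; rewrite !mxE => ->; rewrite mulr0.
refine (@symbol_koszul_acyclic K d n A S tc (toric_var K A) (@toric_var_congr K d n A)
  (@toric_ring_gen K d n A) cls _ _ (@toric_lift K d n A) wt (fun j => c - wt j)%N c
  _ _ _ s sd _ sreg).
- by move=> a; rewrite toric_constE.
- by [].
- move=> u v uv; suff: (\sum_j wt j * u j)%N%:Z = (\sum_j wt j * v j)%N%:Z by case.
  by rewrite !wtA; apply: eq_bigr => i _; rewrite uv.
- by move=> j; rewrite subn_gt0.
- by move=> j; rewrite subnK // ltnW.
move=> i id; apply: ideal_span_mono (sI i id) => g [j jA ->].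
by apply: ideal_span_mem; exists j => //; rewrite toric_weight_gt0.
Qed.

End ToricKoszul.

(** * The filtration by degree in x *)

Section Filtration.
Variables (S : comNzRingType) (n d : nat).
Local Notation B := {mpoly S[n]}.
Variables (e : 'I_d -> B) (D : nzRingType) (V : lmodType D) (phi : 'I_d -> V -> V).
Variables (Theta : B -> V) (Psi : V -> B).
Hypothesis ThetaD : {morph Theta : a b / a + b}.
Hypotheses (ThetaK : cancel Theta Psi) (PsiK : cancel Psi Theta).
Hypothesis phi_lin : forall i, linear (phi i).
Hypothesis phi_comm : forall i j v, phi i (phi j v) = phi j (phi i v).
Hypothesis e_homog0 : forall i b, pihomog mdeg 0 (e i * b) = 0.
Hypothesis e_homogS : forall i k b,
  pihomog mdeg k.+1 (e i * b) = e i * pihomog mdeg k b.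
Hypothesis phi_symbol : forall i k b, (msize b <= k)%N ->
  exists2 b' : B, (msize b' <= k)%N & phi i (Theta b) = Theta (e i * b + b').

Local Notation chain := {ffun {set 'I_d} -> B^o}.
Local Notation kz := (ring_koszul e).

Let Theta0 : Theta 0 = 0.
Proof. by apply: (addrI (Theta 0)); rewrite -ThetaD !addr0. Qed.

Let ThetaN b : Theta (- b) = - Theta b.
Proof. by apply/eqP; rewrite -addr_eq0 -ThetaD addNr Theta0. Qed.

Let Theta_sum (I : Type) (s : seq I) (P : pred I) (F : I -> B) :
  Theta (\sum_(i <- s | P i) F i) = \sum_(i <- s | P i) Theta (F i).
Proof. exact: (big_morph Theta ThetaD Theta0). Qed.

Let Theta_sign k b : Theta ((-1) ^+ k * b) = (-1) ^+ k *: Theta b.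
Proof.
elim: k => [|k IHk]; first by rewrite !expr0 mul1r scale1r.
by rewrite !exprS -scalerA -IHk scaleN1r -ThetaN mulN1r mulNr.
Qed.

Let phiD i : {morph phi i : u v / u + v}.
Proof. by move=> u v; rewrite -[u]scale1r phi_lin !scale1r. Qed.

Let lift_chain (z : chain) : koszul_chain V d := [ffun T : {set 'I_d} => Theta (z T)].

Let diffD : {morph koszul_diff phi : z w / z + w}.
Proof.
move=> z w; apply/ffunP => T; rewrite !ffunE -big_split; apply: eq_bigr => i _.
by rewrite /= !ffunE phiD scalerDr.
Qed.

Let lift_diff k (z : chain) : (forall T, msize (z T) <= k)%N ->
  exists2 z' : chain, (forall T, msize (z' T : B) <= k)%N &
    koszul_diff phi (lift_chain z) = lift_chain (kz z + z').
Proof.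
move=> zk; have /boolp.choice [b bP] (x : {set 'I_d} * 'I_d) : exists b' : B,
    (msize b' <= k)%N /\ phi x.2 (Theta (z (x.2 |: x.1))) = Theta (e x.2 * z (x.2 |: x.1) + b').
  by have [b' bk bE] := phi_symbol x.2 (zk (x.2 |: x.1)); exists b'.
exists [ffun T : {set 'I_d} => \sum_(i | i \notin T) koszul_sign B i T * b (T, i) : B^o].
  move=> T; rewrite ffunE; apply: leq_trans (msize_sum _ _ _) _.
  apply/bigmax_leqP => i _; rewrite /koszul_sign.
  have [bk _] := bP (T, i); rewrite -signr_odd; case: odd; last by rewrite mul1r.
  by rewrite mulN1r msizeN.
apply/ffunP => T; rewrite !ffunE -big_split Theta_sum; apply: eq_bigr => i iT /=.
have [_ bE] := bP (T, i); rewrite ffunE /= bE /koszul_sign -Theta_sign.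
by rewrite mulrDr.
Qed.

Let pichain k (z : chain) : chain := [ffun T : {set 'I_d} => pihomog mdeg k (z T : B) : B^o].

Let pichain_kz k z : pichain k.+1 (kz z) = kz (pichain k z).
Proof.
apply/ffunP => T; rewrite ffunE !ring_koszulE raddf_sum; apply: eq_bigr => i _ /=.
rewrite ffunE /koszul_sign -signr_odd; case: odd; last by rewrite !mul1r e_homogS.
by rewrite !mulN1r raddfN /= e_homogS.
Qed.

Let pichain0_kz z : pichain 0 (kz z) = 0.
Proof.
apply/ffunP => T; rewrite !ffunE raddf_sum big1 // => i _ /=.
rewrite /GRing.scale /= /koszul_sign -signr_odd; case: odd; last by rewrite mul1r e_homog0.
by rewrite mulN1r raddfN /= e_homog0 oppr0.
Qed.

Let pihomog_ge k (b : B) : (msize b <= k)%N -> pihomog mdeg k b = 0.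
Proof.
move=> bk; rewrite pihomogE big_seq_cond big1 // => m /andP[ms /eqP mk].
by have := leq_trans (msize_mdeg_lt ms) bk; rewrite mk ltnn.
Qed.

Let pihomog_size k (b : B) : (msize (pihomog mdeg k b) <= k.+1)%N.
Proof.
rewrite pihomogE; apply: leq_trans (msize_sum _ _ _) _.
apply/bigmax_leqP_seq => m _ /eqP mk; apply: leq_trans (msizeZ_le _ _) _.
by rewrite msizeX mk.
Qed.

Let pihomog_sub k (b : B) : (msize b <= k.+1)%N -> (msize (b - pihomog mdeg k b) <= k)%N.
Proof.
move=> bk; rewrite {1}(pihomog_partitionE bk) big_ord_recr /= addrK.
apply: leq_trans (msize_sum _ _ _) _; apply/bigmax_leqP => i _.
exact: leq_trans (pihomog_size _ _) _.
Qed.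

Let lift_inj z w : lift_chain z = lift_chain w -> z = w.
Proof.
move=> E; apply/ffunP => T; apply: (can_inj ThetaK).
by have := congr1 (fun f : koszul_chain V d => f T) E; rewrite !ffunE.
Qed.

Let lift_deg p z : koszul_deg p (lift_chain z) <-> koszul_deg p z.
Proof.
split=> h T; have := h T; rewrite ffunE; first by rewrite -Theta0 (can_eq ThetaK).
by rewrite -[in Theta _ != _]Theta0 (can_eq ThetaK).
Qed.

(* The top component of a cycle in the [x]-degree filtration is a cycle of the
   associated graded complex [kz], hence a boundary, and can be removed. *)
Theorem filtered_koszul_homology_zero p : (0 < p)%N ->
  ring_koszul_acyclic e -> koszul_homology_zero phi p.
Proof.
move=> p0 ac.
suff main k (z : chain) : koszul_deg p z -> (forall T, msize (z T : B) <= k)%N ->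
    koszul_diff phi (lift_chain z) = 0 ->
    exists2 w, koszul_deg p.+1 w & koszul_diff phi w = lift_chain z.
  move=> Z Zp dZ; pose z : chain := [ffun T : {set 'I_d} => Psi (Z T) : B^o].
  have zZ : lift_chain z = Z by apply/ffunP => T; rewrite !ffunE PsiK.
  rewrite -zZ; apply: (main (\max_T msize (z T : B))).
  - by apply/lift_deg; rewrite zZ.
  - by move=> T; apply: (leq_bigmax (F := fun T => msize (z T : B))).
  by rewrite zZ.
elim: k z => [|k IHk] z zp zk dz.
  exists 0; first by move=> T; rewrite ffunE eqxx.
  have -> : z = 0.
    by apply/ffunP => T; have := zk T; rewrite leqn0 msize_poly_eq0 ffunE => /eqP.
  apply/ffunP => T; rewrite !ffunE Theta0 big1 // => i _.
  rewrite ffunE (_ : phi i 0 = 0) ?scaler0 //.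
  by apply: (addrI (phi i 0)); rewrite -phiD !addr0.
have [z' z'k dzE] := lift_diff zk.
have dzN : kz z = - z'.
  apply/eqP; rewrite -addr_eq0; apply/eqP/lift_inj; rewrite -dzE dz.
  by apply/ffunP => T; rewrite !ffunE Theta0.
have dzk : kz (pichain k z) = 0.
  rewrite -pichain_kz dzN; apply/ffunP => T; rewrite !ffunE raddfN /= pihomog_ge ?oppr0 //.
have zkp : koszul_deg p (pichain k z).
  move=> T; rewrite ffunE => h; apply: zp; apply: contraNneq h => ->.
  by rewrite raddf0.
have [w wp dw] := ac _ _ p0 zkp dzk.
(* The symbols are linear in x, so the component of [w] of x-degree k - 1 already has the required
   boundary. For k = 0 the boundary has no component of degree 0, hence is zero, and w0 = 0
   suffices. *)
have [w0 [w0p w0k dw0]] : exists w0 : chain, [/\ koszul_deg p.+1 w0,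
    forall T, (msize (w0 T : B) <= k)%N & kz w0 = pichain k z].
  case: k {IHk zk z'k dzk zkp} dw => [|k] dw.
    exists 0; split=> [T|T|]; rewrite ?ffunE ?eqxx ?msize0 //.
    rewrite ring_koszul0 -(pichain0_kz w) dw.
    by apply/ffunP => T; rewrite !ffunE pihomog_id.
  exists (pichain k w); split=> [T|T|].
  - rewrite ffunE => h; apply: wp; apply: contraNneq h => ->.
    by rewrite raddf0.
  - by rewrite ffunE pihomog_size.
  rewrite -pichain_kz dw; apply/ffunP => T.
  by rewrite !ffunE pihomog_id.
have [w' w'k dw0E] := lift_diff w0k.
(* Subtracting the boundary of [w0] removes the top component of [z] at the cost of an error [w'] of
   lower x-degree, to which the induction hypothesis applies. *)
have decomp : lift_chain z = koszul_diff phi (lift_chain w0) + lift_chain (z - pichain k z - w').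
  rewrite dw0E dw0; apply/ffunP => T; rewrite !ffunE -ThetaD; congr Theta.
  have split_sum (a b c : B) : a = b + c + (a - b - c) by ring.
  exact: split_sum.
have w0p' : koszul_deg p.+1 (lift_chain w0) by apply/lift_deg.
have dw0p : koszul_deg p (koszul_diff phi (lift_chain w0)) by apply: koszul_diff_deg.
have [|||W Wp dW] := IHk (z - pichain k z - w').
- apply/lift_deg => T; have := congr1 (fun f : koszul_chain V d => f T) decomp.
  rewrite [RHS]ffunE => E; have [//|Tp] := eqVneq #|T| p; apply: contraNeq => _.
  have z0 : lift_chain z T = 0 by apply: contraNeq Tp => h; apply/eqP/(lift_deg p z).2.
  have d0 : koszul_diff phi (lift_chain w0) T = 0 by apply: contraNeq Tp => /dw0p ->.
  by move: E; rewrite z0 d0 add0r => <-.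
- move=> T; rewrite !ffunE; apply: leq_trans (msizeD_le _ _) _.
  by rewrite geq_max msizeN w'k pihomog_sub.
- move: dz; rewrite decomp diffD koszul_diffK //; by rewrite add0r.
exists (lift_chain w0 + W); last by rewrite diffD dW decomp.
move=> T; rewrite ffunE; have [w0T|/w0p' //] := eqVneq (lift_chain w0 T) 0.
by rewrite w0T add0r => /Wp.
Qed.

End Filtration.

(** * Total symbols in the Weyl algebra *)

Section MonomialSum.
Variables (R : nzRingType) (n : nat) (V : zmodType) (phi : 'X_{1..n} -> R -> V).
Hypothesis phiD : forall m, {morph phi m : a b / a + b}.

Definition monomial_sum (p : {mpoly R[n]}) : V := \sum_(m <- msupp p) phi m p@_m.

Let phi0 m : phi m 0 = 0.
Proof. by apply: (addrI (phi m 0)); rewrite -phiD !addr0. Qed.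

Let monomial_sum_wide (s : seq 'X_{1..n}) p : uniq s -> {subset msupp p <= s} ->
  monomial_sum p = \sum_(m <- s) phi m p@_m.
Proof.
move=> us ps; rewrite [RHS](bigID (fun m => m \in msupp p)) /= [X in _ + X]big1 ?addr0.
  rewrite -[RHS]big_filter; apply: perm_big; apply: uniq_perm => [||m].
  - exact: msupp_uniq.
  - exact: filter_uniq.
  by rewrite mem_filter; case: (boolP (m \in msupp p)) => //= /ps.
by move=> m /memN_msupp_eq0 ->.
Qed.

Lemma monomial_sumD : {morph monomial_sum : p q / p + q}.
Proof.
move=> p q; pose s := undup (msupp p ++ msupp q ++ msupp (p + q)).
have us : uniq s by exact: undup_uniq.
rewrite !(monomial_sum_wide us) -?big_split; last first.
- by move=> m mp; rewrite mem_undup !mem_cat mp ?orbT.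
- by move=> m mp; rewrite mem_undup !mem_cat mp ?orbT.
- by move=> m mp; rewrite mem_undup !mem_cat mp ?orbT.
by apply: eq_bigr => m _; rewrite mcoeffD phiD.
Qed.

Lemma monomial_sum0 : monomial_sum 0 = 0.
Proof. by rewrite /monomial_sum msupp0 big_nil. Qed.

Lemma monomial_sumZX c m : monomial_sum (c *: 'X_[m]) = phi m c.
Proof.
have [->|c0] := eqVneq c 0; first by rewrite scale0r monomial_sum0 phi0.
rewrite (@monomial_sum_wide [:: m]) // ?big_seq1 ?mcoeffZ ?mcoeffX ?eqxx ?mulr1 //.
by move=> k /msuppZ_le; rewrite msuppX.
Qed.

End MonomialSum.

Section WeylNormalForm.
Variables (K : numFieldType) (n : nat).
Local Notation Kx := {mpoly K[n]}.
(* Total symbols: the outer variables stand for the derivations, which act before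
   the multiplication by the coefficients in [Kx]. *)
Local Notation sym := {mpoly Kx[n]}.

Definition symbol_op (q : sym) (f : Kx) : Kx :=
  monomial_sum (fun g (a : Kx) => a * f^`M[g]) q.

Lemma symbol_opD q r f : symbol_op (q + r) f = symbol_op q f + symbol_op r f.
Proof. by apply: monomial_sumD => m a b; exact: mulrDl. Qed.

Lemma symbol_op0 f : symbol_op 0 f = 0.
Proof. exact: monomial_sum0. Qed.

Lemma symbol_opZX a g f : symbol_op (a *: 'X_[g]) f = a * f^`M[g].
Proof. by apply: monomial_sumZX => m b c; exact: mulrDl. Qed.

Lemma symbol_opC a f : symbol_op a%:MP f = a * f.
Proof. by rewrite -[a%:MP]mulr1 mul_mpolyC -mpolyX0 symbol_opZX mderivm0m. Qed.

Lemma symbol_opZ a q f : symbol_op (a%:MP * q) f = a * symbol_op q f.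
Proof.
elim/mpolyind: q => [|c m q _ _ IHq]; first by rewrite mulr0 !symbol_op0 mulr0.
rewrite mulrDr !symbol_opD IHq mulrDr; congr (_ + _).
by rewrite mul_mpolyC scalerA !symbol_opZX mulrA.
Qed.

Lemma symbol_opMX q j f : symbol_op (q * 'X_j) f = symbol_op q f^`M(j).
Proof.
elim/mpolyind: q => [|c m q _ _ IHq]; first by rewrite mul0r !symbol_op0.
rewrite mulrDl !symbol_opD IHq; congr (_ + _).
by rewrite -scalerAl -mpolyXD !symbol_opZX addmC mderivmDm mderivmU1m.
Qed.

Lemma symbol_op_deriv q j : exists q', forall f, (symbol_op q f)^`M(j) = symbol_op q' f.
Proof.
elim/mpolyind: q => [|c m q _ _ [q' IHq]].
  by exists 0 => f; rewrite !symbol_op0 mderiv0.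
exists (c^`M(j) *: 'X_[m] + c *: 'X_[m + U_(j)] + q') => f.
rewrite !symbol_opD -IHq mderivD !symbol_opZX mderivM; congr (_ + _ * _ + _).
by rewrite mderivmDm mderivmU1m.
Qed.

Lemma weyl_symbol_ex (P : weyl K n) : exists q, forall f, P f = symbol_op q f.
Proof.
(* Every operator, composed on the left with one in normal form, again has a normal form; this is
   applied to the identity, whose symbol is 1. *)
suff [q qP] : exists q, forall f, P (symbol_op 1 f) = symbol_op q f.
  by exists q => f; rewrite -qP -mpolyC1 symbol_opC mul1r.
case: P => P /= wP; elim: wP 1 => {P} [c|j|j|P Q _ IHP _ IHQ|P Q _ IHP _ IHQ] q.
- by exists ((c%:MP)%:MP * q) => f; rewrite symbol_opZ mul_mpolyC.
- by exists (('X_j)%:MP * q) => f; rewrite symbol_opZ.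
- exact: symbol_op_deriv.
- have [q1 h1] := IHP q; have [q2 h2] := IHQ q.
  by exists (q1 + q2) => f; rewrite symbol_opD h1 h2.
have [q1 h1] := IHQ q; have [q2 h2] := IHP q1.
by exists q2 => f; rewrite h1 h2.
Qed.

(** The operator is tested on x^g, with g of least degree in the support of the symbol. All other
    derivatives that occur annihilate x^g, and what remains is g! times the coefficient at g, where
    g! is nonzero in characteristic 0. *)
Lemma symbol_op_inj0 q : (forall f, symbol_op q f = 0) -> q = 0.
Proof.
move=> q0; apply/eqP; apply: contraT => qn0.
have [g gq gmin] : exists2 g, g \in msupp q & forall h, h \in msupp q -> (mdeg g <= mdeg h)%N.
  have ex : exists k, has (fun g => mdeg g == k) (msupp q).
    case E: (msupp q) => [|g s]; first by move: qn0; rewrite -msupp_eq0 E.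
    by exists (mdeg g); rewrite /= eqxx.
  case: (ex_minnP ex) => k /hasP[g gq /eqP gk] kmin; exists g => // h hq.
  by rewrite gk; apply: kmin; apply/hasP; exists h.
have := q0 'X_[g]; rewrite /symbol_op /monomial_sum (bigD1_seq g) ?msupp_uniq //=.
rewrite big_seq_cond big1 ?addr0 => [|h /andP[hq hg]]; last first.
  rewrite mderivmX; have [/forallP hle|] := boolP [forall i, (h i <= g i)%N].
    have : mdeg h == mdeg g by rewrite eqn_leq gmin // andbT !mdegE leq_sum.
    rewrite !mdegE => /eqP E; case/eqP: hg; apply/mnmP => i; apply/eqP.
    rewrite eqn_leq hle /= leqNgt; apply/negP => hi.
    suff: (\sum_j h j < \sum_j g j)%N by rewrite E ltnn.
    rewrite (bigD1 i) //= [X in (_ < X)%N](bigD1 i) //=.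
    by rewrite -addSn leq_add // leq_sum.
  case/forallPn => i; rewrite -ltnNge => hi.
  by rewrite (bigD1 i) //= ffact_small // mul0n scale0r mulr0.
rewrite mderivmX (_ : g - g = 0)%MM; last by rewrite -{1}[g]add0m addmK.
move/eqP; rewrite mpolyX0 -mul_mpolyC mulr1 mulrC mul_mpolyC.
rewrite scaler_eq0 pnatr_eq0 => /orP[|qg]; last by move: gq; rewrite mcoeff_msupp qg.
rewrite -leqn0 leqNgt => /negP; case.
by rewrite prodn_gt0 // => i; rewrite ffact_gt0.
Qed.

Lemma symbol_op_inj q r : (forall f, symbol_op q f = symbol_op r f) -> q = r.
Proof.
move=> qr; apply/eqP; rewrite -subr_eq0; apply/eqP/symbol_op_inj0 => f.
rewrite symbol_opD qr -symbol_opD subrr; exact: symbol_op0.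
Qed.

Definition weyl_symbol (P : weyl K n) : sym := projT1 (cid (weyl_symbol_ex P)).

Lemma weyl_symbolP (P : weyl K n) f : P f = symbol_op (weyl_symbol P) f.
Proof. exact: (projT2 (cid (weyl_symbol_ex P))). Qed.

Lemma weyl_symbol_eq (P : weyl K n) q : (forall f, P f = symbol_op q f) -> weyl_symbol P = q.
Proof. by move=> Pq; apply: symbol_op_inj => f; rewrite -weyl_symbolP. Qed.

Lemma weyl_symbolD P Q : weyl_symbol (P + Q) = weyl_symbol P + weyl_symbol Q.
Proof. by apply: weyl_symbol_eq => f; rewrite symbol_opD -!weyl_symbolP. Qed.

Lemma weyl_symbolZ c P : weyl_symbol (c *: P) = (c%:MP)%:MP * weyl_symbol P.
Proof. by apply: weyl_symbol_eq => f; rewrite symbol_opZ -weyl_symbolP mul_mpolyC. Qed.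

Lemma weyl_symbolMd P j : weyl_symbol (P * wd K j) = weyl_symbol P * 'X_j.
Proof. by apply: weyl_symbol_eq => f; rewrite symbol_opMX -weyl_symbolP. Qed.

Definition weyl_mono (m : 'X_{1..n}) : weyl K n := mmap1 (@wx K n) m.

Lemma weyl_monoE m f : weyl_mono m f = 'X_[m] * f.
Proof.
rewrite mpolyXE_id /weyl_mono /mmap1; elim: (index_enum _) f => [|i s IHs] f.
  by rewrite !big_nil /= scale1r mul1r.
rewrite !big_cons /= IHs -!mulrA; move: (_ * f) => g.
elim: (m i) g => [|k IHk] g; first by rewrite !expr0 /= scale1r mul1r.
by rewrite !exprS /= IHk mulrA.
Qed.

Lemma weyl_symbol_mono m : weyl_symbol (weyl_mono m) = ('X_[m])%:MP.
Proof. by apply: weyl_symbol_eq => f; rewrite symbol_opC weyl_monoE. Qed.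

Lemma wx_mono j m : wx K j * weyl_mono m = weyl_mono (m + U_(j)).
Proof.
by apply: weyl_eq => f /=; rewrite !weyl_monoE mulrA mpolyXD [_ * 'X_j]mulrC.
Qed.

Lemma mono_wx j m : weyl_mono m * wx K j = weyl_mono (m + U_(j)).
Proof. by apply: weyl_eq => f /=; rewrite !weyl_monoE mulrA mpolyXD. Qed.

Lemma weyl_mono0 : weyl_mono 0 = 1.
Proof. by apply: weyl_eq => f; rewrite weyl_monoE mpolyX0 mul1r /= scale1r. Qed.

Lemma wd_mono j m :
  wd K j * weyl_mono m = weyl_mono m * wd K j + (m j)%:R *: weyl_mono (m - U_(j)).
Proof.
apply: weyl_eq => f /=; rewrite !weyl_monoE mderivM mderivX addrC.
by rewrite -scalerAl.
Qed.

End WeylNormalForm.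

(** * The Euler-Koszul complex *)

Section SymbolPoly.
Variables (K : numFieldType) (n : nat) (S : comNzRingType).
Variables (tc : {rmorphism K -> S}) (v : 'I_n -> S).
Local Notation RA := {mpoly K[n]}.
Local Notation B := {mpoly S[n]}.
Local Notation mon m := (\prod_j v j ^+ m%MM j).

(** For an operator P with total symbol [q], this is the element of S[x] that corresponds to the
    tensor of P and [s]: each derivation, standing on the right, acts on [s] as multiplication by
    its image [v j]. *)
Definition symbol_poly (q : {mpoly RA[n]}) (s : S) : B :=
  monomial_sum (fun g (a : RA) => map_mpoly tc a * (mon g * s)%:MP) q.

Lemma symbol_polyDl q r s : symbol_poly (q + r) s = symbol_poly q s + symbol_poly r s.
Proof. by apply: monomial_sumD => g a b; rewrite rmorphD; exact: mulrDl. Qed.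

Lemma symbol_polyZX a g s :
  symbol_poly (a *: 'X_[g]) s = map_mpoly tc a * (mon g * s)%:MP.
Proof. by apply: monomial_sumZX => g' b c; rewrite rmorphD; exact: mulrDl. Qed.

Lemma symbol_poly0 s : symbol_poly 0 s = 0.
Proof. exact: monomial_sum0. Qed.

Lemma symbol_polyDr q s s' : symbol_poly q (s + s') = symbol_poly q s + symbol_poly q s'.
Proof.
elim/mpolyind: q => [|c m q _ _ IHq]; first by rewrite !symbol_poly0 addr0.
rewrite !symbol_polyDl IHq addrACA; congr (_ + _).
by rewrite !symbol_polyZX -mulrDr -mpolyCD -mulrDr.
Qed.

Lemma symbol_polyC q c s : symbol_poly ((c%:MP)%:MP * q) s = symbol_poly q (tc c * s).
Proof.
elim/mpolyind: q => [|a m q _ _ IHq]; first by rewrite mulr0 !symbol_poly0.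
rewrite mulrDr !symbol_polyDl IHq; congr (_ + _).
rewrite mul_mpolyC scalerA !symbol_polyZX rmorphM /= map_mpolyC.
by rewrite [_ * map_mpoly _ a]mulrC -mulrA -mpolyCM mulrCA.
Qed.

Lemma symbol_polyMX q j s : symbol_poly (q * 'X_j) s = symbol_poly q (v j * s).
Proof.
elim/mpolyind: q => [|a m q _ _ IHq]; first by rewrite mul0r !symbol_poly0.
rewrite mulrDl !symbol_polyDl IHq; congr (_ + _).
rewrite -scalerAl -mpolyXD !symbol_polyZX mulrA; congr (_ * (_ * _)%:MP).
rewrite (eq_bigr (fun i => v i ^+ m i * v i ^+ (i == j))) => [|i _].
  rewrite big_split /=; congr (_ * _); rewrite (bigD1 j) //= eqxx expr1 big1 ?mulr1 //.
  by move=> i /negPf ->.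
by rewrite mnmDE mnm1E exprD eq_sym.
Qed.

Lemma symbol_polyX m s : symbol_poly ('X_[m])%:MP s = s *: 'X_[m].
Proof.
rewrite -[_%:MP]mulr1 mul_mpolyC -mpolyX0 symbol_polyZX map_mpolyX.
by rewrite big1 ?mul1r 1?mulrC ?mul_mpolyC // => j _; rewrite mnm0E.
Qed.

End SymbolPoly.

Lemma symbol_termE (S : comNzRingType) n (k : int) (t s : S) (j : 'I_n) m :
  k%:~R * ('X_j * t%:MP) * (s *: 'X_[m]) = (t * (k%:~R * s)) *: 'X_[m + U_(j)] :> {mpoly S[n]}.
Proof.
rewrite mpolyXD -!mul_mpolyC !mpolyCM rmorph_int; ring.
Qed.

Section SymbolFiltration.
Variables (S : comNzRingType) (d n : nat) (A : 'M[int]_(d, n)) (tv : 'I_n -> S).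
Local Notation B := {mpoly S[n]}.
Local Notation e := (toric_symbol A tv).

Let pihomogXE k (m : 'X_{1..n}) :
  pihomog mdeg k 'X_[S, m] = if mdeg m == k then 'X_[m] else 0.
Proof. exact: pihomogX. Qed.

Let pihomogXM j k (b : B) :
  pihomog mdeg 0 ('X_j * b) = 0 /\ pihomog mdeg k.+1 ('X_j * b) = 'X_j * pihomog mdeg k b.
Proof.
elim/mpolyind: b => [|s m b _ _ [IH0 IHS]]; first by rewrite mulr0 !raddf0 mulr0.
rewrite mulrDr !raddfD /= IH0 IHS addr0 mulrDr -scalerAr -mpolyXD !linearZ /= !pihomogXE.
rewrite mdegD mdeg1 add1n eqSS scaler0; split=> //; congr (_ + _).
by case: ifP => _; rewrite -scalerAr ?mpolyXD ?mulr0.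
Qed.

Let symbol_linear i (b : B) :
  e i * b = \sum_j 'X_j * (((A i j)%:~R * tv j)%:MP * b).
Proof.
rewrite /toric_symbol /euler_symbol mulr_suml; apply: eq_bigr => j _.
by rewrite /poly_var mpolyCM rmorph_int; ring.
Qed.

Lemma toric_symbol_pihomog0 i b : pihomog mdeg 0 (e i * b) = 0.
Proof.
rewrite symbol_linear raddf_sum big1 // => j _.
by have [] := pihomogXM j 0 (((A i j)%:~R * tv j)%:MP * b).
Qed.

Lemma toric_symbol_pihomogS i k b :
  pihomog mdeg k.+1 (e i * b) = e i * pihomog mdeg k b.
Proof.
rewrite !symbol_linear raddf_sum; apply: eq_bigr => j _ /=.
by rewrite (pihomogXM j k _).2 !mul_mpolyC linearZ.
Qed.

Variables (D : nzRingType) (V : lmodType D) (phi : 'I_d -> V -> V).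
Variables (Theta : B -> V) (Psi : V -> B).
Hypothesis ThetaD : {morph Theta : a b / a + b}.
Hypotheses (ThetaK : cancel Theta Psi) (PsiK : cancel Psi Theta).
Hypothesis phi_lin : forall i, linear (phi i).
Hypothesis phi_comm : forall i j v, phi i (phi j v) = phi j (phi i v).
Variable hom : S -> Prop.
Hypothesis hom_gen : forall s, exists2 r : seq S, (forall x, x \in r -> hom x) & s = \sum_(x <- r) x.
Hypothesis phi_mono : forall i s m, hom s -> exists c : S,
  phi i (Theta (s *: 'X_[m])) = Theta (e i * (s *: 'X_[m])) + Theta ((c * s) *: 'X_[m]).

(** It suffices to treat s x^m with [s] homogeneous, and there the error term has the same
    x-monomial. *)
Let phi_symbol i k (b : B) : (msize b <= k)%N ->
  exists2 b' : B, (msize b' <= k)%N & phi i (Theta b) = Theta (e i * b + b').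
Proof.
pose T b := exists2 b' : B, (msize b' <= k)%N & phi i (Theta b) = Theta (e i * b + b').
have phiD : {morph phi i : u v / u + v}.
  by move=> u v; rewrite -[u]scale1r phi_lin !scale1r.
have Theta0 : Theta 0 = 0 by apply: (addrI (Theta 0)); rewrite -ThetaD !addr0.
have T0 : T 0.
  exists 0; rewrite ?msize0 // mulr0 addr0 Theta0.
  by apply: (addrI (phi i 0)); rewrite -phiD !addr0.
have TD a c : T a -> T c -> T (a + c).
  move=> [a' ak aE] [c' ck cE]; exists (a' + c').
    by apply: leq_trans (msizeD_le _ _) _; rewrite geq_max ak.
  by rewrite ThetaD phiD aE cE -ThetaD mulrDr addrACA.
have TX s (m : 'X_{1..n}) : (mdeg m < k)%N -> T (s *: 'X_[m]).
  move=> mk; have [r rh ->] := hom_gen s.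
  rewrite scaler_suml big_seq; apply: big_ind => // x /rh xh.
  have [c cE] := phi_mono i m xh; exists ((c * x) *: 'X_[m]); last by rewrite cE ThetaD.
  by apply: leq_trans (msizeZ_le _ _) _; rewrite msizeX.
move=> bk; rewrite -/(T b) [b]mpolyE big_seq; apply: big_ind => // m ms.
by apply: TX; apply: leq_trans (msize_mdeg_lt ms) bk.
Qed.

Theorem symbol_filtered_koszul p : (0 < p)%N ->
  ring_koszul_acyclic e -> koszul_homology_zero phi p.
Proof.
move=> p0 ac; apply: (filtered_koszul_homology_zero ThetaD ThetaK PsiK phi_lin phi_comm
  toric_symbol_pihomog0 toric_symbol_pihomogS phi_symbol p0 ac).
Qed.

End SymbolFiltration.

(** * Identification of the tensor product with S[x] *)

Section TensorToric.
Variables (K : numFieldType) (d n : nat) (A : 'M[int]_(d, n)).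
Local Notation RA := {mpoly K[n]}.
Local Notation S := (toric_ring K A).
Local Notation B := {mpoly S[n]}.
Local Notation cls := (\pi_S : RA -> S).
Local Notation tc := (toric_const K A).
Local Notation DN := (tensor (dpoly (K := K) (n := n)) S).
Local Notation "P <*> m" := (pure (dpoly (K := K) (n := n)) P (m : S)) (at level 40).

Definition poly_tensor (b : B) : DN := monomial_sum (fun m (s : S) => weyl_mono K m <*> s) b.

Lemma poly_tensorD : {morph poly_tensor : a b / a + b}.
Proof. by apply: monomial_sumD => m s s'; exact: pureDr. Qed.

Lemma poly_tensorZX s m : poly_tensor (s *: 'X_[m]) = weyl_mono K m <*> s.
Proof. by apply: monomial_sumZX => k u v; exact: pureDr. Qed.

Lemma poly_tensor0 : poly_tensor 0 = 0.
Proof. exact: monomial_sum0. Qed.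

Local Notation spoly := (symbol_poly tc (toric_var K A)).

Let weyl_symbol_poly P (r : RA) s :
  spoly (weyl_symbol (P * dpoly r)) s = spoly (weyl_symbol P) (r *: s).
Proof.
elim/mpoly_gen_ind: r P s => [c|j|p q hp hq|p q hp hq] P s.
- by rewrite dpolyC -scalerAr mulr1 weyl_symbolZ symbol_polyC.
- by rewrite dpolyXi weyl_symbolMd symbol_polyMX.
- by rewrite raddfD mulrDr weyl_symbolD symbol_polyDl hp hq scalerDl symbol_polyDr.
by rewrite rmorphM mulrA hq hp scalerA.
Qed.

(** The inverse is defined on the tensor product because right multiplication of an operator by d_j
    multiplies its symbol by the outer variable, which becomes multiplication of [s] by t_j. *)
Lemma poly_tensor_inv : exists Psi : DN -> B, cancel poly_tensor Psi.
Proof.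
have [||| Psi PsiD Psip] := @tensor_lift _ _ (dpoly (K := K) (n := n)) S B
  (fun P s => spoly (weyl_symbol P) s).
- by move=> P Q m; rewrite weyl_symbolD symbol_polyDl.
- by move=> P m m'; rewrite symbol_polyDr.
- exact: weyl_symbol_poly.
exists Psi; elim/mpolyind => [|s m b _ _ IHb].
  by rewrite poly_tensor0; apply: (addrI (Psi 0)); rewrite -PsiD !addr0.
rewrite poly_tensorD PsiD IHb; congr (_ + _).
by rewrite poly_tensorZX Psip weyl_symbol_mono symbol_polyX.
Qed.

Let img (y : DN) := exists b, poly_tensor b = y.

Let imgD x y : img x -> img y -> img (x + y).
Proof. by move=> [a <-] [b <-]; exists (a + b); rewrite poly_tensorD. Qed.

Let img_mono m s : img (weyl_mono K m <*> s).
Proof. by exists (s *: 'X_[m]); rewrite poly_tensorZX. Qed.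

Let pureZ c P s : (c *: P) <*> s = P <*> (tc c * s).
Proof.
by rewrite -[_ * s]/(c%:MP *: s) -pureM /= dpolyC -scalerAr mulr1.
Qed.

Let pured P j s : (P * wd K j) <*> s = P <*> (toric_var K A j * s).
Proof. by rewrite -[_ * s]/('X_j *: s) -pureM /= dpolyXi. Qed.

(** The derivations are moved to the right of the monomials in x, where they cross the tensor sign
    and become multiplication by t_j. *)
Let imgZ (P : weyl K n) y : img y -> img (P *: y).
Proof.
move=> [b <-]; elim/weyl_ind: P b => [c|j|j|P Q IHP IHQ|P Q IHP IHQ] b.
- elim/mpolyind: b => [|s m b _ _ IHb].
    by rewrite poly_tensor0 scaler0 -poly_tensor0; exists 0.
  rewrite poly_tensorD scalerDr; apply: imgD => //.
  rewrite poly_tensorZX scale_pure -scalerAl mul1r pureZ; exact: img_mono.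
- elim/mpolyind: b => [|s m b _ _ IHb].
    by rewrite poly_tensor0 scaler0 -poly_tensor0; exists 0.
  rewrite poly_tensorD scalerDr; apply: imgD => //.
  rewrite poly_tensorZX scale_pure wx_mono; exact: img_mono.
- elim/mpolyind: b => [|s m b _ _ IHb].
    by rewrite poly_tensor0 scaler0 -poly_tensor0; exists 0.
  rewrite poly_tensorD scalerDr; apply: imgD => //.
  rewrite poly_tensorZX scale_pure wd_mono pureDl pured pureZ.
  apply: imgD; exact: img_mono.
- by rewrite scalerDl; apply: imgD; [apply: IHP | apply: IHQ].
by rewrite -scalerA; have [b' <-] := IHQ b; apply: IHP.
Qed.

Lemma poly_tensor_surj y : img y.
Proof.
elim/tensor_ind: y => [|x y|P m]; [by exists 0; rewrite poly_tensor0 | exact: imgD |].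
rewrite -[P]mulr1 -scale_pure; apply: imgZ; rewrite -(weyl_mono0 K n); exact: img_mono.
Qed.

Let weyl_mono_homog (m : 'X_{1..n}) : exists u, weyl_homog A u (weyl_mono K m).
Proof.
rewrite /weyl_mono /mmap1; elim/big_ind: _ => [|P Q [u hu] [v hv]|j _].
- by exists 0; rewrite -[1]scale1r; exact: weyl_homogC.
- by exists (u + v); exact: weyl_homogM.
elim: (m j) => [|k [u hu]]; first by exists 0; rewrite expr0 -[1]scale1r; exact: weyl_homogC.
by exists (col j A + u); rewrite exprS; apply: weyl_homogM => //; exact: weyl_homog_x.
Qed.

Variable beta : 'cV[K]_d.
Local Notation g := (toric_grading K A).
Local Notation endo := (euler_endo g beta).
Local Notation e := (toric_symbol A (toric_var K A)).

Let symbol_mono i s m : poly_tensor (e i * (s *: 'X_[m])) = (weyl_mono K m * euler K A i) <*> s.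
Proof.
have pure_sum (I : Type) (r : seq I) (F : I -> weyl K n) :
    (\sum_(j <- r) F j) <*> s = \sum_(j <- r) (F j) <*> s.
  by elim: r => [|j r IHr]; rewrite ?big_nil ?pure0l // !big_cons pureDl IHr.
have Theta_sum (I : Type) (r : seq I) (F : I -> B) :
    poly_tensor (\sum_(j <- r) F j) = \sum_(j <- r) poly_tensor (F j).
  exact: (big_morph _ poly_tensorD poly_tensor0).
rewrite /toric_symbol /euler_symbol /euler mulr_suml mulr_sumr Theta_sum pure_sum.
apply: eq_bigr => j _; rewrite /poly_var symbol_termE poly_tensorZX.
rewrite -[weyl_mono K m * (_ *: _)]scalerAr [weyl_mono K m * (_ * _)]mulrA mono_wx.
by rewrite pureZ pured rmorph_int.
Qed.

(** Moving the Euler operator to the right of x^m yields the degree of x^m as a scalar, which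
    cancels the same part of the degree subtracted in the action. Only the degree [v] of [s] and
    [beta] remain. *)
Let endo_mono i v s m : toric_part v s = s ->
  endo i (weyl_mono K m <*> s) =
  (weyl_mono K m * euler K A i) <*> s + weyl_mono K m <*> (tc (- (v i 0)%:~R - beta i 0) * s).
Proof.
move=> hs; have [u hu] := weyl_mono_homog m.
have hy : tensor_homog g (u + v) (weyl_mono K m <*> s) by apply: tensor_homog_pure.
rewrite /euler_endo (euler_actionP _ hy) -scalerBl scale_pure.
rewrite -pureZ -pureDl; congr (_ <*> _).
rewrite !mulrBl (euler_homog i hu) -scalerAl mul1r scalerBl scaleNr mxE intrD mulrDl.
rewrite opprD !scaler_int !mulrzl; rewrite !addrA addrK.
by [].
Qed.

Let toric_hom (s : S) := exists v, toric_part v s = s.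

Let toric_hom_gen s :
  exists2 r : seq S, (forall x, x \in r -> toric_hom x) & s = \sum_(x <- r) x.
Proof.
have [r [_ _ sE]] := toric_part_sum s; exists [seq toric_part v s | v <- r].
  by move=> x /mapP [v _ ->]; exists v; rewrite toric_partK eqxx.
by rewrite big_map.
Qed.

Let poly_tensor_mono i s m : toric_hom s -> exists c : S,
  endo i (poly_tensor (s *: 'X_[m])) =
  poly_tensor (e i * (s *: 'X_[m])) + poly_tensor ((c * s) *: 'X_[m]).
Proof.
case=> v hv; exists (tc (- (v i 0)%:~R - beta i 0)).
by rewrite symbol_mono !poly_tensorZX (endo_mono _ _ hv).
Qed.

Theorem euler_koszul_homology_of_symbol p : (0 < p)%N ->
  ring_koszul_acyclic e -> euler_koszul_homology_zero g beta p.
Proof.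
have [Psi ThetaK] := poly_tensor_inv.
have PsiK : cancel Psi poly_tensor.
  by move=> y; have [b <-] := poly_tensor_surj y; rewrite ThetaK.
exact: (symbol_filtered_koszul poly_tensorD ThetaK PsiK (euler_endo_linear g beta)
  (euler_endo_comm g beta) toric_hom_gen poly_tensor_mono).
Qed.

End TensorToric.

Local Open Scope complex_scope.

Theorem corollary4p6 (R : realType) (d n : nat) (A : 'M[int]_(d, n))
    (A_positive : positive_semigroup A)
    (A_full : forall v : 'cV[int]_d, in_ZA A v)
    (SA_CM : cohen_macaulay (toric_ring R[i] A)) :
  forall (beta : 'cV[R[i]]_d) (p : nat), (0 < p)%N ->
    euler_koszul_homology_zero (toric_grading R[i] A) beta p.
Proof.
move=> beta p p0; apply: euler_koszul_homology_of_symbol => //.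
exact: toric_koszul_acyclic.
Qed.
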